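(* Let $\mathcal{H}$ be a complex, separable, infinite-dimensional Hilbert space. Suppose that for an operator family $\mathcal{S}=\{S_\gamma\}_{\gamma\in\mathcal{G}}\subset\mathfrak{R}(\mathcal{H})$, with an index set $\mathcal{G}$ of arbitrary cardinality, there exists an orthonormal sequence $\{e_n\}_{n=1}^\infty$ in $\mathcal{H}$ such that $$\lim_{n\to\infty}\sup_{\gamma\in\mathcal{G}}\left\|S_\gamma e_n\right\|_{\mathcal{H}}=0,\qquad \lim_{n\to\infty}\sup_{\gamma\in\mathcal{G}}\left\|(S_\gamma)^*e_n\right\|_{\mathcal{H}}=0.$$ Then there exists a unitary operator $U\colon\mathcal{H}\to L^2$ such that all the operators $T_\gamma=US_\gamma U^{-1}$ $(\gamma\in\mathcal{G})$ and their linear combinations are bi-Carleman operators on $L^2$, whose kernels are $K^\infty$ kernels of Mercer type.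
   Context: $\mathfrak{R}(\mathcal{H})$ is the algebra of bounded linear operators on $\mathcal{H}$. $L^2=L^2(\mathbb{R})$ is the complex Hilbert space with $\langle f,g\rangle_{L^2}=\int_{\mathbb{R}}f\overline{g}\,ds$. A unitary operator $U\colon\mathcal{H}\to L^2$ is a bounded linear surjection with $\langle Uf,Ug\rangle_{L^2}=\langle f,g\rangle_{\mathcal{H}}$ for all $f,g$. Linear combinations are finite. For $T\in\mathfrak{R}(L^2)$, $$\mathcal{M}(T)=\left(T\mathfrak{R}(L^2)\cup T^*\mathfrak{R}(L^2)\right)\cap\left(\mathfrak{R}(L^2)T\cup\mathfrak{R}(L^2)T^*\right),$$ where $S\mathfrak{R}(L^2)=\{SA\mid A\in\mathfrak{R}(L^2)\}$ and $\mathfrak{R}(L^2)S=\{AS\mid A\in\mathfrak{R}(L^2)\}$. A linear operator $T\colon L^2\to L^2$ is integral with kernel $\boldsymbol{T}$ if $\boldsymbol{T}\colon\mathbb{R}^2\to\mathbb{C}$ is measurable and $(Tf)(s)=\int_{\mathbb{R}}\boldsymbol{T}(s,t)f(t)\,dt$ for every $f\in L^2$ and almost every $s$. A kernel $\boldsymbol{T}$ is Carleman if $\boldsymbol{T}(s,\cdot)\in L^2$ for almost every $s$; it is bi-Carleman if also $\boldsymbol{T}'(s,t)=\overline{\boldsymbol{T}(t,s)}$ is Carleman. A bi-Carleman operator is an integral operator whose kernel is bi-Carleman. The Carleman functions associated with a bi-Carleman kernel $\boldsymbol{T}$ are $\boldsymbol{t}(s)=\overline{\boldsymbol{T}(s,\cdot)}$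 and $\boldsymbol{t}'(s)=\overline{\boldsymbol{T}'(s,\cdot)}=\boldsymbol{T}(\cdot,s)$, with values in $L^2$. For a locally compact space $X$ and a Banach space $B$, $C(X,B)$ is the Banach space of continuous functions $X\to B$ vanishing at infinity, with the sup norm. A bi-Carleman kernel $\boldsymbol{T}\colon\mathbb{R}^2\to\mathbb{C}$ is a $K^\infty$ kernel if: (i) $\boldsymbol{T}$ and all its partial derivatives of all orders are in $C(\mathbb{R}^2,\mathbb{C})$; (ii) $\boldsymbol{t}$ and its strong (norm) derivatives $\boldsymbol{t}^{(i)}$ of all orders are in $C(\mathbb{R},L^2)$; (iii) $\boldsymbol{t}'$ and its strong derivatives $(\boldsymbol{t}')^{(i)}$ of all orders are in $C(\mathbb{R},L^2)$. A $K^\infty$ kernel $\boldsymbol{T}$ inducing the integral operator $T$ on $L^2$ is of Mercer type if every operator belonging to $\mathcal{M}(T)$ is an integral operator with a $K^\infty$ kernel. *)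

(* Defs.v *)
From HB Require Import structures.
From mathcomp Require Import all_boot all_order all_algebra sesquilinear.
From mathcomp Require Import generic_quotient.
From mathcomp Require Import all_classical all_reals all_analysis.
From mathcomp Require Import measurable_realfun complex.
From mathcomp Require Import ring lra.
Set Implicit Arguments.
Unset Strict Implicit.
Unset Printing Implicit Defensive.
Import Order.TTheory GRing.Theory Num.Theory.
Import numFieldNormedType.Exports.
Import Normc.
Local Open Scope classical_set_scope.
Local Open Scope ring_scope.
Local Open Scope complex_scope.

Local Notation Re := (@complex.Re _).
Local Notation Im := (@complex.Im _).

(* R[i] is the field of complex numbers over R; inner products are linear in
   the first argument, and norms are R[i]-valued (with zero imaginary part). *)
HB.mixin Record NormedModule_hasInner (R : realType) H
    of NormedModule R[i] H := {
  inner : {dot H for @Num.conj R[i]};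
  inner_norm : forall x : H, `|x| ^+ 2 = inner x x
}.

#[short(type="preHilbertType")]
HB.structure Definition PreHilbert (R : realType) :=
  {H of NormedModule_hasInner R H & NormedModule R[i] H}.

#[short(type="hilbertType")]
HB.structure Definition Hilbert (R : realType) :=
  {H of PreHilbert R H & CompleteNormedModule R[i] H}.

Section dot_triangle.
Variables (C : numClosedFieldType) (U : lmodType C).
Variable form : {dot U for @Num.conj C}.

Lemma dot_CauchySchwarz u v :
  `|form u v| <= sqrtC (form u u) * sqrtC (form v v).
Proof.
rewrite -(sqrCK (normr_ge0 _)) -sqrtCM ?nnegrE ?dnorm_ge0//.
rewrite ler_sqrtC ?nnegrE ?exprn_ge0 ?mulr_ge0 ?dnorm_ge0//.
have [->|v0] := eqVneq v 0; first by rewrite (linear0r form u) (linear0r form 0) normr0 expr0n/= mulr0.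
have vv0 : form v v != 0 by rewrite dnorm_eq0.
pose a := form u v / form v v; pose w := u - a *: v.
have wv : form w v = 0 by rewrite linearBl/= linearZl_LR/= divfK// subrr.
rewrite -(subrK (a *: v) u) -/w hnormDd; last first.
  by rewrite linearZr_LR/= wv mulr0.
rewrite linearDl/= wv add0r linearZl_LR/= dnormZ normrM exprMn.
rewrite (ger0_norm (dnorm_ge0 _ v)) [leRHS]mulrDl.
rewrite -[X in _ <= _ + X]mulrA -expr2.
by rewrite lerDr mulr_ge0 ?dnorm_ge0.
Qed.

Lemma dot_triangle u v :
  sqrtC (form (u + v) (u + v)) <= sqrtC (form u u) + sqrtC (form v v).
Proof.
rewrite -ler_sqr ?nnegrE ?addr_ge0 ?sqrtC_ge0 ?dnorm_ge0//.
rewrite sqrrD !sqrtCK addrAC dnormD lerD2l.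
have -> : form u v + Num.conj (form u v) = 'Re (form u v) *+ 2.
  by rewrite ReE -mulr_natr divfK ?pnatr_eq0.
rewrite lerMn2r/=; apply: le_trans (dot_CauchySchwarz u v).
by rewrite leif_Re_Creal.
Qed.

End dot_triangle.

Section complex_integral.
Context d (T : measurableType d) (R : realType).
Variable mu : {measure set T -> \bar R}.
Implicit Types f g : T -> R[i].

Definition cmeasurable f :=
  measurable_fun [set: T] (Re \o f) /\ measurable_fun [set: T] (Im \o f).

Definition cintegrable f :=
  mu.-integrable [set: T] (EFin \o (Re \o f)) /\
  mu.-integrable [set: T] (EFin \o (Im \o f)).

(* meaningful only for cintegrable f *)
Definition cintegral f : R[i] :=
  (\int[mu]_x Re (f x)) +i* (\int[mu]_x Im (f x)).

Definition square_integrable f :=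
  cmeasurable f /\ (\int[mu]_x (normc (f x) ^+ 2)%:E < +oo)%E.

Lemma normc_sqr (z : R[i]) : normc z ^+ 2 = Re z ^+ 2 + Im z ^+ 2.
Proof. by case: z => a b /=; rewrite sqr_sqrtr// addr_ge0// sqr_ge0. Qed.

Lemma cmeasurable0 : cmeasurable (fun=> 0).
Proof. by split; exact: measurable_cst. Qed.

Lemma cmeasurableD f g :
  cmeasurable f -> cmeasurable g -> cmeasurable (fun x => f x + g x).
Proof.
move=> [f1 f2] [g1 g2]; split.
- rewrite [X in measurable_fun _ X](_ : _ = (Re \o f) \+ (Re \o g)).
    exact: measurable_funD.
  by apply/funext => x /=; case: (f x); case: (g x).
- rewrite [X in measurable_fun _ X](_ : _ = (Im \o f) \+ (Im \o g)).
    exact: measurable_funD.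
  by apply/funext => x /=; case: (f x); case: (g x).
Qed.

Lemma cmeasurableM f g :
  cmeasurable f -> cmeasurable g -> cmeasurable (fun x => f x * g x).
Proof.
move=> [f1 f2] [g1 g2]; split.
- rewrite [X in measurable_fun _ X](_ : _ =
    ((Re \o f) \* (Re \o g)) \- ((Im \o f) \* (Im \o g))).
    by apply: measurable_funB; apply: measurable_funM.
  by apply/funext => x /=; case: (f x); case: (g x).
- rewrite [X in measurable_fun _ X](_ : _ =
    ((Re \o f) \* (Im \o g)) \+ ((Im \o f) \* (Re \o g))).
    by apply: measurable_funD; apply: measurable_funM.
  by apply/funext => x /=; case: (f x); case: (g x).
Qed.

Lemma cmeasurableZ (a : R[i]) f :
  cmeasurable f -> cmeasurable (fun x => a * f x).
Proof. by apply: cmeasurableM; split; exact: measurable_cst. Qed.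

Lemma cmeasurableJ f :
  cmeasurable f -> cmeasurable (fun x => Num.conj (f x)).
Proof.
move=> [f1 f2]; split.
- rewrite [X in measurable_fun _ X](_ : _ = Re \o f)//.
  by apply/funext => x /=; case: (f x).
- rewrite [X in measurable_fun _ X](_ : _ = \- (Im \o f)).
    exact: measurable_funN.
  by apply/funext => x /=; case: (f x).
Qed.


Lemma normc_ge0 (z : R[i]) : 0 <= normc z.
Proof. by case: z => a b /=; exact: sqrtr_ge0. Qed.

Lemma normc_normr (z : R[i]) : `|z| = (normc z)%:C.
Proof.
rewrite [LHS]normc_def; congr (_%:C); rewrite -normc_sqr.
by rewrite sqrtr_sqr ger0_norm// normc_ge0.
Qed.

Lemma ge0_normc_Re (z : R[i]) : `|Re z| <= normc z.
Proof.
rewrite -[leRHS]ger0_norm ?normc_ge0// -!sqrtr_sqr ler_wsqrtr//.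
by rewrite normc_sqr lerDl sqr_ge0.
Qed.

Lemma ge0_normc_Im (z : R[i]) : `|Im z| <= normc z.
Proof.
rewrite -[leRHS]ger0_norm ?normc_ge0// -!sqrtr_sqr ler_wsqrtr//.
by rewrite normc_sqr lerDr sqr_ge0.
Qed.

Lemma measurable_normc_sqr f :
  cmeasurable f -> measurable_fun [set: T] (fun x => normc (f x) ^+ 2).
Proof.
move=> [f1 f2].
rewrite [X in measurable_fun _ X](_ : _ =
    (fun x => (Re \o f) x ^+ 2) \+ (fun x => (Im \o f) x ^+ 2)).
  by apply: measurable_funD; exact: measurable_funX.
by apply/funext => x /=; rewrite normc_sqr.
Qed.

Lemma square_integrableE f :
  square_integrable f <->
  cmeasurable f /\ mu.-integrable [set: T] (fun x => (normc (f x) ^+ 2)%:E).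
Proof.
have absE : (\int[mu]_x `|(normc (f x) ^+ 2)%:E| =
    \int[mu]_x (normc (f x) ^+ 2)%:E)%E.
  by apply: eq_integral => x _; rewrite gee0_abs// lee_fin sqr_ge0.
split=> -[mf h]; split=> //.
  apply/integrableP; split; first exact/measurable_EFinP/measurable_normc_sqr.
  by rewrite absE.
by move/integrableP : h => [_]; rewrite absE.
Qed.

Lemma cintegrable_le f (b : T -> R) : cmeasurable f ->
  mu.-integrable [set: T] (EFin \o b) -> (forall x, normc (f x) <= b x) ->
  cintegrable f.
Proof.
move=> [f1 f2] ib fb; split.
- apply: le_integrable ib => //; first exact/measurable_EFinP.
  move=> x _ /=; rewrite lee_fin (le_trans (ge0_normc_Re _))//.
  by rewrite (le_trans (fb x))// ler_norm.
- apply: le_integrable ib => //; first exact/measurable_EFinP.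
  move=> x _ /=; rewrite lee_fin (le_trans (ge0_normc_Im _))//.
  by rewrite (le_trans (fb x))// ler_norm.
Qed.

Lemma normcJ (z : R[i]) : normc (Num.conj z) = normc z.
Proof. by case: z => a b /=; rewrite sqrrN. Qed.

Lemma square_integrable0 : square_integrable (fun=> 0).
Proof.
split; first exact: cmeasurable0.
by under eq_integral do rewrite normc0 expr0n; rewrite integral0.
Qed.

Lemma square_integrableD f g : square_integrable f -> square_integrable g ->
  square_integrable (fun x => f x + g x).
Proof.
move=> /square_integrableE[mf fi] /square_integrableE[mg gi].
apply/square_integrableE; split; first exact: cmeasurableD.
have h := integrableD measurableT (integrableZl measurableT 2 fi)
  (integrableZl measurableT 2 gi).
apply: le_integrable h => //.
  exact/measurable_EFinP/measurable_normc_sqr/cmeasurableD.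
move=> x _ /=; rewrite lee_fin !ger0_norm ?sqr_ge0//; last first.
  by rewrite addr_ge0// mulr_ge0// sqr_ge0.
rewrite !normc_sqr; case: (f x) => a b; case: (g x) => a' b' /=.
rewrite -subr_ge0.
rewrite [X in 0 <= X](_ : _ = (a - a') ^+ 2 + (b - b') ^+ 2); last by ring.
by rewrite addr_ge0// sqr_ge0.
Qed.

Lemma square_integrableZ (a : R[i]) f : square_integrable f ->
  square_integrable (fun x => a * f x).
Proof.
move=> /square_integrableE[mf fi].
apply/square_integrableE; split; first exact: cmeasurableZ.
have h := integrableZl measurableT (normc a ^+ 2) fi.
apply: eq_integrable h => //.
by move=> x _ /=; rewrite normcM exprMn.
Qed.

Lemma cintegrableMJ f g : square_integrable f -> square_integrable g ->
  cintegrable (fun x => f x * Num.conj (g x)).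
Proof.
move=> /square_integrableE[mf fi] /square_integrableE[mg gi].
apply: (@cintegrable_le _ (fun x => normc (f x) ^+ 2 + normc (g x) ^+ 2)).
- by apply: cmeasurableM => //; exact: cmeasurableJ.
- by apply: eq_integrable (integrableD measurableT fi gi).
- move=> x; rewrite normcM normcJ.
  have := normc_ge0 (f x); have := normc_ge0 (g x).
  move: (normc _) (normc _) => a b a0 b0; rewrite -subr_ge0.
  rewrite [X in 0 <= X](_ : _ = (b - a) ^+ 2 + b * a); last by ring.
  by rewrite addr_ge0 ?sqr_ge0 ?mulr_ge0.
Qed.

Lemma cintegralD f g : cintegrable f -> cintegrable g ->
  cintegral (fun x => f x + g x) = cintegral f + cintegral g.
Proof.
move=> [f1 f2] [g1 g2]; rewrite /cintegral /=; congr (_ +i* _).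
- rewrite -RintegralD//; apply: eq_Rintegral => x _.
  by case: (f x); case: (g x).
- rewrite -RintegralD//; apply: eq_Rintegral => x _.
  by case: (f x); case: (g x).
Qed.

Lemma cintegralZ (a : R[i]) f : cintegrable f ->
  cintegral (fun x => a * f x) = a * cintegral f.
Proof.
case: a => a b [f1 f2]; rewrite /cintegral /=.
have Z c (h : T -> R) : mu.-integrable [set: T] (EFin \o h) ->
    mu.-integrable [set: T] (EFin \o (fun x => c * h x)).
  by move=> hi; apply: eq_integrable (integrableZl measurableT c hi).
congr (_ +i* _).
- rewrite -!RintegralZl// -RintegralB//; try exact: Z.
  by apply: eq_Rintegral => x _; case: (f x).
- rewrite -!RintegralZl// -RintegralD//; try exact: Z.
  by apply: eq_Rintegral => x _; case: (f x).
Qed.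

Lemma cintegralJ f : cintegrable f ->
  cintegral (fun x => Num.conj (f x)) = Num.conj (cintegral f).
Proof.
move=> [f1 f2]; rewrite /cintegral /=; congr (_ +i* _).
- by apply: eq_Rintegral => x _; case: (f x).
- rewrite -mulN1r -RintegralZl//.
  by apply: eq_Rintegral => x _; case: (f x) => a b /=; rewrite mulN1r.
Qed.

Lemma ae_eq_cintegral f g : cmeasurable f -> cmeasurable g ->
  {ae mu, forall x, f x = g x} -> cintegral f = cintegral g.
Proof.
move=> [f1 f2] [g1 g2] fg; rewrite /cintegral /Rintegral.
congr (fine _ +i* fine _); apply: ae_eq_integral => //;
  do ?exact/measurable_EFinP.
- by apply: filterS fg => x -> _.
- by apply: filterS fg => x -> _.
Qed.

End complex_integral.

Section L2_space.
Context d (T : measurableType d) (R : realType).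
Variable mu : {measure set T -> \bar R}.

(* L2 mu is the quotient of the complex square integrable functions by almost
   everywhere equality; an element of L2 mu is applied to a point through a
   representative of its class. *)
Definition L2pred : {pred T -> R[i]^o} := fun f => `[< square_integrable mu f >].

Lemma L2pred_submod_closed : submod_closed L2pred.
Proof.
split; first exact/asboolP/square_integrable0.
move=> a f g /asboolP fi /asboolP gi; apply/asboolP.
apply: (@square_integrableD _ _ _ mu (fun x => a * f x) g) => //.
exact: square_integrableZ.
Qed.

HB.instance Definition _ :=
  GRing.isSubmodClosed.Build R[i] (T -> R[i]^o) L2pred L2pred_submod_closed.

Record L2fun := MkL2fun {
  L2fun_val :> T -> R[i]^o ;
  L2fun_valP : L2fun_val \in L2pred }.

HB.instance Definition _ := [isSub for L2fun_val].
HB.instance Definition _ := [Choice of L2fun by <:].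
HB.instance Definition _ := [SubChoice_isSubLmodule of L2fun by <:].

Lemma L2funP (f : L2fun) : square_integrable mu f.
Proof. exact/asboolP/(L2fun_valP f). Qed.

Definition L2fun_equiv (f g : L2fun) : bool :=
  `[< {ae mu, forall x, f x = g x} >].

Lemma L2fun_equiv_is_equiv : equiv_class_of L2fun_equiv.
Proof.
split.
- by move=> f; apply/asboolP; exact: nearW.
- by move=> f g; apply/asboolP/asboolP; apply: filterS => x ->.
- move=> g f h /asboolP fg /asboolP gh; apply/asboolP.
  by near=> x; rewrite (near fg x)// (near gh x).
Unshelve. all: by end_near. Qed.

Canonical L2fun_equiv_equiv := EquivRelPack L2fun_equiv_is_equiv.
Canonical L2fun_equiv_encModRel := defaultEncModRel L2fun_equiv.

Local Open Scope quotient_scope.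

Definition L2 : Type := {eq_quot L2fun_equiv}.
HB.instance Definition _ := Choice.on L2.
HB.instance Definition _ : EqQuotient L2fun L2fun_equiv L2 := EqQuotient.on L2.

Definition L2_fun (x : L2) : T -> R[i] := repr x.
Coercion L2_fun : L2 >-> Funclass.

Lemma L2_eqP (f g : L2fun) :
  reflect {ae mu, forall x, f x = g x} (f == g %[mod L2]).
Proof. by rewrite eqmodE; exact: asboolP. Qed.

Lemma L2_reprK (f : L2fun) : {ae mu, forall x, repr (\pi_L2 f) x = f x}.
Proof. by apply/L2_eqP; rewrite reprK. Qed.

Definition L2zero : L2 := \pi_L2 0.
Definition L2add (x y : L2) : L2 := \pi_L2 (repr x + repr y).
Definition L2opp (x : L2) : L2 := \pi_L2 (- repr x).
Definition L2scale (a : R[i]) (x : L2) : L2 := \pi_L2 (a *: repr x).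

Lemma pi_L2add (f g : L2fun) : L2add (\pi f) (\pi g) = \pi_L2 (f + g).
Proof.
apply/eqP/L2_eqP; have := L2_reprK f; have := L2_reprK g.
by apply: filterS2 => x /= gE fE; rewrite /= -[LHS]/(_ + _) fE gE.
Qed.

Lemma pi_L2opp (f : L2fun) : L2opp (\pi f) = \pi_L2 (- f).
Proof.
apply/eqP/L2_eqP; have := L2_reprK f.
by apply: filterS => x /= fE; rewrite -[LHS]/(- _) fE.
Qed.

Lemma pi_L2scale a (f : L2fun) : L2scale a (\pi f) = \pi_L2 (a *: f).
Proof.
apply/eqP/L2_eqP; have := L2_reprK f.
by apply: filterS => x /= fE; rewrite -[LHS]/(_ *: _) fE.
Qed.

Lemma L2addA : associative L2add.
Proof.
by elim/quotW => f; elim/quotW => g; elim/quotW => h; rewrite !pi_L2add addrA.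
Qed.

Lemma L2addC : commutative L2add.
Proof. by elim/quotW => f; elim/quotW => g; rewrite !pi_L2add addrC. Qed.

Lemma L2add0 : left_id L2zero L2add.
Proof. by elim/quotW => f; rewrite pi_L2add add0r. Qed.

Lemma L2addN : left_inverse L2zero L2opp L2add.
Proof. by elim/quotW => f; rewrite pi_L2opp pi_L2add addNr. Qed.

HB.instance Definition _ :=
  GRing.isZmodule.Build L2 L2addA L2addC L2add0 L2addN.

Lemma L2scaleA a b x : L2scale a (L2scale b x) = L2scale (a * b) x.
Proof. by elim/quotW: x => f; rewrite !pi_L2scale scalerA. Qed.

Lemma L2scale1 : left_id 1 L2scale.
Proof. by elim/quotW => f; rewrite !pi_L2scale scale1r. Qed.

Lemma L2scaleDr : right_distributive L2scale +%R.
Proof.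
move=> a; elim/quotW => f; elim/quotW => g.
by rewrite -[LHS]/(L2scale _ (L2add _ _)) -[RHS]/(L2add _ _)
  !(pi_L2add, pi_L2scale) scalerDr.
Qed.

Lemma L2scaleDl x : {morph L2scale^~ x : a b / a + b}.
Proof.
elim/quotW: x => f a b.
by rewrite -[RHS]/(L2add _ _) !(pi_L2add, pi_L2scale) scalerDl.
Qed.

HB.instance Definition _ :=
  GRing.Zmodule_isLmodule.Build R[i] L2 L2scaleA L2scale1 L2scaleDr L2scaleDl.

Definition L2inner (x y : L2) : R[i] :=
  cintegral mu (fun s => repr x s * Num.conj (repr y s)).

Lemma L2inner_pi (f g : L2fun) : L2inner (\pi f) (\pi g) =
  cintegral mu (fun s => (f s : R[i]) * Num.conj (g s)).
Proof.
have [mf _] := L2funP f; have [mg _] := L2funP g.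
have [mf' _] := L2funP (repr (\pi_L2 f)).
have [mg' _] := L2funP (repr (\pi_L2 g)).
apply: ae_eq_cintegral.
- by apply: cmeasurableM => //; exact: cmeasurableJ.
- by apply: cmeasurableM => //; exact: cmeasurableJ.
- have := L2_reprK f; have := L2_reprK g.
  by apply: filterS2 => x /= -> ->.
Qed.

Lemma L2innerPl (z : L2) a : {morph L2inner^~ z : x y / a *: x + y >-> a * x + y}.
Proof.
elim/quotW: z => h; elim/quotW => f; elim/quotW => g.
rewrite -[_ *: _ + _]/(L2add (L2scale _ _) _) pi_L2scale pi_L2add !L2inner_pi.
rewrite -cintegralZ; last exact: cintegrableMJ (L2funP f) (L2funP h).
rewrite -cintegralD; last 2 first.
- rewrite [X in cintegrable _ X](_ : _ =
      (fun s => (a * f s) * Num.conj (h s))).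
    exact: cintegrableMJ (square_integrableZ a (L2funP f)) (L2funP h).
  by apply/funext => s; rewrite mulrA.
- exact: cintegrableMJ (L2funP g) (L2funP h).
by congr cintegral; apply/funext => s; rewrite mulrA -mulrDl.
Qed.

Lemma L2inner_conj x y : L2inner x y = (-1) ^+ false * Num.conj (L2inner y x).
Proof.
rewrite expr0 mul1r; elim/quotW: y => g; elim/quotW: x => f.
rewrite !L2inner_pi -cintegralJ; last exact: cintegrableMJ (L2funP g) (L2funP f).
by congr cintegral; apply/funext => s; rewrite rmorphM/= conjCK mulrC.
Qed.

Lemma L2inner_diag (f : L2fun) : L2inner (\pi f) (\pi f) =
  (\int[mu]_s (normc (f s) ^+ 2))%:C.
Proof.
rewrite L2inner_pi /cintegral; congr (_ +i* _).
  by apply: eq_Rintegral => s _; rewrite normc_sqr; case: (f s) => a b /=; ring.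
transitivity (\int[mu]_s (0 : R)); last by rewrite /Rintegral integral0.
by apply: eq_Rintegral => s _; case: (f s) => a b /=; ring.
Qed.

Lemma L2inner_gt0 x : x != 0 -> 0 < L2inner x x.
Proof.
elim/quotW: x => f; apply: contraNT; rewrite L2inner_diag => f0.
have [mf fi] := (square_integrableE mu f).1 (L2funP f).
have I0 : \int[mu]_s (normc (f s) ^+ 2) = 0.
  apply/eqP; apply: contraNT f0 => I0; rewrite ltcR lt0r I0/=.
  by apply: Rintegral_ge0 => s _; exact: sqr_ge0.
have : ae_eq mu setT (fun s => (normc (f s) ^+ 2)%:E) (cst 0%E).
  apply/ae_eq_integral_abs => //.
    exact/measurable_EFinP/measurable_normc_sqr.
  under eq_integral do rewrite gee0_abs ?lee_fin ?sqr_ge0//.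
  rewrite -[LHS]fineK ?integrable_fin_num//.
  by rewrite -[fine _]/(\int[mu]_s (normc (f s) ^+ 2)) I0.
move=> H; apply/eqP/eqP/L2_eqP; apply: filterS H => s /(_ I)[] /eqP.
by rewrite sqrf_eq0 => /eqP /eq0_normc.
Qed.

Lemma L2inner_bilinear :
  bilinear_for ( *%R : GRing.Scale.law R[i] R[i])
    ((@Num.conj R[i]) \; *%R : GRing.Scale.law R[i] R[i]) L2inner.
Proof.
split=> [z a x y|z a x y]; first exact: L2innerPl.
rewrite (L2inner_conj z) (L2inner_conj z x) (L2inner_conj z y).
by rewrite !expr0 !mul1r L2innerPl rmorphD rmorphM.
Qed.

HB.instance Definition _ := bilinear_isBilinear.Build R[i] L2 L2 R[i]
  *%R (@Num.conj R[i] \; *%R) L2inner L2inner_bilinear.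

HB.instance Definition _ := isHermitianSesquilinear.Build R[i] L2
  false (@Num.conj R[i]) L2inner L2inner_conj.

HB.instance Definition _ := isDotProduct.Build R[i] L2 L2inner L2inner_gt0.

Definition L2norm (x : L2) : R[i] := sqrtC (L2inner x x).

Lemma L2normD x y : L2norm (x + y) <= L2norm x + L2norm y.
Proof. exact: (dot_triangle L2inner). Qed.

Lemma L2normZ (a : R[i]) x : L2norm (a *: x) = `|a| * L2norm x.
Proof.
by rewrite /L2norm dnormZ sqrtCM ?nnegrE ?exprn_ge0 ?dnorm_ge0// sqrCK.
Qed.

Lemma L2norm_eq0 x : L2norm x = 0 -> x = 0.
Proof. by move/eqP; rewrite sqrt_dnorm_eq0 => /eqP. Qed.

HB.instance Definition _ :=
  Lmodule_isNormed.Build R[i] L2 L2normD L2normZ L2norm_eq0.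

Lemma L2inner_norm (x : L2) : `|x| ^+ 2 = L2inner x x.
Proof. exact: sqrtCK. Qed.

HB.instance Definition _ := NormedModule_hasInner.Build R L2 L2inner_norm.

End L2_space.

Section Hilbert_operators.
Variable R : realType.

Definition bounded_operator (H K : preHilbertType R) : set (H -> K) :=
  [set T | linear T /\ exists M : R, forall x, `|T x| <= M%:C * `|x|].

(* The defining relation determines A uniquely, and by Riesz representation
   such an A exists when H is complete and T is a bounded operator; the default
   value 0 is then never used. *)
Definition adjoint (H K : preHilbertType R) (T : H -> K) : K -> H :=
  xget (fun=> 0) [set A | forall x y, inner (T x) y = inner x (A y)].

Definition unitary_operator (H K : preHilbertType R) : set (H -> K) :=
  [set U | [/\ bounded_operator U, set_surj setT setT U &
    forall f g, inner (U f) (U g) = inner f g]].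

Definition separable (H : topologicalType) :=
  exists D : set H, countable D /\ dense D.

Definition infinite_dimensional (H : lmodType R[i]) :=
  ~ exists n (v : 'I_n -> H), forall x, exists c : 'I_n -> R[i],
    x = \sum_(i < n) c i *: v i.

Definition orthonormal_sequence (H : preHilbertType R) (e : nat -> H) :=
  forall m n, inner (e m) (e n) = (m == n)%:R.

(* supremum taken in [0, +oo], hence 0 for an empty family *)
Definition sup_norm (G : Type) (H : preHilbertType R) (F : G -> H) : \bar R :=
  ereal_sup ([set 0%E] `|` range (fun g => (Re `|F g|)%:E)).

(* (T B u T* B) n (B T u B T* ), with B the algebra of bounded operators *)
Definition Mset (H : preHilbertType R) (T : H -> H) : set (H -> H) :=
  ([set T \o A | A in @bounded_operator H H] `|`
   [set adjoint T \o A | A in @bounded_operator H H]) `&`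
  ([set A \o T | A in @bounded_operator H H] `|`
   [set A \o adjoint T | A in @bounded_operator H H]).

End Hilbert_operators.

Section vanishing_derivatives.
Variable R : realType.

(* continuous functions vanishing at infinity *)
Definition C0 (X : topologicalType) (B : normedModType R[i]) : set (X -> B) :=
  [set f | continuous f /\ forall eps : R, 0 < eps ->
    exists2 K : set X, compact K & forall x, ~ K x -> `|f x| < eps%:C].

(* derivative with respect to the norm of B *)
Definition has_deriv (B : normedModType R[i]) (f : R -> B) (s : R) (l : B) :=
  (h^-1)%:C *: (f (s + h) - f s) @[h --> (0 : R)^'] --> l.

(* f is infinitely differentiable, and D n is its n-th derivative *)
Definition C0_derivatives (B : normedModType R[i]) (f : R -> B) :=
  exists D : nat -> R -> B, [/\ D 0%N = f,
    forall n s, has_deriv (D n) s (D n.+1 s) &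
    forall n, C0 (D n)].

(* D w is the iterated partial derivative of f along the word w, the head of
   w being the last differentiation: false for the first variable, true for
   the second. *)
Definition C0_partial_derivatives (B : normedModType R[i]) (f : R * R -> B) :=
  exists D : seq bool -> R * R -> B, [/\ D [::] = f,
    forall w p, has_deriv (fun s => D w (s, p.2)) p.1 (D (false :: w) p),
    forall w p, has_deriv (fun t => D w (p.1, t)) p.2 (D (true :: w) p) &
    forall w, C0 (D w)].

End vanishing_derivatives.

Section kernels.
Variable R : realType.

Local Notation mu := (@lebesgue_measure R).
Notation L2R := (L2 mu).

Implicit Types (K : R * R -> R[i]^o) (T : L2R -> L2R).

Definition adjoint_kernel K : R * R -> R[i]^o :=
  fun p => Num.conj (K (p.2, p.1) : R[i]).

(* the integral is a Lebesgue integral, required to converge *)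
Definition integral_operator K T :=
  [/\ linear T, cmeasurable K &
    forall f : L2R, {ae mu, forall s,
      cintegrable mu (fun t => K (s, t) * f t) /\
      T f s = cintegral mu (fun t => K (s, t) * f t)}].

Definition Carleman_kernel K :=
  cmeasurable K /\ {ae mu, forall s, square_integrable mu (fun t => K (s, t))}.

Definition biCarleman_kernel K :=
  Carleman_kernel K /\ Carleman_kernel (adjoint_kernel K).

Definition biCarleman_operator K T :=
  biCarleman_kernel K /\ integral_operator K T.

Definition L2_class (x : L2R) (f : R -> R[i]) :=
  square_integrable mu f /\ {ae mu, forall s, x s = f s}.

(* As t is a function from the whole of R to L2, K (s, .) is required to be
   square integrable for every s, not only for almost every s. *)
Definition Carleman_function K (t : R -> L2R) :=
  forall s, L2_class (t s) (fun x => Num.conj (K (s, x) : R[i])).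

Definition Kinf_kernel K :=
  [/\ biCarleman_kernel K,
    C0_partial_derivatives K,
    exists2 t, Carleman_function K t & C0_derivatives t &
    exists2 t', Carleman_function (adjoint_kernel K) t' & C0_derivatives t'].

Definition Mercer_type K T :=
  [/\ Kinf_kernel K, integral_operator K T &
    forall P, Mset T P -> exists2 K', Kinf_kernel K' & integral_operator K' P].

End kernels.
Notation L2R R := (L2 (@lebesgue_measure R)).

(* Main.v *)
(* Let u_n be an orthonormal basis of L^2(R) made of smooth compactly supported
   functions such that, for n even, the first n derivatives of u_n are at most
   2^-n in sup norm.  Choose weights w_n with w_n = 1 for n even and, for n odd,
   w_n so small that w_n |D^i u_n| <= c_i 2^-n for all i and n.  In H choose an
   orthonormal basis b_n which, for n odd, is a normalised small perturbation of
   some e_k with k so large that |S_g b_n| and |S_g^* b_n| are O(w_n^2), the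
   constant depending on g, and put U b_n = u_n.

   If T is a combination of the U S_g U^-1 and P = X A = B Y with X, Y in
   {T, T^*}, then |P u_n| and |P^* u_n| are O(w_n^2), so the matrix
   p_mn = <P u_n, u_m> is O(w_m w_n).  Hence the kernel
   sum_mn p_mn u_m(s) conj(u_n(t)) converges geometrically together with all its
   derivatives, and so do its Carleman functions
   t(s) = sum_m conj(u_m(s)) P^* u_m and t'(s) = sum_n conj(u_n(s)) P u_n. *)

Require Import Defs.
From mathcomp Require Import all_boot all_order all_algebra sesquilinear.
From mathcomp Require Import all_classical all_reals all_analysis.
From mathcomp Require Import measurable_realfun complex.
From mathcomp Require Import ring lra.
Set Implicit Arguments.
Unset Strict Implicit.
Unset Printing Implicit Defensive.
Import Order.TTheory GRing.Theory Num.Theory.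
Import numFieldNormedType.Exports.
Import Normc.
Local Open Scope classical_set_scope.
Local Open Scope ring_scope.
Local Open Scope complex_scope.

(** The obstacle: the operators are known to be small only along [e], which need not be complete,
    while every vector of a basis has to be controlled. The two bases therefore take turns. For n
    even, b_n is an uncontrolled vector needed for the completeness of b, and its image is a
    function that is itself tiny. For n odd, u_n is an uncontrolled function needed for the
    completeness of u, and its preimage is a vector on which the operators are tiny.

    A unit vector of L^2 can be tiny because the line has infinite length: if a bump is dilated by
    lam and normalised, its i-th derivative is of order lam^(-1/2-i).

    The square of w_n comes from passing from columns to entries: |p_mn| is at most |P u_n| and at
    most |P^* u_m|, so it is O(min(w_m, w_n)^2), which is at most O(w_m w_n).

    The form of M(T) enters at the same point: P = B Y gives P u_n = B (Y u_n), P = X A gives P^*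
    u_n = A^* (X^* u_n), and X^* lies again in {T, T^*}.

    One U serves the whole family because the index k chosen at step n makes all S_g e_k small at
    once; g enters only through the norms of S_g and its adjoint. *)

Section real_norm.
Variable R : realType.
Local Notation C := R[i].

(** Norms take values in [R[i]]; estimates are carried out with this real number, for which the
    total order is available. *)
Definition nrm (B : normedModType C) (x : B) : R := complex.Re `|x|.

Section normed.
Variable B : normedModType C.
Implicit Types x y : B.

Lemma nrmE x : `|x| = (nrm x)%:C.
Proof.
by rewrite /nrm; have := normr_ge0 x; case: `|x| => a b; rewrite lecE/= => /andP[/eqP-> _].
Qed.

Lemma nrm_ge0 x : 0 <= nrm x.
Proof. by have := normr_ge0 x; rewrite nrmE lecR. Qed.

Lemma nrm0 : nrm (0 : B) = 0.
Proof. by rewrite /nrm normr0. Qed.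

Lemma nrm_eq0 x : (nrm x == 0) = (x == 0).
Proof. by rewrite -(@normr_eq0 _ _ x) nrmE fmorph_eq0. Qed.

Lemma nrmD x y : nrm (x + y) <= nrm x + nrm y.
Proof. by rewrite -lecR rmorphD/= -!nrmE ler_normD. Qed.

Lemma nrmN x : nrm (- x) = nrm x.
Proof. by rewrite /nrm normrN. Qed.

Lemma nrmB x y : nrm (x - y) = nrm (y - x).
Proof. by rewrite -nrmN opprB. Qed.

Lemma nrmZ (a : C) x : nrm (a *: x) = normc a * nrm x.
Proof.
apply: (@complexI R); rewrite -nrmE rmorphM/= normrZ nrmE.
by rewrite normc_normr.
Qed.

Lemma nrm_le_sub x y : nrm x <= nrm y + nrm (x - y).
Proof. by have := nrmD y (x - y); rewrite addrC subrK. Qed.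

Lemma nrm_sum (I : Type) (r : seq I) (P : pred I) (f : I -> B) :
  nrm (\sum_(i <- r | P i) f i) <= \sum_(i <- r | P i) nrm (f i).
Proof.
elim/big_ind2 : _ => //; first by rewrite nrm0.
by move=> x a y b xa yb; apply: (le_trans (nrmD _ _)); exact: lerD.
Qed.

Lemma cvg_nrmP {T : Type} (F : set_system T) (FF : Filter F) (f : T -> B) (l : B) :
  f @ F --> l <-> forall e : R, 0 < e -> \forall x \near F, nrm (f x - l) < e.
Proof.
split => [fl e e0|fl].
  have e0' : 0 < e%:C by rewrite ltcR.
  have := (cvgrPdist_lt _ _).1 fl _ e0' => /(_ FF).
  by apply: (@filterS _ F FF) => x; rewrite distrC nrmE ltcR.
apply/cvgrPdist_lt => -[e e'] e0.
have {e0}[/eqP -> e0] : (e' == 0) /\ 0 < e by move: e0; rewrite ltcE/= => /andP.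
have := fl _ e0; apply: (@filterS _ F FF) => x; rewrite distrC nrmE => h.
by rewrite ltcR.
Qed.

End normed.

Lemma nrm_complex (z : C^o) : nrm z = normc z.
Proof. by apply: (@complexI R); rewrite -nrmE normc_normr. Qed.

Lemma nrmZC (B : normedModType C) (a : R) (x : B) : nrm (a%:C *: x) = `|a| * nrm x.
Proof. by rewrite nrmZ /= expr0n /= addr0 sqrtr_sqr. Qed.

Lemma normcR (a : R) : normc (a%:C) = `|a|.
Proof. by rewrite /= expr0n /= addr0 sqrtr_sqr. Qed.

Lemma nrm_inner (V : preHilbertType R) (x : V) : inner x x = (nrm x ^+ 2)%:C.
Proof. by rewrite -inner_norm nrmE rmorphXn. Qed.

Lemma normc_inner (V : preHilbertType R) (x y : V) :
  normc (inner x y) <= nrm x * nrm y.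
Proof.
have nE z : sqrtC (inner z z) = (nrm (z : V))%:C.
  by rewrite -inner_norm exprCK ?nnegrE// nrmE.
rewrite -lecR -normc_normr rmorphM/= -!nE.
exact: dot_CauchySchwarz.
Qed.

End real_norm.

(** * Geometric series in normed spaces *)

Section completeness.
Variable R : realType.
Local Notation C := R[i].

Definition nrm_cauchy (B : normedModType C) (u : nat -> B) := forall e : R, 0 < e ->
  exists N, forall m n, (N <= m)%N -> (N <= n)%N -> nrm (u m - u n) < e.

(** Completeness as a property rather than a structure: it has to cover [C^o], [H] and also [L2 mu],
    for which it is proved further on. *)
Definition seq_complete (B : normedModType C) :=
  forall u : nat -> B, nrm_cauchy u -> cvgn u.

Lemma complete_seq_complete (B : completeNormedModType C) : seq_complete B.
Proof.
move=> u cu; apply: cauchy_cvg; apply: cauchy_exP => -[e e'] e0.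
have {e0}[/eqP -> e0] : (e' == 0) /\ 0 < e by move: e0; rewrite ltcE/= => /andP.
have [N uN] := cu _ e0; exists (u N); exists N => // n Nn.
by rewrite -ball_normE/= nrmE ltcR uN.
Qed.

Lemma nrm_cauchy_real (u : nat -> C^o) (p : C -> R) :
  (forall x y, `|p x - p y| <= normc (x - y)) -> nrm_cauchy u ->
  exists l, forall e : R, 0 < e -> exists N, forall n, (N <= n)%N -> `|p (u n) - l| < e.
Proof.
move=> pu cu.
have : cvgn (fun n => p (u n)).
  apply: cauchy_cvg; apply: cauchy_exP => e e0.
  have [N uN] := cu _ e0; exists (p (u N)); exists N => // n Nn.
  by rewrite -ball_normE/=; apply: le_lt_trans (uN N n _ _).
move=> /cvg_ex[l pl]; exists l => e e0.
have := (cvgrPdist_lt _ _).1 pl e e0 => -[N _ h].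
by exists N => n Nn; rewrite distrC; exact: h.
Qed.

Lemma normc_le (z : C) : normc z <= `|complex.Re z| + `|complex.Im z|.
Proof.
rewrite -[leRHS]ger0_norm ?addr_ge0// -[leLHS]ger0_norm ?normc_ge0//.
rewrite -ler_sqr ?nnegrE// !real_normK ?num_real// normc_sqr sqrrD !real_normK ?num_real//.
by rewrite addrAC lerDl mulrn_wge0// mulr_ge0.
Qed.

Lemma seq_complete_C : seq_complete C^o.
Proof.
move=> u cu.
have [|a ha] := @nrm_cauchy_real u (@complex.Re _) _ cu.
  by move=> -[a b] [c d]; exact: (ge0_normc_Re ((a +i* b) - (c +i* d))).
have [|b hb] := @nrm_cauchy_real u (@complex.Im _) _ cu.
  by move=> -[a' b'] [c d]; exact: (ge0_normc_Im ((a' +i* b') - (c +i* d))).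
apply/cvg_ex; exists (a +i* b); apply/cvg_nrmP => e e0.
have e20 : 0 < e / 2 by rewrite divr_gt0.
have [N hN] := ha _ e20; have [M hM] := hb _ e20.
exists (maxn N M) => // n; rewrite /= geq_max => /andP[/hN h1 /hM h2].
rewrite nrm_complex (le_lt_trans (normc_le _))// [ltRHS]splitr ltrD//.
- by move: h1; case: (u n).
- by move: h2; case: (u n).
Qed.

End completeness.

Section geometric_series.
Variable R : realType.
Local Notation C := R[i].
Variable B : normedModType C.
Hypothesis cB : seq_complete B.
Implicit Types f g : nat -> B.

(* All series below are dominated by a geometric series of ratio 1/2. *)
Definition geo f (c : R) := forall k, nrm (f k) <= c * 2^-1 ^+ k.

Definition csum f : B := limn (series f).

Lemma sum_half (N n : nat) : \sum_(N <= k < N + n) (2^-1 ^+ k : R) <= 2 * 2^-1 ^+ N.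
Proof.
suff -> : \sum_(N <= k < N + n) (2^-1 ^+ k : R) = 2 * 2^-1 ^+ N - 2 * 2^-1 ^+ (N + n).
  by rewrite gerBl mulr_ge0// exprn_ge0.
elim: n => [|n IH]; first by rewrite addn0 big_geq// subrr.
rewrite addnS big_nat_recr/= ?leq_addr// IH exprS; lra.
Qed.

Lemma geo_ge0 f c : geo f c -> 0 <= c.
Proof. by move=> /(_ 0%N); rewrite expr0 mulr1; apply: le_trans; exact: nrm_ge0. Qed.

Lemma geo_partial f c N n : geo f c ->
  nrm (\sum_(N <= k < N + n) f k) <= 2 * c * 2^-1 ^+ N.
Proof.
move=> fc; apply: (le_trans (nrm_sum _ _ _)).
apply: (@le_trans _ _ (\sum_(N <= k < N + n) c * 2^-1 ^+ k)); first exact: ler_sum.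
rewrite -mulr_sumr [2 * c]mulrC -mulrA ler_wpM2l ?sum_half//.
exact: geo_ge0 fc.
Qed.

Lemma half_lt (c e : R) : 0 < e -> exists N, forall n, (N <= n)%N -> c * 2^-1 ^+ n < e.
Proof.
move=> e0; have : (fun n => c * 2^-1 ^+ n) @ \oo --> 0.
  by apply: (cvg_geometric c); rewrite ger0_norm// invf_lt1// ltr1n.
move=> /cvgrPdist_lt/(_ _ e0)[N _ h]; exists N => n Nn.
by have := h n Nn; rewrite sub0r normrN; apply: le_lt_trans; exact: ler_norm.
Qed.

Lemma geo_cvg f c : geo f c -> series f @ \oo --> csum f.
Proof.
move=> fc; apply: cB => e e0; have [N hN] := half_lt (2 * c) e0.
exists N => m n Nm Nn; wlog mn : m n Nm Nn / (n <= m)%N.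
  move=> h; have /orP[|] := leq_total n m; first exact: h.
  by move=> mn; rewrite nrmB; exact: h.
rewrite sub_series_geq// -[m](subnKC mn).
by apply: (le_lt_trans (geo_partial _ _ fc)); exact: hN.
Qed.

Lemma nrm_lim_le (u : nat -> B) l y (r : R) N : u @ \oo --> l ->
  (forall n, (N <= n)%N -> nrm (u n - y) <= r) -> nrm (l - y) <= r.
Proof.
move=> ul h; rewrite leNgt; apply/negP => rl.
have e0 : 0 < nrm (l - y) - r by rewrite subr_gt0.
have [M _ hM] := (cvg_nrmP _ _ _).1 ul _ e0.
have h1 := hM (maxn N M) (leq_maxr _ _); have h2 := h (maxn N M) (leq_maxl _ _).
have := nrmD (l - u (maxn N M)) (u (maxn N M) - y); rewrite addrA subrK.
by move: h1; rewrite /= nrmB; lra.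
Qed.

Lemma geo_tail f c N : geo f c -> nrm (csum f - series f N) <= 2 * c * 2^-1 ^+ N.
Proof.
move=> fc; apply: (nrm_lim_le (N := N) (geo_cvg fc)) => n Nn.
by rewrite sub_series_geq// -[n](subnKC Nn); exact: geo_partial.
Qed.

Lemma geo_bound f c : geo f c -> nrm (csum f) <= 2 * c.
Proof. by move=> /(geo_tail 0); rewrite /series/= big_geq// subr0 expr0 mulr1. Qed.

Lemma csum_unique f l : series f @ \oo --> l -> csum f = l.
Proof. by move=> fl; exact/cvg_lim. Qed.

End geometric_series.

Section series_of_functions.
Variable R : realType.
Local Notation C := R[i].
Variable B : normedModType C.
Hypothesis cB : seq_complete B.

Lemma geoB (f g : nat -> B) c d : geo f c -> geo g d -> geo (fun k => f k - g k) (c + d).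
Proof.
move=> fc gd k; apply: (le_trans (nrmD _ _)); rewrite nrmN mulrDl.
exact: lerD.
Qed.

Lemma csumB (f g : nat -> B) c d : geo f c -> geo g d ->
  csum (fun k => f k - g k) = csum f - csum g.
Proof.
move=> fc gd; apply: csum_unique.
have -> : series (fun k => f k - g k) = (fun n => series f n - series g n).
  by apply/funext => n; rewrite /series/= sumrB.
apply: cvgB; [exact: geo_cvg fc|exact: geo_cvg gd].
Qed.

Lemma csumZ a (f : nat -> B) c : geo f c -> csum (fun k => a *: f k) = a *: csum f.
Proof.
move=> fc; apply: csum_unique.
have -> : series (fun k => a *: f k) = (fun n => a *: series f n).
  by apply/funext => n; rewrite /series/= scaler_sumr.
apply: cvgZr; exact: geo_cvg fc.
Qed.

(* Tannery's theorem. *)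
Lemma cvg_csum (T : Type) (F : set_system T) {FF : Filter F}
    (f : T -> nat -> B) (l : nat -> B) c :
  (\forall x \near F, geo (f x) c) -> geo l c ->
  (forall k, (fun x => f x k) @ F --> l k) -> (fun x => csum (f x)) @ F --> csum l.
Proof.
move=> fc lc fl.
have fN N : (fun x => series (f x) N) @ F --> series l N.
  elim: N => [|N IH].
    rewrite /series/= big_geq//.
    rewrite (_ : (fun x => _) = cst 0); first exact: cvg_cst.
    by apply/funext => x; rewrite /series/= big_geq.
  rewrite seriesSr.
  rewrite (_ : (fun x => _) = (fun x => series (f x) N + f x N)); last first.
    by apply/funext => x; rewrite seriesSr.
  exact: cvgD.
apply/cvg_nrmP => e e0; have e30 : 0 < e / 3 by rewrite divr_gt0.
have [N hN] := half_lt (2 * c) e30.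
have := (cvg_nrmP FF _ _).1 (fN N) _ e30.
apply: filterS2 fc => x fxc h.
have h1 := geo_tail cB N fxc; have h2 := geo_tail cB N lc.
have := hN _ (leqnn _); move: h h1 h2.
have -> : csum (f x) - csum l = (csum (f x) - series (f x) N) +
   ((series (f x) N - series l N) + (series l N - csum l)).
  by rewrite !subrKA.
rewrite (nrmB (csum l)) => h h1 h2 h3.
have := nrmD (csum (f x) - series (f x) N)
   ((series (f x) N - series l N) + (series l N - csum l)).
have := nrmD (series (f x) N - series l N) (series l N - csum l).
lra.
Qed.

End series_of_functions.

(** * Functions vanishing at infinity *)

Section C0_functions.
Variable R : realType.
Local Notation C := R[i].
Variables (X : topologicalType) (B : normedModType C).
Implicit Types f g : X -> B.

Lemma C0P f : C0 f <-> continuous f /\ forall e : R, 0 < e ->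
  exists2 K : set X, compact K & forall x, ~ K x -> nrm (f x) < e.
Proof.
by split=> -[fc h]; split=> // e /h[K cK hK]; exists K => // x /hK;
  rewrite nrmE ltcR.
Qed.

Lemma C0_0 : C0 (fun _ : X => 0 : B).
Proof.
apply/C0P; split; first by move=> x; exact: cvg_cst.
by move=> e e0; exists set0; [exact: compact0|move=> x _; rewrite nrm0].
Qed.

Lemma C0D f g : C0 f -> C0 g -> C0 (fun x => f x + g x).
Proof.
move=> /C0P[fc f0] /C0P[gc g0]; apply/C0P; split.
  by move=> x; apply: cvgD; [exact: fc|exact: gc].
move=> e e0; have e20 : 0 < e / 2 by rewrite divr_gt0.
have [K cK hK] := f0 _ e20; have [L cL hL] := g0 _ e20.
exists (K `|` L); first exact: compactU.
move=> x /= /not_orP[/hK h1 /hL h2].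
by apply: (le_lt_trans (nrmD _ _)); lra.
Qed.

Lemma C0_sum (f : nat -> X -> B) N : (forall k, C0 (f k)) ->
  C0 (fun x => series (fun k => f k x) N).
Proof.
move=> f0; elim: N => [|N IH].
  rewrite (_ : (fun x => _) = (fun=> 0)); first exact: C0_0.
  by apply/funext => x; rewrite /series/= big_geq.
rewrite (_ : (fun x => _) = (fun x => series (f^~ x) N + f N x)); last first.
  by apply/funext => x; rewrite seriesSr.
exact: C0D.
Qed.

(** The geometric bound does not depend on x, so convergence is uniform: a compact set outside which
    the N-th partial sum is below e/2 also serves for the whole sum once the tail is below e/2. *)
Lemma C0_csum (f : nat -> X -> B) c : seq_complete B -> (forall k, C0 (f k)) ->
  (forall x, geo (fun k => f k x) c) -> C0 (fun x => csum (fun k => f k x)).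
Proof.
move=> cB f0 fc; apply/C0P; split.
  move=> x; apply: (@cvg_csum _ _ cB _ _ _ (fun x k => f k x) (f^~ x) c) => //.
    exact: nearW.
  by move=> k; have [h _] := f0 k; exact: h.
move=> e e0; have e20 : 0 < e / 2 by rewrite divr_gt0.
have [N hN] := half_lt (2 * c) e20.
have [_ /(_ _ e20)[K cK hK]] := (C0P _).1 (C0_sum N f0); exists K => // x /hK.
have := geo_tail cB N (fc x); have := hN _ (leqnn _).
have := nrm_le_sub (csum (f^~ x)) (series (f^~ x) N).
lra.
Qed.

Lemma cvg_nrm (T : Type) (F : set_system T) {FF : Filter F} (h : T -> B) (l : B) :
  h @ F --> l -> nrm (h x) @[x --> F] --> nrm l.
Proof.
move=> /(cvg_nrmP FF) hl; apply/cvgrPdist_lt => e e0.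
apply: filterS (hl e e0) => x; apply: le_lt_trans.
rewrite ler_norml lerBrDl; have := nrm_le_sub (h x) l.
by have := nrm_le_sub l (h x); rewrite nrmB; lra.
Qed.

Lemma C0_bounded f : C0 f -> exists M, forall x, nrm (f x) <= M.
Proof.
move=> /C0P[fc /(_ 1 ltr01)[K cK hK]].
have cfK : compact ((fun x => nrm (f x) : R^o) @` K).
  apply: continuous_compact => //; apply: continuous_subspaceT => x.
  exact: cvg_nrm (fc x).
case: (compact_bounded cfK) => M [Mr h].
exists (Num.max 1 (M + 1)) => x; rewrite le_max.
have [Kx|/hK/ltW->//] := pselect (K x); apply/orP; right.
have := h (M + 1); rewrite ltrDl ltr01 => /(_ erefl (nrm (f x))).
by rewrite /= ger0_norm ?nrm_ge0//; apply; exists x.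
Qed.

End C0_functions.

(** * Differentiation term by term *)

Section derivatives.
Variable R : realType.
Local Notation C := R[i].

Lemma has_derivP (B : normedModType C) (f : R -> B) s l :
  has_deriv f s l <-> forall e : R, 0 < e ->
    \forall h \near (0 : R)^', nrm ((h^-1)%:C *: (f (s + h) - f s) - l) < e.
Proof. by rewrite /has_deriv cvg_nrmP. Qed.

(** [p] will be the real or the imaginary part. The hypothesis packs real linearity and |p z| <= |z|
    into the one inequality that the difference quotients need. *)
Lemma has_deriv_real (p : C -> R) (f : R -> C^o) s (l : C) :
  (forall (a : R) x y z, `|a * (p x - p y) - p z| <= normc (a%:C * (x - y) - z)) ->
  has_deriv f s l -> is_derive (s : R^o) (1 : R^o) (fun x => p (f x)) (p l).
Proof.
move=> pP /has_derivP fl.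
have H : (fun h : R => h^-1 *: (((fun x => p (f x)) \o shift s) (h *: 1) - p (f s)))
    @ (0 : R)^' --> p l.
  apply/cvgrPdist_lt => e e0; have := fl _ e0; apply: filterS => h.
  rewrite nrm_complex distrC => H; apply: le_lt_trans H.
  rewrite /= [h *: 1]mulr1 [h + s]addrC; exact: pP.
apply: DeriveDef; first by apply/cvg_ex; exists (p l).
exact/cvg_lim.
Qed.

(** The mean value theorem holds for real functions only, so it is applied to the real and imaginary
    parts; this costs the factor 2. *)
Lemma has_deriv_lip (f g : R -> C^o) (M : R) :
  (forall s, has_deriv f s (g s)) -> (forall s, normc (g s) <= M) ->
  forall s h, normc (f (s + h) - f s) <= 2 * M * `|h|.
Proof.
move=> fg gM s h; apply: (le_trans (normc_le _)).
suff H (p : C -> R) : (forall (a : R) x y z, `|a * (p x - p y) - p z| <= normc (a%:C * (x - y) - z)) ->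
    (forall z, `|p z| <= normc z) -> `|p (f (s + h)) - p (f s)| <= M * `|h|.
  have -> : 2 * M * `|h| = M * `|h| + M * `|h| by ring.
  apply: lerD.
    rewrite [X in `|X|](_ : _ = complex.Re (f (s + h)) - complex.Re (f s)); last first.
      by case: (f (s + h)) => a b; case: (f s).
    apply: H; last exact: ge0_normc_Re.
    move=> a [x x'] [y y'] [z z']; apply: le_trans (ge0_normc_Re _).
    by rewrite /= mul0r subr0.
  rewrite [X in `|X|](_ : _ = complex.Im (f (s + h)) - complex.Im (f s)); last first.
    by case: (f (s + h)) => a b; case: (f s).
  apply: H; last exact: ge0_normc_Im.
  move=> a [x x'] [y y'] [z z']; apply: le_trans (ge0_normc_Im _).
  by rewrite /= mul0r addr0.
move=> pP pn.
have D (x : R) : is_derive (x : R^o) (1 : R^o) (fun x => p (f x)) (p (g x)) by exact: has_deriv_real.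
have cnt (a b : R) : {within `[a, b], continuous (fun x => p (f x))}.
  apply: derivable_within_continuous => x _; by have [] := D x.
wlog h0 : s h / 0 < h.
  move=> W; have [h0|h0|<-] := ltgtP 0 h; first exact: W.
    have := W (s + h) (- h); rewrite addrK oppr_gt0 h0 normrN distrC; exact.
  by rewrite addr0 subrr !normr0 mulr0.
have [c _ ->] := MVT (ltr_pwDr h0 (lexx s)) (fun x _ => D x) (cnt s (s + h)).
rewrite addrAC subrr add0r normrM ler_wpM2r//.
exact: le_trans (pn _) (gM _).
Qed.

(** Limit and sum are exchanged by [cvg_csum]: the mean value bound dominates the difference
    quotients by twice the bound on the differentiated series, uniformly in h. *)
Lemma has_deriv_csum (B : normedModType C) (a b : nat -> R -> C) (v : nat -> B) c :
  seq_complete B ->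
  (forall k s, has_deriv (a k : R -> C^o) s (b k s)) ->
  (forall s, geo (fun k => a k s *: v k) c) ->
  (forall s, geo (fun k => b k s *: v k) c) ->
  forall s, has_deriv (fun s => csum (fun k => a k s *: v k)) s
     (csum (fun k => b k s *: v k)).
Proof.
move=> cB ab ac bc s; rewrite /has_deriv.
have c0 := geo_ge0 (ac 0).
pose q (h : R) k := (h^-1)%:C *: (a k (s + h) *: v k - a k s *: v k).
rewrite (_ : (fun h => _) = (fun h => csum (q h))); last first.
  apply/funext => h; rewrite /q.
  rewrite (csumZ cB _ (c := c + c)); last exact: geoB.
  by rewrite (csumB cB (ac _) (ac _)).
have vq (h : R) k : q h k = ((h^-1)%:C * (a k (s + h) - a k s)) *: v k.
  by rewrite /q -scalerBl scalerA.
apply: (@cvg_csum _ _ cB _ _ _ q _ (2 * c)).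
- near=> h => k; rewrite vq nrmZ.
  have [->|vk0] := eqVneq (v k) 0.
    by rewrite nrm0 mulr0 mulr_ge0// ?exprn_ge0// mulr_ge0.
  have vk : 0 < nrm (v k) by rewrite lt0r nrm_ge0 nrm_eq0 vk0.
  (* The bound on [b k t *: v k] is uniform in t, so dividing by the norm of [v k] leaves a
     Lipschitz constant for [a k]; this is why [v k = 0] is treated apart. *)
  have bM t : normc (b k t) <= c * 2^-1 ^+ k / nrm (v k).
    by rewrite ler_pdivlMr// -nrmZ; exact: bc.
  have h0 : h != 0 by near: h; exact: nbhs_dnbhs_neq.
  have := has_deriv_lip (ab k) bM s h => L.
  rewrite normcM normcR -ler_pdivlMr// normfV mulrC ler_pdivrMr ?normr_gt0//.
  by apply: (le_trans L); rewrite !mulrA.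
- move=> k; apply: (le_trans (bc s k)); rewrite ler_wpM2r ?exprn_ge0//.
  by rewrite ler_peMl// ler1n.
- move=> k; under eq_cvg do rewrite vq.
  apply/cvg_nrmP => e e0.
  have vk0 : 0 < nrm (v k) + 1 by rewrite ltr_wpDl// nrm_ge0.
  have := (has_derivP _ _ _).1 (ab k s) (e / (nrm (v k) + 1)).
  rewrite divr_gt0// => /(_ erefl); apply: filterS => h.
  rewrite nrm_complex ltr_pdivlMr// => H.
  rewrite -scalerBl nrmZ; apply: le_lt_trans H.
  by rewrite ler_wpM2l ?normc_ge0// lerDl.
Unshelve. all: by end_near. Qed.

End derivatives.

(** * Orthonormal sequences and bases *)

Section inner_product.
Variable R : realType.
Local Notation C := R[i].
Variable V : preHilbertType R.
Implicit Types (x y z : V) (a : C).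

Lemma innerDl x y z : inner (x + y) z = inner x z + inner y z.
Proof. exact: linearDl. Qed.

Lemma innerBl x y z : inner (x - y) z = inner x z - inner y z.
Proof. exact: linearBl. Qed.

Lemma innerZl a x y : inner (a *: x) y = a * inner x y.
Proof. exact: linearZl_LR. Qed.

Lemma innerC x y : inner x y = Num.conj (inner y x).
Proof. by rewrite hermC expr0 mul1r. Qed.

Lemma innerDr x y z : inner z (x + y) = inner z x + inner z y.
Proof. exact: linearDr. Qed.

Lemma innerBr x y z : inner z (x - y) = inner z x - inner z y.
Proof. exact: linearBr. Qed.

Lemma innerZr a x y : inner x (a *: y) = Num.conj a * inner x y.
Proof. exact: linearZr_LR. Qed.

Lemma inner0l x : inner 0 x = 0.
Proof. exact: linear0l. Qed.

Lemma inner0r x : inner x 0 = 0.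
Proof. exact: linear0r. Qed.

Lemma inner_suml (I : Type) (r : seq I) (P : pred I) (f : I -> V) y :
  inner (\sum_(i <- r | P i) f i) y = \sum_(i <- r | P i) inner (f i) y.
Proof.
elim/big_rec2 : _ => [|i u v _ IH]; first exact: inner0l.
by rewrite innerDl IH.
Qed.

Lemma inner_sumr (I : Type) (r : seq I) (P : pred I) (f : I -> V) y :
  inner y (\sum_(i <- r | P i) f i) = \sum_(i <- r | P i) inner y (f i).
Proof.
elim/big_rec2 : _ => [|i u v _ IH]; first exact: inner0r.
by rewrite innerDr IH.
Qed.

Lemma inner_eq0 x : inner x x = 0 -> x = 0.
Proof.
by move=> /eqP; rewrite nrm_inner fmorph_eq0 sqrf_eq0 nrm_eq0 => /eqP.
Qed.

Lemma inner_ext x y : (forall z, inner z x = inner z y) -> x = y.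
Proof.
move=> h; apply/eqP; rewrite -subr_eq0; apply/eqP/inner_eq0.
by rewrite innerBr !h subrr.
Qed.

Lemma normc_sqr_conj (z : C) : z * Num.conj z = (normc z ^+ 2)%:C.
Proof. by rewrite -normCK normc_normr rmorphXn. Qed.

Lemma nrm_sqrD x y : inner x y = 0 -> nrm (x + y) ^+ 2 = nrm x ^+ 2 + nrm y ^+ 2.
Proof.
move=> xy; apply: (@complexI R); rewrite -nrm_inner innerDl !innerDr xy.
by rewrite (innerC y) xy rmorph0 addr0 add0r !nrm_inner rmorphD.
Qed.

Lemma cvg_innerl (T : Type) (F : set_system T) {FF : Filter F} (f : T -> V) l y :
  f @ F --> l -> (inner (f t) y : C^o) @[t --> F] --> (inner l y : C^o).
Proof.
move=> /(cvg_nrmP FF) fl; apply/cvg_nrmP => e e0.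
have y0 : 0 < nrm y + 1 by rewrite ltr_wpDl// nrm_ge0.
have := fl (e / (nrm y + 1)); rewrite divr_gt0// => /(_ erefl).
apply: filterS => t; rewrite ltr_pdivlMr// => h.
rewrite nrm_complex -innerBl; apply: (le_lt_trans (normc_inner _ _)).
by apply: le_lt_trans h; rewrite ler_wpM2l ?nrm_ge0// lerDl.
Qed.

Lemma cvg_innerr (T : Type) (F : set_system T) {FF : Filter F} (f : T -> V) l y :
  f @ F --> l -> (inner y (f t) : C^o) @[t --> F] --> (inner y l : C^o).
Proof.
move=> /(cvg_innerl (y := y))/(cvg_nrmP FF) fl; apply/cvg_nrmP => e /fl.
by apply: filterS => t; rewrite !nrm_complex -innerBr (innerC y) Defs.normcJ innerBl.
Qed.

Definition orthonormal_upto (b : nat -> V) n := forall i j, (i < n)%N -> (j < n)%N ->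
  inner (b i) (b j) = (i == j)%:R.

Lemma orthonormal_seq_upto b n : orthonormal_sequence b -> orthonormal_upto b n.
Proof. by move=> h i j _ _; exact: h. Qed.

Definition residual (b : nat -> V) n x := x - \sum_(i < n) inner x (b i) *: b i.

Lemma inner_comb (b : nat -> V) n (c : nat -> C) j : orthonormal_upto b n -> (j < n)%N ->
  inner (\sum_(i < n) c i *: b i) (b j) = c j.
Proof.
move=> ob jn; rewrite inner_suml (bigD1 (Ordinal jn))//= innerZl ob// eqxx mulr1.
rewrite big1 ?addr0// => i ij; rewrite innerZl ob//.
by rewrite (negbTE (ij : nat_of_ord i != j)) mulr0.
Qed.

Lemma inner_residual b n x j : orthonormal_upto b n -> (j < n)%N ->
  inner (residual b n x) (b j) = 0.
Proof. by move=> ob jn; rewrite innerBl (inner_comb (fun i => inner x (b i)))// subrr. Qed.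

Lemma nrm_comb b n (c : nat -> C) : orthonormal_upto b n ->
  nrm (\sum_(i < n) c i *: b i) ^+ 2 = \sum_(i < n) normc (c i) ^+ 2.
Proof.
move=> ob; apply: (@complexI R); rewrite -nrm_inner inner_sumr rmorph_sum.
apply: eq_bigr => i _; rewrite innerZr inner_comb// mulrC.
exact: normc_sqr_conj.
Qed.

Lemma nrm_residual b n x : orthonormal_upto b n ->
  nrm x ^+ 2 = nrm (residual b n x) ^+ 2 + \sum_(i < n) normc (inner x (b i)) ^+ 2.
Proof.
move=> ob; rewrite -(nrm_comb (fun i => inner x (b i)) ob) -nrm_sqrD ?subrK//.
rewrite inner_sumr big1// => i _; rewrite innerZr inner_residual ?mulr0//.
Qed.

Lemma bessel b n x : orthonormal_upto b n ->
  \sum_(i < n) normc (inner x (b i)) ^+ 2 <= nrm x ^+ 2.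
Proof. by move=> /nrm_residual->; rewrite lerDr sqr_ge0. Qed.

(** By Bessel the squared coefficients are summable, hence tend to 0. *)
Lemma orthonormal_weak0 b x : orthonormal_sequence b -> forall e : R, 0 < e ->
  exists N, forall n, (N <= n)%N -> normc (inner x (b n)) < e.
Proof.
move=> ob e e0.
have /cvg_series_cvg_0/cvgrPdist_lt/(_ (e ^+ 2)) :
    cvgn (series (fun n => normc (inner x (b n)) ^+ 2)).
  apply: nondecreasing_is_cvgn.
    by apply: nondecreasing_series => n _ _; exact: sqr_ge0.
  exists (nrm x ^+ 2) => _ [n _ <-]; rewrite /series/= big_mkord.
  by apply: bessel; exact: orthonormal_seq_upto.
rewrite exprn_gt0// => /(_ isT)[N _ h]; exists N => n Nn.
have := h n Nn; rewrite sub0r normrN ger0_norm ?sqr_ge0//.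
by rewrite ltr_sqr// nnegrE ?normc_ge0// ltW.
Qed.

Lemma nrm_orthonormal (b : nat -> V) n : orthonormal_sequence b -> nrm (b n) = 1.
Proof.
move=> ob; apply/eqP; rewrite -(@eqrXn2 _ 2)// ?nrm_ge0// expr1n; apply/eqP.
by apply: (@complexI R); rewrite -nrm_inner ob eqxx.
Qed.

End inner_product.

(** * Gram-Schmidt with a free choice at every other step *)

Section interleaved_orthonormalization.
Variable R : realType.
Local Notation C := R[i].
Variable V : preHilbertType R.
(** [A] is a class that the construction must not leave: the test functions in L^2, and everything
    in H. [x] is a sequence with trivial orthogonal complement in both uses. *)
Variables (A : set V) (x : nat -> V) (p : bool) (Good : nat -> set V).
Hypothesis A_lin : forall (a : C) u v, A u -> A v -> A (a *: u + v).
Hypothesis Ax : forall j, A (x j).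
Hypothesis step : forall n (w : nat -> V), (forall i, (i < n)%N -> A (w i)) ->
  orthonormal_upto w n -> exists v, [/\ A v, nrm v = 1,
    forall i, (i < n)%N -> inner v (w i) = 0 & Good n v].

Let A0 : A 0.
Proof. by have := A_lin (-1) (Ax 0) (Ax 0); rewrite scaleN1r addNr. Qed.

Let Aresidual n w y : (forall i, (i < n)%N -> A (w i)) -> A y -> A (residual w n y).
Proof.
move=> Aw Ay; rewrite /residual addrC -scaleN1r; apply: A_lin => //.
elim: n Aw => [|n IH] Aw; first by rewrite big_ord0.
rewrite big_ord_recr/= addrC; apply: A_lin; first exact: Aw.
by apply: IH => i ni; apply: Aw; rewrite ltnW.
Qed.

Let next n (w : nat -> V) : (forall i, (i < n)%N -> A (w i)) -> orthonormal_upto w n ->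
  exists v, [/\ A v, nrm v = 1, forall i, (i < n)%N -> inner v (w i) = 0,
    odd n = p -> Good n v &
    odd n != p -> residual w n (x n./2) = inner (x n./2) v *: v].
Proof.
move=> Aw ow; have [np|np] := eqVneq (odd n) p.
  by have [v [Av v1 vw Gv]] := step Aw ow; exists v; split.
(* If the given vector already lies in the span of the earlier ones, any new unit vector will do,
   and [step] supplies one; the required identity then reads 0 = 0. *)
have [r0|r0] := eqVneq (residual w n (x n./2)) 0.
  have [v [Av v1 vw Gv]] := step Aw ow; exists v; split => // _.
  rewrite r0; move: r0 => /eqP; rewrite subr_eq0 => /eqP ->.
  rewrite inner_suml big1 ?scale0r// => i _.
  by rewrite innerZl (innerC (w i)) vw// rmorph0 mulr0.
have n0 : nrm (residual w n (x n./2)) != 0 by rewrite nrm_eq0.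
exists ((nrm (residual w n (x n./2)))^-1%:C *: residual w n (x n./2)); split.
- by rewrite -[X in A X]addr0; apply: A_lin => //; exact: Aresidual.
- by rewrite nrmZC ger0_norm ?invr_ge0 ?nrm_ge0// mulVf.
- by move=> i ni; rewrite innerZl inner_residual// mulr0.
- by move=> E; rewrite E eqxx in np.
- move=> _; set r := residual _ _ _.
  have -> : inner (x n./2) ((nrm r)^-1%:C *: r) = (nrm r)%:C.
    rewrite innerZr -[x _](subrK (\sum_(i < n) inner (x n./2) (w i) *: w i)) -/r.
    rewrite innerDl inner_suml [X in _ + X]big1 ?addr0; last first.
      by move=> i _; rewrite innerZl (innerC (w i)) inner_residual// rmorph0 mulr0.
    rewrite nrm_inner; have -> : Num.conj (nrm r)^-1%:C = (nrm r)^-1%:C :> C.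
      exact: conjc_real.
    by rewrite -rmorphM/= expr2 mulKf.
  by rewrite scalerA -rmorphM/= mulfV// scale1r.
Qed.

(* Steps n with odd n = p supply a vector satisfying Good n, the other steps
   orthonormalise the given sequence x. *)
Lemma interleaved_orthonormalization : exists b : nat -> V,
  [/\ orthonormal_sequence b, forall n, A (b n), forall n, odd n = p -> Good n (b n) &
   forall n, odd n != p -> residual b n.+1 (x n./2) = 0].
Proof.
pose valid (s : seq V) := (forall i, (i < size s)%N -> A (nth 0 s i)) /\
  orthonormal_upto (nth 0 s) (size s).
pose ok (s : seq V) v := [/\ A v, nrm v = 1,
  forall i, (i < size s)%N -> inner v (nth 0 s i) = 0,
    odd (size s) = p -> Good (size s) v &
    odd (size s) != p ->
      residual (nth 0 s) (size s) (x (size s)./2) = inner (x (size s)./2) v *: v].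
(* The recursion runs on the list of all vectors built so far. Lists that are not valid get the
   dummy value 0; by [vst] they never occur. *)
have /choice[nx nxP] : forall s, exists v, valid s -> ok s v.
  move=> s; have [[h1 h2]|nv] := pselect (valid s); last by exists 0.
  by have [v h] := next h1 h2; exists v.
pose st n := iter n (fun s => rcons s (nx s)) [::].
pose b n := nx (st n).
have sst n : size (st n) = n by elim: n => // n IH; rewrite /st/= size_rcons IH.
have nst n i : (i < n)%N -> nth 0 (st n) i = b i.
  elim: n => // n IH; rewrite ltnS leq_eqVlt /st/= nth_rcons -/(st n) sst.
  by case/predU1P => [->|/[dup] ni ->]; [rewrite ltnn eqxx|exact: IH].
have vst n : valid (st n).
  elim: n => [|n IH]; first by split.
  have [Av v1 vw _ _] := nxP _ IH; have [IH1 IH2] := IH.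
  rewrite /st/= -/(st n) /valid size_rcons; split=> [i|i j].
    rewrite ltnS leq_eqVlt nth_rcons; case/predU1P => [->|ni]; last by rewrite ni; exact: IH1.
    by rewrite ltnn eqxx.
  rewrite !ltnS (leq_eqVlt i) (leq_eqVlt j) !nth_rcons.
  case/predU1P => [->|ni]; case/predU1P => [->|nj].
  - rewrite !ltnn !eqxx nrm_inner; have -> : nrm (nx (st n)) = 1 by exact: v1.
    by rewrite expr1n.
  - by rewrite ltnn eqxx nj vw// gtn_eqF.
  - by rewrite ltnn eqxx ni innerC vw// rmorph0 ltn_eqF.
  - by rewrite ni nj IH2.
have okb n := nxP _ (vst n).
have bO i j : (i < j)%N -> inner (b j) (b i) = 0.
  by move=> ij; have [_ _ h _ _] := okb j; rewrite -(nst j i ij) h ?sst.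
exists b; split.
- move=> i j; have [ij|ij|->] := ltngtP i j.
  + by rewrite innerC bO// rmorph0.
  + by rewrite bO.
  + by rewrite nrm_inner; have [_ -> _ _ _] := okb j; rewrite expr1n.
- by move=> n; have [] := okb n.
- by move=> n; have [_ _ _ + _] := okb n; rewrite sst.
- move=> n np; have [_ _ _ _] := okb n; rewrite sst => /(_ np) h.
  rewrite /residual big_ord_recr/= opprD addrA -[X in _ - X]h; apply/eqP.
  rewrite subr_eq0; apply/eqP; congr (_ - _); apply: eq_bigr => i _.
  by rewrite nst.
Qed.

End interleaved_orthonormalization.

(** * Orthonormal bases, adjoints and unitary operators *)

Section orthonormal_basis.
Variable R : realType.
Local Notation C := R[i].

(** Completeness as a trivial orthogonal complement is what the constructions deliver directly;
    [basis_expand] turns it into convergent expansions. *)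
Definition orthonormal_basis (V : preHilbertType R) (b : nat -> V) :=
  orthonormal_sequence b /\ forall y, (forall n, inner y (b n) = 0) -> y = 0.

Section one_space.
Variables (V : preHilbertType R) (b : nat -> V).
Hypothesis cV : seq_complete V.
Hypothesis ob : orthonormal_sequence b.

Lemma nrm_comb_nat m n (c : nat -> C) :
  nrm (\sum_(m <= k < n) c k *: b k) ^+ 2 = \sum_(m <= k < n) normc (c k) ^+ 2.
Proof.
have bm (Z : nmodType) (f : nat -> Z) :
    \sum_(m <= k < n) f k = \sum_(i < n - m) f (i + m)%N.
  by rewrite -{1}[m]add0n big_addn big_mkord.
rewrite !bm.
apply: (@nrm_comb _ _ (fun i => b (i + m)%N) (n - m) (fun i => c (i + m)%N)).
by move=> i j _ _; rewrite ob eqn_add2r.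
Qed.

Lemma riesz_fischer (c : nat -> C) (M : R) :
  (forall n, \sum_(k < n) normc (c k) ^+ 2 <= M) -> cvgn (series (fun k => c k *: b k)).
Proof.
move=> cM; apply: cV => e e0.
have : cvgn (series (fun k => normc (c k) ^+ 2)).
  apply: nondecreasing_is_cvgn.
    by apply: nondecreasing_series => n _ _; exact: sqr_ge0.
  by exists M => _ [n _ <-]; rewrite /series/= big_mkord.
move=> /cvg_ex[x /cvgrPdist_lt/(_ (e ^+ 2 / 2))]; rewrite divr_gt0 ?exprn_gt0//.
move=> /(_ isT)[N _ h].
exists N => m n Nm Nn; wlog mn : m n Nm Nn / (n <= m)%N.
  move=> H; have /orP[|] := leq_total n m; first exact: H.
  by move=> mn; rewrite nrmB; exact: H.
rewrite sub_series_geq//.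
rewrite -ltr_sqr ?nnegrE ?nrm_ge0 ?ltW// nrm_comb_nat.
have hm := h _ Nm; have hn := h _ Nn.
have := sub_series_geq (fun k => normc (c k) ^+ 2) mn => <-.
move: hm hn => /=; set A := series _ m; set D := series _ n => hm hn.
by move: hm hn; rewrite !ltr_norml => /andP[? ?] /andP[? ?]; lra.
Qed.

Definition expand (x : nat -> C) : V := limn (series (fun k => x k *: b k)).

Lemma inner_expand (c : nat -> C) (M : R) n :
  (forall n, \sum_(k < n) normc (c k) ^+ 2 <= M) -> inner (expand c) (b n) = c n.
Proof.
move=> cM; have := riesz_fischer cM => /(cvg_innerl (y := b n)) h.
apply: (@cvg_unique _ (@norm_hausdorff C C^o) _ _ _ _ h).
apply/cvg_nrmP => e e0; exists n.+1 => // N /= Nn.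
have on : orthonormal_upto b N by exact: orthonormal_seq_upto.
rewrite /series/= big_mkord (inner_comb c on Nn).
by rewrite subrr nrm0.
Qed.

Hypothesis b_basis : orthonormal_basis b.

Lemma basis_ext x y : (forall n, inner x (b n) = inner y (b n)) -> x = y.
Proof.
move=> h; apply/eqP; rewrite -subr_eq0; apply/eqP/b_basis.2 => n.
by rewrite innerBl h subrr.
Qed.

Lemma bessel_seq x n : \sum_(k < n) normc (inner x (b k)) ^+ 2 <= nrm x ^+ 2.
Proof. by apply: bessel; exact: orthonormal_seq_upto. Qed.

Lemma basis_expand x : series (fun k => inner x (b k) *: b k) @ \oo --> x.
Proof.
have h := @riesz_fischer (fun k => inner x (b k)) _ (bessel_seq x).
suff E : expand (fun k => inner x (b k)) = x by rewrite -[X in _ --> X]E.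
apply: basis_ext => n.
exact: (@inner_expand (fun k => inner x (b k)) _ _ (bessel_seq x)).
Qed.

Lemma parseval x y :
  series (fun k => inner x (b k) * Num.conj (inner y (b k)) : C^o) @ \oo --> (inner x y : C^o).
Proof.
move: (@basis_expand x) => /(cvg_innerl (y := y)).
rewrite (_ : (fun _ => _) = series (fun k => inner x (b k) * Num.conj (inner y (b k)) : C^o))//.
apply/funext => n; rewrite /series/= inner_suml; apply: eq_bigr => k _.
by rewrite innerZl -innerC.
Qed.

End one_space.

Section bounded.
Variables (V W : preHilbertType R) (T : V -> W).
Hypothesis bT : bounded_operator T.

Lemma bounded_nrm : exists2 M : R, 0 <= M & forall x, nrm (T x) <= M * nrm x.
Proof.
have [_ [M h]] := bT; exists (Num.max M 0); first by rewrite le_max lexx orbT.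
move=> x; have := h x; rewrite !nrmE -rmorphM/= lecR => /le_trans; apply.
by rewrite ler_wpM2r ?nrm_ge0// le_max lexx.
Qed.

Lemma boundedZ a x : T (a *: x) = a *: T x.
Proof.
have [lT _] := bT; have h u : T (a *: u + 0) = a *: T u + T 0 by exact: lT.
have T0 : T 0 = 0.
  by have := lT 1 0 0; rewrite scaler0 addr0 scale1r => /eqP; rewrite -subr_eq subrr => /eqP.
by rewrite -[X in T X]addr0 h T0 addr0.
Qed.

Lemma boundedD x y : T (x + y) = T x + T y.
Proof. by have [lT _] := bT; rewrite -[x in LHS]scale1r lT scale1r. Qed.

Lemma boundedB x y : T (x - y) = T x - T y.
Proof. by rewrite boundedD -scaleN1r boundedZ scaleN1r. Qed.

Lemma bounded0 : T 0 = 0.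
Proof. by rewrite -(scale0r (0 : V)) boundedZ scale0r. Qed.

Lemma bounded_sum (I : Type) (r : seq I) (P : pred I) (f : I -> V) :
  T (\sum_(i <- r | P i) f i) = \sum_(i <- r | P i) T (f i).
Proof.
by elim/big_rec2 : _ => [|i u v _ <-]; [exact: bounded0|rewrite boundedD].
Qed.

Lemma bounded_cvg (u : nat -> V) l : u @ \oo --> l -> (fun n => T (u n)) @ \oo --> T l.
Proof.
have [M M0 TM] := bounded_nrm.
move=> /cvg_nrmP h; apply/cvg_nrmP => e e0.
have M1 : 0 < M + 1 by rewrite ltr_wpDl.
have := h (e / (M + 1)); rewrite divr_gt0// => /(_ isT).
apply: filterS => n; rewrite ltr_pdivlMr// => hn; rewrite -boundedB.
apply: le_lt_trans hn; apply: (le_trans (TM _)).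
by rewrite mulrC ler_wpM2l ?nrm_ge0// lerDl.
Qed.

End bounded.

Lemma bounded_operatorP (V W : preHilbertType R) (T : V -> W) (M : R) :
  linear T -> (forall x, nrm (T x) <= M * nrm x) -> bounded_operator T.
Proof.
move=> lT TM; split => //; exists M => x.
by rewrite !nrmE -rmorphM/= lecR.
Qed.

Lemma bounded_comp (U V W : preHilbertType R) (S : V -> W) (T : U -> V) :
  bounded_operator S -> bounded_operator T -> bounded_operator (S \o T).
Proof.
move=> bS bT; have [M M0 hM] := bounded_nrm bS; have [N N0 hN] := bounded_nrm bT.
apply: (@bounded_operatorP _ _ _ (M * N)).
  by move=> a x y /=; rewrite (boundedD bT) (boundedZ bT) (boundedD bS) (boundedZ bS).
move=> x /=; apply: (le_trans (hM _)); rewrite -mulrA ler_wpM2l//.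
Qed.

Section adjoint_operator.
Variables (V W : preHilbertType R) (T : V -> W).
Hypothesis bT : bounded_operator T.

(** The existence of [A] makes [xget] return a solution, and the inner product separates points, so
    there is only one. *)
Lemma adjoint_spec (A : W -> V) : (forall x y, inner (T x) y = inner x (A y)) ->
  adjoint T = A.
Proof.
move=> TA; have h : forall x y, inner (T x) y = inner x (adjoint T y).
  by rewrite /adjoint; case: xgetP => [? -> //|/(_ A)/(_ TA)].
by apply/funext => y; apply: inner_ext => z; rewrite -h TA.
Qed.

(** Riesz representation in coordinates: A y is to have the coefficients c_k = <y, T b_k>. They are
    square summable, since v = sum_(k < n) c_k b_k satisfies |v|^2 = <y, T v> <= M |y| |v|. *)
Lemma adjoint_exists (b : nat -> V) : seq_complete V -> orthonormal_basis b ->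
  forall x y, inner (T x) y = inner x (adjoint T y).
Proof.
move=> cV bb; suff [A hA] : exists A : W -> V, forall x y, inner (T x) y = inner x (A y).
  by rewrite (adjoint_spec hA).
have [M M0 TM] := bounded_nrm bT; have [ob _] := bb.
pose c y k := inner y (T (b k)).
have cM y n : \sum_(k < n) normc (c y k) ^+ 2 <= (M * nrm y) ^+ 2.
  set s := \sum_(k < n) _.
  pose v := \sum_(k < n) c y k *: b k.
  have vE : nrm v ^+ 2 = s by apply: nrm_comb; exact: orthonormal_seq_upto.
  have : normc (inner y (T v)) = s.
    rewrite /v (bounded_sum bT) inner_sumr.
    rewrite (eq_bigr (fun k : 'I_n => (normc (c y k) ^+ 2)%:C)); last first.
      move=> k _; rewrite (boundedZ bT) innerZr -normc_sqr_conj mulrC.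
      by congr (_ * _).
    by rewrite -rmorph_sum normcR ger0_norm// sumr_ge0// => i _; exact: sqr_ge0.
  have := normc_inner y (T v); have := TM v; have := nrm_ge0 v; have := nrm_ge0 y.
  move=> y0 v0 Tv + E; rewrite E -vE => h.
  have [->|vn0] := eqVneq (nrm v) 0; first by rewrite expr0n sqr_ge0.
  have vp : 0 < nrm v by rewrite lt0r vn0.
  rewrite ler_sqr ?nnegrE// ?mulr_ge0//.
  rewrite -(ler_pM2r vp) -expr2; apply: (le_trans h).
  by rewrite mulrAC mulrC ler_wpM2r// mulrC.
exists (fun y => expand b (c y)) => x y.
have Ab n : inner (expand b (c y)) (b n) = c y n by exact: inner_expand (cM y).
have h1 := parseval cV ob bb (x := x) (y := expand b (c y)).
have := bounded_cvg bT (basis_expand cV ob bb (x := x)) => /(cvg_innerl (y := y)) h2.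
have E : (fun n => inner (T (series (fun k => inner x (b k) *: b k) n)) y) =
    series (fun k => inner x (b k) * Num.conj (inner (expand b (c y)) (b k)) : C^o).
  apply/funext => n; rewrite /series/= (bounded_sum bT) inner_suml.
  apply: eq_bigr => k _.
  by rewrite (boundedZ bT) innerZl Ab /c -innerC.
rewrite E in h2.
exact: (@cvg_unique _ (@norm_hausdorff C C^o) _ _ _ _ h2 h1).
Qed.

End adjoint_operator.

(** |A y|^2 = <T (A y), y> <= M |A y| |y|. *)
Lemma bounded_of_adjoint (V W : preHilbertType R) (T : V -> W) (A : W -> V) :
  bounded_operator T -> (forall x y, inner (T x) y = inner x (A y)) -> bounded_operator A.
Proof.
move=> bT TA; have [M M0 TM] := bounded_nrm bT.
apply: (@bounded_operatorP _ _ _ M).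
  by move=> a x y; apply: inner_ext => z; rewrite innerDr innerZr -!TA innerDr innerZr.
move=> y; have [->|n0] := eqVneq (nrm (A y)) 0; first by rewrite mulr_ge0 ?nrm_ge0.
have n1 : 0 < nrm (A y) by rewrite lt0r n0 nrm_ge0.
rewrite -(ler_pM2r n1) -expr2.
have := normc_inner (T (A y)) y; rewrite TA nrm_inner normcR ger0_norm ?sqr_ge0//.
move=> /le_trans; apply; rewrite mulrAC ler_wpM2r ?nrm_ge0//.
Qed.

Lemma unitary_of_bases (V W : preHilbertType R) (b : nat -> V) (u : nat -> W) :
  seq_complete V -> seq_complete W -> orthonormal_basis b -> orthonormal_basis u ->
  exists (U : V -> W) (Ui : W -> V), [/\ unitary_operator U, cancel U Ui, cancel Ui U,
    forall n, U (b n) = u n & forall n, Ui (u n) = b n].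
Proof.
move=> cV cW bb bu; have [ob _] := bb; have [ou _] := bu.
pose U x := expand u (fun k => inner x (b k)).
pose Ui x := expand b (fun k => inner x (u k)).
have UE x n : inner (U x) (u n) = inner x (b n) by exact: (inner_expand cW ou (c := fun k => inner x (b k)) _ (bessel_seq ob x)).
have UiE x n : inner (Ui x) (b n) = inner x (u n) by exact: (inner_expand cV ob (c := fun k => inner x (u k)) _ (bessel_seq ou x)).
have K1 : cancel U Ui by move=> x; apply: (basis_ext bb) => n; rewrite UiE UE.
have K2 : cancel Ui U by move=> x; apply: (basis_ext bu) => n; rewrite UE UiE.
have Ub n : U (b n) = u n by apply: (basis_ext bu) => k; rewrite UE ob ou.
have UI f g : inner (U f) (U g) = inner f g.
  have := parseval cW ou bu (x := U f) (y := U g).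
  rewrite (_ : (fun k => _) = (fun k => inner f (b k) * Num.conj (inner g (b k)))).
    move=> /cvg_unique; apply; first exact: norm_hausdorff.
    exact: (parseval cV ob bb).
  by apply/funext => k; rewrite !UE.
exists U, Ui; split => //; last by move=> n; rewrite -Ub K1.
split => //; last by move=> y _; exists (Ui y).
apply: (@bounded_operatorP _ _ _ 1).
  by move=> a x y; apply: (basis_ext bu) => n; rewrite UE !innerDl !innerZl !UE.
move=> x; rewrite mul1r -ler_sqr ?nnegrE ?nrm_ge0//.
by rewrite -lecR -!nrm_inner UI.
Qed.

End orthonormal_basis.

(** * Completeness of L^2 *)

Section L2_class_theory.
Context d (T : measurableType d) (R : realType).
Variable mu : {measure set T -> \bar R}.
Local Notation C := R[i].
Local Notation L2R := (L2 mu).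
Implicit Types (x y : L2R) (f g : T -> C).

(* For the Lebesgue measure this is L2_class. *)
Definition L2_rep (x : L2R) (f : T -> C) :=
  square_integrable mu f /\ {ae mu, forall s, x s = f s}.

Local Open Scope quotient_scope.

Lemma L2_rep_repr x : L2_rep x x.
Proof. by split; [exact: L2funP|exact: nearW]. Qed.

Lemma square_integrable_ae f g : square_integrable mu f -> cmeasurable g ->
  {ae mu, forall s, f s = g s} -> square_integrable mu g.
Proof.
move=> [mf fi] mg fg; split => //.
rewrite (_ : (\int[mu]_s _)%E = (\int[mu]_s (normc (f s) ^+ 2)%:E)%E)//.
apply: ae_eq_integral => //.
- exact/measurable_EFinP/measurable_normc_sqr.
- exact/measurable_EFinP/measurable_normc_sqr.
- by apply: filterS fg => s /= -> _.
Qed.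

Lemma L2_rep_ae x f g : L2_rep x f -> cmeasurable g ->
  {ae mu, forall s, f s = g s} -> L2_rep x g.
Proof.
move=> [fi xf] mg fg; split; first exact: square_integrable_ae fg.
by apply: filterS2 xf fg => s -> ->.
Qed.

Lemma L2_rep_pi (F : L2fun mu) : L2_rep (\pi_L2R F) F.
Proof. by split; [exact: L2funP|exact: L2_reprK]. Qed.

Lemma L2_rep_exists f : square_integrable mu f -> exists x, L2_rep x f.
Proof.
move=> fi; have fP : f \in L2pred mu by exact/asboolP.
by exists (\pi_L2R (MkL2fun fP)); exact: L2_rep_pi.
Qed.

Lemma L2_rep_lin a x y f g : L2_rep x f -> L2_rep y g ->
  L2_rep (a *: x + y) (fun s => a * f s + g s).
Proof.
move=> [fi xf] [gi yg].
have h : L2_rep (a *: x + y) (fun s => a * x s + y s).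
  have := L2_rep_pi (a *: repr x + repr y).
  rewrite -pi_L2add -pi_L2scale !reprK; exact.
apply: (L2_rep_ae h).
  by apply: cmeasurableD; [apply: cmeasurableZ; exact: fi.1|exact: gi.1].
by apply: filterS2 xf yg => s -> ->.
Qed.

Lemma L2_rep0 : L2_rep (0 : L2R) (fun=> 0).
Proof.
apply: (L2_rep_ae (L2_rep_pi 0)); first exact: cmeasurable0.
exact: nearW.
Qed.

Lemma L2_repD x y f g : L2_rep x f -> L2_rep y g ->
  L2_rep (x + y) (fun s => f s + g s).
Proof.
move=> xf yg; have := L2_rep_lin 1 xf yg; rewrite scale1r.
by under eq_fun do rewrite mul1r.
Qed.

Lemma L2_repZ a x f : L2_rep x f -> L2_rep (a *: x) (fun s => a * f s).
Proof.
move=> xf; have := L2_rep_lin a xf L2_rep0; rewrite addr0.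
by under eq_fun do rewrite addr0.
Qed.

Lemma L2_repB x y f g : L2_rep x f -> L2_rep y g ->
  L2_rep (x - y) (fun s => f s - g s).
Proof.
move=> xf yg; have := L2_repD xf (L2_repZ (-1) yg); rewrite scaleN1r.
by under eq_fun do rewrite mulN1r.
Qed.

Lemma L2_rep_series (x : nat -> L2R) (f : nat -> T -> C) n :
  (forall k, L2_rep (x k) (f k)) -> L2_rep (series x n) (fun s => series (f^~ s) n).
Proof.
move=> xf; elim: n => [|n IH].
  rewrite /series/= big_geq// (_ : (fun s => _) = (fun=> 0)); first exact: L2_rep0.
  by apply/funext => s; rewrite big_geq.
rewrite seriesSr (_ : (fun s => _) = (fun s => series (f^~ s) n + f n s)).
  exact: L2_repD.
by apply/funext => s; rewrite seriesSr.
Qed.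

Lemma L2_rep_inner x y f g : L2_rep x f -> L2_rep y g ->
  inner x y = cintegral mu (fun s => f s * Num.conj (g s)).
Proof.
move=> [fi xf] [gi yg]; apply: ae_eq_cintegral.
- by apply: cmeasurableM; [exact: (L2funP (repr x)).1|
    apply: cmeasurableJ; exact: (L2funP (repr y)).1].
- by apply: cmeasurableM; [exact: fi.1|apply: cmeasurableJ; exact: gi.1].
- by apply: filterS2 xf yg; rewrite /L2_fun => s -> ->.
Qed.

Lemma L2_rep_nrm x f : L2_rep x f ->
  (\int[mu]_s (normc (f s) ^+ 2)%:E = (nrm x ^+ 2)%:E)%E.
Proof.
move=> [fi xf].
have [mf ii] := (square_integrableE mu f).1 fi.
have := L2_rep_inner (conj fi xf) (conj fi xf); rewrite nrm_inner.
move=> /(congr1 (@complex.Re R))/= ->.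
rewrite -[LHS]fineK ?integrable_fin_num//; congr (_%:E).
rewrite /Rintegral; congr fine; apply: eq_integral => s _.
by rewrite normc_sqr_conj.
Qed.

Lemma L2_rep_inj x y f : L2_rep x f -> L2_rep y f -> x = y.
Proof.
move=> xf yf; apply/eqP; rewrite -subr_eq0 -nrm_eq0 -sqrf_eq0; apply/eqP.
have [] // : ((nrm (x - y) ^+ 2)%:E = 0)%E.
rewrite -(L2_rep_nrm (L2_repB xf yf)).
under eq_integral do rewrite subrr normc0 expr0n.
by rewrite integral0.
Qed.

Lemma cmeasurable_cvg (f : nat -> T -> C) g : (forall n, cmeasurable (f n)) ->
  (forall s, (f n s : C^o) @[n --> \oo] --> (g s : C^o)) -> cmeasurable g.
Proof.
move=> mf fg.
have H (p : C -> R) : (forall z w, `|p z - p w| <= normc (z - w)) ->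
    forall s, p (f n s) @[n --> \oo] --> p (g s).
  move=> pP s; apply/cvgrPdist_lt => e e0.
  have := (cvg_nrmP _ _ _).1 (fg s) _ e0 => -[N _ h]; exists N => // n Nn.
  by have := h n Nn; rewrite nrm_complex distrC => /(le_lt_trans _); apply.
split.
- refine (@measurable_fun_cvg d T R setT (fun n => @complex.Re R \o f n) (@complex.Re R \o g) _ _) => [n|s _].
    by have [] := mf n.
  by apply: H => -[a b] [a' b']; exact: (ge0_normc_Re ((a +i* b) - (a' +i* b'))).
- refine (@measurable_fun_cvg d T R setT (fun n => @complex.Im R \o f n) (@complex.Im R \o g) _ _) => [n|s _].
    by have [] := mf n.
  by apply: H => -[a b] [a' b']; exact: (ge0_normc_Im ((a +i* b) - (a' +i* b'))).
Qed.

Lemma fatou_nrm (x : nat -> L2R) (f : nat -> T -> C) g (M : R) : 0 <= M ->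
  (forall n, L2_rep (x n) (f n)) -> (forall n, nrm (x n) <= M) ->
  (forall s, (f n s : C^o) @[n --> \oo] --> (g s : C^o)) ->
  (\int[mu]_s (normc (g s) ^+ 2)%:E <= (M ^+ 2)%:E)%E.
Proof.
move=> M0 xf xM fg.
have := @fatou _ _ _ mu setT measurableT (fun n s => (normc (f n s) ^+ 2)%:E).
move=> h; rewrite (_ : (\int[mu]_s _)%E =
    (\int[mu]_s limn_einf (fun n => (normc (f n s) ^+ 2)%:E))%E); last first.
  apply: eq_integral => s _.
  have : (fun n => (normc (f n s) ^+ 2)%:E) @ \oo --> (normc (g s) ^+ 2)%:E.
    apply: cvg_EFin; first exact: nearW.
    rewrite expr2 (_ : fine \o _ = (fun n => normc (f n s) * normc (f n s))); last first.
      by apply/funext => n /=; rewrite expr2.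
    have h' : normc (f n s) @[n --> \oo] --> normc (g s).
      rewrite -nrm_complex; under eq_cvg do rewrite -nrm_complex.
      exact: cvg_nrm (fg s).
    exact: cvgM.
  by move=> /cvg_limn_einf_sup[-> _].
apply: le_trans (h _ _) _.
- by move=> n; apply/measurable_EFinP/measurable_normc_sqr; exact: (xf n).1.1.
- by move=> n s _; rewrite lee_fin sqr_ge0.
- rewrite limn_einf_lim; apply: lime_le; first exact: is_cvg_einfs.
  apply: nearW => n; apply: (@le_trans _ _ (\int[mu]_s (normc (f n s) ^+ 2)%:E)%E).
    by apply: ereal_inf_lbound; exists n => //=.
  by rewrite (L2_rep_nrm (xf n)) lee_fin ler_sqr ?nnegrE ?nrm_ge0.
Qed.

(** Fatou's lemma, applied to the differences with a fixed late term, shows both that g is square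
    integrable and that the sequence converges to its class. *)
Lemma L2_cauchy_class (x : nat -> L2R) (f : nat -> T -> C) g : nrm_cauchy x ->
  (forall n, L2_rep (x n) (f n)) ->
  (forall s, (f n s : C^o) @[n --> \oo] --> (g s : C^o)) ->
  exists2 y, L2_rep y g & x @ \oo --> y.
Proof.
move=> cx xf fg.
have mg : cmeasurable g by apply: cmeasurable_cvg fg => n; exact: (xf n).1.1.
have H e : 0 < e -> exists N, forall m, (N <= m)%N ->
    (\int[mu]_s (normc (g s - f m s) ^+ 2)%:E <= (e ^+ 2)%:E)%E.
  move=> e0; have [N hN] := cx _ e0; exists N => m Nm.
  apply: (@fatou_nrm (fun n => x (n + N)%N - x m) (fun n s => f (n + N)%N s - f m s)).
  - exact: ltW.
  - by move=> n; exact: L2_repB.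
  - by move=> n; rewrite ltW// hN// leq_addl.
  - move=> s; apply: cvgB; last exact: cvg_cst.
    by have := fg s; rewrite -(cvg_shiftn N).
have [y yg] : exists y, L2_rep y g.
  apply: L2_rep_exists.
  have [N hN] := H 1 ltr01; have := hN N (leqnn N) => h1.
  have mB : cmeasurable (fun s => g s - f N s).
    rewrite (_ : (fun s => _) = (fun s => g s + (-1) * f N s)).
      by apply: cmeasurableD => //; apply: cmeasurableZ; exact: (xf N).1.1.
    by apply/funext => s; rewrite mulN1r.
  have h2 : square_integrable mu (fun s => g s - f N s).
    by split=> //; apply: le_lt_trans h1 _; rewrite ltry.
  have := square_integrableD h2 (xf N).1.
  by under eq_fun do rewrite subrK.
exists y => //; apply/cvg_nrmP => e e0.
have e20 : 0 < e / 2 by rewrite divr_gt0.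
have [N hN] := H _ e20; exists N => // m /= /hN.
rewrite (L2_rep_nrm (L2_repB yg (xf m))) lee_fin ler_sqr ?nnegrE ?nrm_ge0 ?(ltW e20)//.
by rewrite nrmB => /le_lt_trans; apply; lra.
Qed.

Lemma cvg_nrm_cauchy (B : normedModType C) (x : nat -> B) (l : B) : x @ \oo --> l -> nrm_cauchy x.
Proof.
move=> /cvg_nrmP xl e e0; have e20 : 0 < e / 2 by rewrite divr_gt0.
have [N _ h] := xl _ e20; exists N => m n Nm Nn.
rewrite -(subrKA l); apply: (le_lt_trans (nrmD _ _)).
by have := h m Nm; have := h n Nn; rewrite /= (nrmB l); lra.
Qed.

(** The bridge between series in L^2 and series of values: the norm limit is represented by the
    pointwise limit of the chosen representatives. *)
Lemma L2_rep_lim (x : nat -> L2R) (l : L2R) (f : nat -> T -> C) g : x @ \oo --> l ->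
  (forall n, L2_rep (x n) (f n)) ->
  (forall s, (f n s : C^o) @[n --> \oo] --> (g s : C^o)) -> L2_rep l g.
Proof.
move=> xl xf fg; have [y yg xy] := L2_cauchy_class (cvg_nrm_cauchy xl) xf fg.
by rewrite (cvg_unique (@norm_hausdorff C L2R) xl xy).
Qed.


Lemma cvg_subseq (B : normedModType C) (u : nat -> B) (phi : nat -> nat) (l : B) :
  nrm_cauchy u -> (forall k, (k <= phi k)%N) -> (fun k => u (phi k)) @ \oo --> l ->
  u @ \oo --> l.
Proof.
move=> cu kphi /cvg_nrmP ul; apply/cvg_nrmP => e e0.
have e20 : 0 < e / 2 by rewrite divr_gt0.
have [N hN] := cu _ e20; have [M _ hM] := ul _ e20.
exists N => // n /= Nn; rewrite -(subrKA (u (phi (maxn N M)))).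
apply: (le_lt_trans (nrmD _ _)).
have h1 := hM (maxn N M) (leq_maxr _ _).
have h2 := hN n (phi (maxn N M)) Nn (leq_trans (leq_maxl _ _) (kphi _)).
by move: h1 h2 => /=; lra.
Qed.

Lemma fast_subseq (B : normedModType C) (u : nat -> B) : nrm_cauchy u ->
  exists phi : nat -> nat, (forall k, (k <= phi k)%N) /\
   forall k, nrm (u (phi k.+1) - u (phi k)) <= 4^-1 ^+ k.
Proof.
move=> cu.
have /choice[N hN] : forall k, exists N, forall m n, (N <= m)%N -> (N <= n)%N ->
    nrm (u m - u n) < 4^-1 ^+ k.
  by move=> k; apply: cu; rewrite exprn_gt0// invr_gt0.
(* Summing all thresholds up to k puts [phi m] beyond [N k] for every m >= k, without a recursive
   choice. *)
pose phi k := (k + \sum_(i < k.+1) N i)%N.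
have phiN k m : (k <= m)%N -> (N k <= phi m)%N.
  move=> km; rewrite /phi (bigD1 (Ordinal (km : (k < m.+1)%N)))//=.
  by rewrite addnCA leq_addr.
exists phi; split=> k; first exact: leq_addr.
by rewrite ltW// hN// phiN.
Qed.

(* If |u_(k+1) - u_k| <= 4^-k in norm then sum_k 4^k |u_(k+1) - u_k|^2 is
   integrable, so that almost everywhere |u_(k+1) - u_k| = O(2^-k) pointwise. *)
Lemma L2_seq_complete : seq_complete L2R.
Proof.
move=> u cu; have [phi [kphi uphi]] := fast_subseq cu.
pose f k : T -> C := L2_fun (u (phi k)).
pose D k (s : T) : R := 4 ^+ k * normc (f k.+1 s - f k s) ^+ 2.
have mf k : cmeasurable (f k) := (L2_rep_repr (u (phi k))).1.1.
have mB k : cmeasurable (fun s => f k.+1 s - f k s).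
  rewrite (_ : (fun s => _) = (fun s => f k.+1 s + (-1) * f k s)).
    by apply: cmeasurableD => //; exact: cmeasurableZ.
  by apply/funext => s; rewrite mulN1r.
have mD k : measurable_fun setT (fun s => (D k s)%:E).
  by apply/measurable_EFinP/measurable_funM => //; exact: measurable_normc_sqr.
have D0 k s : (0 <= (D k s)%:E)%E by rewrite lee_fin mulr_ge0 ?exprn_ge0 ?normc_ge0.
pose G s := (\sum_(0 <= k <oo) (D k s)%:E)%E.
have mG : measurable_fun setT G by apply: ge0_emeasurable_sum.
have G0 s : (0 <= G s)%E by apply: nneseries_ge0.
have iD k : (\int[mu]_s (D k s)%:E <= (4^-1 ^+ k)%:E)%E.
  under eq_integral do rewrite EFinM.
  rewrite ge0_integralZl//; last 2 first.
  - exact/measurable_EFinP/measurable_normc_sqr.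
  - by move=> s _; rewrite lee_fin sqr_ge0.
  rewrite (L2_rep_nrm (L2_repB (L2_rep_repr (u (phi k.+1))) (L2_rep_repr (u (phi k))))).
  rewrite -EFinM lee_fin.
  apply: (@le_trans _ _ (4 ^+ k * (4^-1 ^+ k) ^+ 2)).
    by rewrite ler_wpM2l ?exprn_ge0// ler_sqr ?nnegrE ?nrm_ge0 ?exprn_ge0.
  by rewrite expr2 mulrA -exprMn mulfV// expr1n mul1r.
have GY : (\int[mu]_s G s < +oo)%E.
  rewrite integral_nneseries//.
  apply: (@le_lt_trans _ _ (\sum_(0 <= k <oo) (4^-1 ^+ k : R)%:E)%E).
    by apply: lee_nneseries => [k _ _|k _]; [exact: integral_ge0|exact: iD].
  have := @cvg_geometric_series R 1 4^-1.
  rewrite ger0_norm ?invr_ge0// invf_lt1// ltr1n => /(_ isT) h.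
  have /cvg_lim : (fun n => (\sum_(0 <= k < n) (4^-1 ^+ k : R)%:E)%E) @ \oo -->
      ((1 / (1 - 4^-1) : R)%:E).
    apply: cvg_EFin; first by apply: nearW => n; rewrite sumEFin.
    rewrite (_ : fine \o _ = series (geometric 1 4^-1))//.
    by apply/funext => n /=; rewrite sumEFin/= /series/=; apply: eq_bigr => k _; rewrite mul1r.
  by move=> -> //; rewrite ltry.
have iG : mu.-integrable setT G.
  by apply/integrableP; split => //; under eq_integral do rewrite gee0_abs//.
pose E : set T := G @^-1` [set +oo%E].
have mE : measurable E by rewrite -[E]setTI; apply: mG.
have aeE : {ae mu, forall s, ~ E s}.
  have := integrable_ae measurableT iG; apply: filterS => s /(_ I).
  by rewrite /E /= => + GE; rewrite GE.
have fE s : ~ E s -> exists c, geo (fun k => f k.+1 s - f k s : C^o) c.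
  move=> nE; have Gfin : G s \is a fin_num.
    by rewrite ge0_fin_numE// ltey; apply/eqP.
  exists (Num.sqrt (fine (G s))) => k; rewrite nrm_complex.
  rewrite -ler_sqr ?nnegrE ?normc_ge0 ?mulr_ge0 ?sqrtr_ge0 ?exprn_ge0//.
  have half4 : (2^-1 ^+ k) ^+ 2 = (4 ^+ k)^-1 :> R.
    by rewrite -exprM mulnC exprM -exprVn; congr (_ ^+ _); rewrite expr2 -invfM -natrM.
  rewrite exprMn sqr_sqrtr ?fine_ge0// half4 ler_pdivlMr ?exprn_gt0// mulrC -lee_fin fineK//.
  have := @nneseries_lim_ge _ (fun k => (D k s)%:E) xpredT 0%N k.+1 (fun n _ _ => D0 n s).
  apply: le_trans; rewrite big_nat_recr//= leeDr// sume_ge0// => i _; exact: D0.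
(* [L2_cauchy_class] asks for convergence at every point; cutting off the null set [E], where the
   series may diverge, provides it without changing the classes. *)
pose chi s : C := (\1_(~` E) s : R)%:C.
have mchi : cmeasurable chi.
  split; last exact: measurable_cst.
  rewrite (_ : _ \o _ = \1_(~` E)); last exact/funext.
  by apply: measurable_indic; exact: measurableC.
have chiE s : E s -> chi s = 0 by move=> Es; rewrite /chi indicE memNset//= => /(_ Es).
have chi1 s : ~ E s -> chi s = 1 by move=> Es; rewrite /chi indicE mem_set.
pose g s := chi s * (f 0 s + csum (fun k => f k.+1 s - f k s : C^o)).
have [y _ uy] : exists2 y, L2_rep y g & (fun k => u (phi k)) @ \oo --> y.
  apply: (@L2_cauchy_class _ (fun k s => chi s * f k s)).
  - move=> e e0; have [N hN] := cu _ e0; exists N => m n Nm Nn.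
    by apply: hN; [apply: leq_trans (kphi m)|apply: leq_trans (kphi n)].
  - move=> k; apply: (L2_rep_ae (L2_rep_repr _)); first exact: cmeasurableM.
    by apply: filterS aeE => s /chi1 ->; rewrite mul1r.
  - move=> s; have [Es|Es] := pselect (E s).
      by rewrite /g (chiE _ Es) mul0r; under eq_cvg do rewrite mul0r; exact: cvg_cst.
    rewrite /g (chi1 _ Es) mul1r; under eq_cvg do rewrite mul1r.
    have [c hc] := fE s Es.
    rewrite (_ : (fun k => f k s) = (fun k => f 0 s +
       series (fun k => f k.+1 s - f k s : C^o) k)); last first.
      by apply/funext => k; rewrite /series/= telescope_sumr// addrC subrK.
    apply: cvgD; first exact: cvg_cst.
    exact: geo_cvg (@seq_complete_C R) _ _ hc.
by apply/cvg_ex; exists y; exact: (cvg_subseq cu kphi).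
Qed.

End L2_class_theory.

(** * Smooth compactly supported functions *)

Section bump_functions.
Variable R : realType.
Implicit Types (P Q : {poly R}) (c x y : R).

(** The right-hand side is B / y because y will be 1/h: the bound is then B h, which tends to 0 with
    h. *)
Lemma exp_decay c n : 0 < c -> exists B : R, forall y, 0 < y -> y ^+ n * expR (- (c * y)) <= B / y.
Proof.
move=> c0; exists ((n.+1%:R / c) ^+ n.+1) => y y0.
rewrite ler_pdivlMr// mulrAC -exprSr expRN ler_pdivrMr ?expR_gt0//.
(* This is the (n+1)-st power of t <= exp t at t = c y / (n+1). *)
have h : (c * y / n.+1%:R) ^+ n.+1 <= expR (c * y).
  rewrite -[X in expR X](@divfK _ n.+1%:R) ?pnatr_eq0// [X in expR X]mulrC expRM_natl.
  rewrite lerXn2r ?nnegrE ?expR_ge0 ?divr_ge0 ?mulr_ge0 ?(ltW c0) ?(ltW y0)//.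
  by apply: le_trans (expR_ge1Dx _); rewrite lerDr.
have h2 : 0 <= (n.+1%:R / c) ^+ n.+1 by rewrite exprn_ge0// divr_ge0// ltW.
apply: le_trans (ler_wpM2l h2 h); rewrite -exprMn.
have N0 : n.+1%:R != 0 :> R by rewrite pnatr_eq0.
have cn0 : c != 0 by rewrite gt_eqF.
rewrite (_ : n.+1%:R / c * (c * y / n.+1%:R) = y)//.
by move: (n.+1%:R : R) N0 => N N0; field; rewrite N0 cn0.
Qed.

Lemma poly_decay P c : 0 < c ->
  exists B : R, forall y, 0 < y -> `|P.[y] * expR (- (c * y))| <= B / y.
Proof.
move=> c0; have /choice[B hB] := fun n => exp_decay n c0.
exists (\sum_(i < size P) `|P`_i| * B i) => y y0.
rewrite horner_coef mulr_suml mulr_suml; apply: (le_trans (ler_norm_sum _ _ _)).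
apply: ler_sum => i _; rewrite -!mulrA normrM ler_wpM2l//.
by rewrite ger0_norm ?hB// mulr_ge0 ?exprn_ge0 ?expR_ge0// ltW.
Qed.

Definition poly_exp c P x := if 0 < x then P.[x^-1] * expR (- (c * x^-1)) else 0.

(** With y = 1/x one has d/dx = - y^2 d/dy, so the functions P(y) exp(-c y) are closed under
    differentiation and a derivative is a computation on polynomials. *)
Definition poly_exp_deriv c P := 'X^2 * (c *: P - P^`()).

Lemma is_derive_poly_exp c P x : 0 < c ->
  is_derive (x : R^o) (1 : R^o) (poly_exp c P) (poly_exp c (poly_exp_deriv c P) x).
Proof.
move=> c0; have [x0|x0|x0] := ltgtP 0 x.
- apply: (@near_eq_is_derive _ _ _ (fun y => P.[y^-1] * expR (- (c * y^-1)))).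
    by near=> y; rewrite /poly_exp ifT//; near: y; exact: lt_nbhsr.
  rewrite /poly_exp x0.
  have xn0 : x != 0 by rewrite gt_eqF.
  have iV : is_derive (x : R^o) (1 : R^o) (fun y : R => y^-1) (- x ^- 2).
    have := @is_deriveV _ id x 1 1 xn0 (is_derive_id _ _).
    by rewrite /= scaler1.
  have iP := @is_derive1_comp _ (horner P) (fun y : R => y^-1) x _ _ (is_derive_poly P _) iV.
  have iE := @is_derive1_comp _ expR (fun y : R => - (c * y^-1)) x _ _ (is_derive_expR _)
      (is_deriveN (is_deriveZ c iV)).
  refine (is_derive_eq (is_deriveM iP iE) _).
  rewrite /poly_exp_deriv !hornerE /= /GRing.scale/=.
  by field.
- apply: (@near_eq_is_derive _ _ _ (cst 0)).
    by near=> y; rewrite /poly_exp ifF//; apply/negbTE; rewrite -leNgt ltW//; near: y; exact: lt_nbhsl.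
  by rewrite /poly_exp ltNge (ltW x0)/=; exact: is_derive_cst.
- rewrite -x0 [X in is_derive _ _ _ X]/poly_exp ltxx.
  (* At 0 the difference quotient for h > 0 is y P(y) exp(-c y) with y = 1/h, whence the extra
     factor ['X]. *)
  have [B hB] := poly_decay ('X * P) c0.
  have H : (fun h : R => h^-1 *: ((poly_exp c P \o shift 0) (h *: 1) - poly_exp c P 0))
      @ (0 : R)^' --> (0 : R).
    apply/cvgrPdist_lt => e e0.
    near=> h; rewrite sub0r normrN /poly_exp/= ltxx subr0 addr0 [h *: 1]mulr1.
    case: ifPn => h0; last by rewrite scaler0 normr0.
    have := hB h^-1; rewrite invr_gt0 invrK => /(_ h0).
    rewrite hornerM hornerX -mulrA => /le_lt_trans; apply.
    apply: (@le_lt_trans _ _ ((`|B| + 1) * h)).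
      by rewrite ler_wpM2r ?(ltW h0)// (le_trans (ler_norm B))// lerDl.
    rewrite mulrC -ltr_pdivlMr ?ltr_wpDl// -[h]gtr0_norm//; near: h; apply: dnbhs0_lt.
    by rewrite divr_gt0// ltr_wpDl.
  apply: DeriveDef; first by apply/cvg_ex; exists 0.
  exact/cvg_lim.
Unshelve. all: by end_near. Qed.

(* The code [l] stands for the sum over (P, Q) in l of
   P(1/(x-a)) exp(-c/(x-a)) Q(1/(b-x)) exp(-c/(b-x)) on ]a, b[. *)
Definition bump_code := seq ({poly R} * {poly R}).

Definition bump_fun c a b (l : bump_code) x : R :=
  \sum_(pq <- l) poly_exp c pq.1 (x - a) * poly_exp c pq.2 (b - x).

Definition bump_deriv c (l : bump_code) : bump_code :=
  flatten [seq [:: (poly_exp_deriv c pq.1, pq.2); (pq.1, - poly_exp_deriv c pq.2)] | pq <- l].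

Lemma is_derive_bump c a b l x : 0 < c ->
  is_derive (x : R^o) (1 : R^o) (bump_fun c a b l) (bump_fun c a b (bump_deriv c l) x).
Proof.
move=> c0; elim: l => [|[P Q] l IH].
  rewrite /bump_fun /bump_deriv/= big_nil (_ : (fun x => _) = cst 0).
    exact: is_derive_cst.
  by apply/funext => y; rewrite big_nil.
rewrite (_ : bump_fun c a b _ = (fun y => poly_exp c P (y - a) * poly_exp c Q (b - y)) +
    bump_fun c a b l); last first.
  by apply/funext => y; rewrite /bump_fun big_cons.
rewrite (_ : bump_fun c a b _ x = (poly_exp c P (x - a) *
     poly_exp c (- poly_exp_deriv c Q) (b - x) + poly_exp c Q (b - x) *
     poly_exp c (poly_exp_deriv c P) (x - a)) +
    bump_fun c a b (bump_deriv c l) x); last first.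
  by rewrite /bump_fun /bump_deriv/= !big_cons/=; ring.
apply: is_deriveD.
have iP := @is_derive1_comp _ (poly_exp c P) (fun y : R => y - a) x _ _
  (is_derive_poly_exp P _ c0) (is_deriveB (is_derive_id _ _) (is_derive_cst _ _ _)).
have iQ := @is_derive1_comp _ (poly_exp c Q) (fun y : R => b - y) x _ _
  (is_derive_poly_exp Q _ c0) (is_deriveB (is_derive_cst _ _ _) (is_derive_id _ _)).
refine (is_derive_eq (is_deriveM iP iQ) _).
rewrite /GRing.scale/= /poly_exp; case: ifPn => _; case: ifPn => _; rewrite ?hornerN; ring.
Qed.

(** The parameter c is kept because the bumps tend to the indicator function of ]a, b[ as c tends to
    0, which is how totality is obtained. *)
Definition smooth_bump c a b := bump_fun c a b [:: (1, 1)].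

Lemma bumpE c a b x : smooth_bump c a b x =
  if a < x < b then expR (- (c * (x - a)^-1)) * expR (- (c * (b - x)^-1)) else 0.
Proof.
rewrite /smooth_bump /bump_fun big_seq1/= /poly_exp !subr_gt0 !hornerE.
by case: (a < x); case: (x < b) => /=; rewrite ?mul1r ?mulr0 ?mul0r.
Qed.

Lemma bump_derivatives c a b : 0 < c -> exists D : nat -> R -> R,
  [/\ D 0 = smooth_bump c a b, forall n (x : R), is_derive (x : R^o) (1 : R^o) (D n) (D n.+1 x) &
      forall n x, ~~ (a < x < b) -> D n x = 0].
Proof.
move=> c0; exists (fun n => bump_fun c a b (iter n (bump_deriv c) [:: (1, 1)])).
split => // [n x|n x nx]; first exact: is_derive_bump.
rewrite /bump_fun big1// => -[P Q] _ /=; rewrite /poly_exp !subr_gt0.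
by move: nx; case: (a < x); case: (x < b) => //=; rewrite ?mulr0 ?mul0r.
Qed.

End bump_functions.

Arguments normc : simpl never.

Section test_functions.
Variable R : realType.
Local Notation C := R[i].
Local Notation mu := (@lebesgue_measure R).

Lemma has_deriv_continuous (B : normedModType C) (f : R -> B) s l :
  has_deriv f s l -> {for s, continuous f}.
Proof.
move=> /has_derivP fl; apply/cvg_nrmP => e e0.
have M0 : 0 < nrm l + 1 by rewrite ltr_wpDl// nrm_ge0.
have [d /= d0 hd] := (nbhs_ballP _ _).1 (fl 1 ltr01).
have de0 : 0 < Num.min d (e / (nrm l + 1)) by rewrite lt_min d0 divr_gt0.
apply/nbhs_ballP; exists (Num.min d (e / (nrm l + 1))) => //= t.
rewrite /ball_/= lt_min => /andP[h1 h2].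
have [->|ts] := eqVneq t s; first by rewrite subrr nrm0.
have ts0 : t - s != 0 by rewrite subr_eq0.
have := hd (t - s); rewrite ?/ball_/= -?ball_normE/= sub0r normrN distrC => /(_ h1 ts0).
rewrite [s + _]addrC subrK => h3.
have h4 : nrm ((t - s)^-1%:C *: (f t - f s)) < nrm l + 1.
  by have := nrm_le_sub ((t - s)^-1%:C *: (f t - f s)) l; lra.
move: h4; rewrite nrmZC normfV mulrC ltr_pdivrMr ?normr_gt0// => h4.
apply: (lt_trans h4); rewrite mulrC -ltr_pdivlMr//.
by rewrite distrC.
Qed.

Lemma has_derivD (B : normedModType C) (f g : R -> B) s l m :
  has_deriv f s l -> has_deriv g s m -> has_deriv (fun s => f s + g s) s (l + m).
Proof.
rewrite /has_deriv => fl gm.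
rewrite (_ : (fun h => _) = (fun h => h^-1%:C *: (f (s + h) - f s) +
    h^-1%:C *: (g (s + h) - g s))); first exact: cvgD fl gm.
by apply/funext => h; rewrite opprD addrACA scalerDr.
Qed.

Lemma has_derivZ (B : normedModType C) a (f : R -> B) s l :
  has_deriv f s l -> has_deriv (fun s => a *: f s) s (a *: l).
Proof.
rewrite /has_deriv => fl.
rewrite (_ : (fun h => _) = (fun h => a *: (h^-1%:C *: (f (s + h) - f s)))).
  exact: cvgZr fl.
by apply/funext => h; rewrite -scalerBr !scalerA mulrC.
Qed.

Lemma is_derive_has_deriv (f : R -> R) (x l : R) :
  is_derive (x : R^o) (1 : R^o) f l -> has_deriv (fun s => (f s)%:C : C^o) x (l%:C).
Proof.
move=> -[fx fl]; apply/has_derivP => e e0.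
have : (fun h : R => h^-1 *: ((f \o shift x) (h *: (1 : R^o)) - f x)) @ (0 : R)^' --> l.
  by rewrite -fl.
move=> /cvgrPdist_lt/(_ _ e0); apply: filterS => h.
move=> H0; have {H0}H : `|h^-1 * (f (x + h) - f x) - l| < e.
  by move: H0; rewrite distrC /= [h *: 1]mulr1 [h + x]addrC.
rewrite nrm_complex.
rewrite [X in normc X](_ : _ = (h^-1 * (f (x + h) - f x) - l)%:C) ?normcR//.
by rewrite rmorphB rmorphM rmorphB.
Qed.

(* D n is the n-th derivative of D 0, and all D n vanish outside a common bounded set. *)
Definition test_derivatives (D : nat -> R -> C) :=
  (forall n s, has_deriv (D n : R -> C^o) s (D n.+1 s)) /\
  exists K : R, forall n s, K < `|s| -> D n s = 0.

Lemma test_derivatives_lin a D E : test_derivatives D -> test_derivatives E ->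
  test_derivatives (fun n s => a * D n s + E n s).
Proof.
move=> [hD [K DK]] [hE [L EL]]; split.
  by move=> n s; apply: has_derivD => //; exact: (@has_derivZ C^o).
exists (Num.max K L) => n s; rewrite gt_max => /andP[/DK-> /EL->].
by rewrite mulr0 addr0.
Qed.

Variable D : nat -> R -> C.
Hypothesis hD : test_derivatives D.

Lemma test_C0 n : C0 (D n : R -> C^o).
Proof.
have [dD [K DK]] := hD; apply/C0P; split.
  by move=> s; exact: has_deriv_continuous (dD n s).
move=> e e0; exists [set` `[- K, K]]; first exact: segment_compact.
move=> x; rewrite /= in_itv/= -ler_norml => /negP; rewrite -ltNge => /DK ->.
by rewrite nrm0.
Qed.

Lemma test_bounded n : exists M, forall x, normc (D n x) <= M.
Proof.
have [M hM] := C0_bounded (test_C0 n); exists M => x.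
by rewrite -nrm_complex.
Qed.

Lemma continuous_cmeasurable (f : R -> C^o) : continuous f -> cmeasurable (f : measurableTypeR R -> C).
Proof.
move=> cf.
have H (p : C -> R) : (forall z w, `|p z - p w| <= normc (z - w)) ->
    continuous (fun x => p (f x)).
  move=> pP x; apply/cvgrPdist_lt => e e0.
  have /cvg_nrmP/(_ _ e0) := cf x; apply: (@filterS _ (nbhs x)) => t.
  by rewrite nrm_complex distrC => /(le_lt_trans _); apply.
split; apply: continuous_measurable_fun; apply: H.
- by move=> -[a b] [a' b']; exact: (ge0_normc_Re ((a +i* b) - (a' +i* b'))).
- by move=> -[a b] [a' b']; exact: (ge0_normc_Im ((a +i* b) - (a' +i* b'))).
Qed.

Lemma test_cmeasurable n : cmeasurable (D n : measurableTypeR R -> C).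
Proof. by apply: continuous_cmeasurable; have [] := test_C0 n. Qed.

Lemma indic_itv_integrable (a b c : R) : 
  mu.-integrable [set: R] (EFin \o (fun s => c * \1_`[a, b] s)).
Proof.
by apply: eq_integrable (integrableZl measurableT c (integrable_indic_itv a b true false)).
Qed.

Lemma test_square_integrable n : square_integrable mu (D n).
Proof.
have [_ [K DK]] := hD; have [M DM] := test_bounded n.
have M0 : 0 <= M by apply: le_trans (DM 0); exact: normc_ge0.
apply/square_integrableE; split; first exact: test_cmeasurable.
apply: (le_integrable _ _ _ (indic_itv_integrable (- K) K (M ^+ 2))) => //.
  exact/measurable_EFinP/measurable_normc_sqr/test_cmeasurable.
move=> x _ /=; rewrite lee_fin !ger0_norm ?sqr_ge0 ?mulr_ge0 ?sqr_ge0//.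
have [xK|xK] := leP `|x| K; last by rewrite DK// normc0 expr0n mulr_ge0// sqr_ge0.
rewrite indicE mem_set/= ?mulr1; last by rewrite in_itv/= -ler_norml.
by rewrite ler_sqr ?nnegrE ?normc_ge0.
Qed.

End test_functions.

(** * Unit vectors of L^2 that are uniformly small with many derivatives *)

Section tiny_functions.
Variable R : realType.
Local Notation C := R[i].
Local Notation mu := (@lebesgue_measure R).

Lemma is_derive_affine (f : R -> R) (a b x l : R) :
  is_derive ((x - b) / a : R^o) (1 : R^o) f l ->
  is_derive (x : R^o) (1 : R^o) (fun s => f ((s - b) / a)) (a^-1 * l).
Proof.
move=> fl.
have ab : is_derive (x : R^o) (1 : R^o) (fun s : R => (s - b) / a) a^-1.
  rewrite (_ : (fun _ => _) = a^-1 \*: (fun s : R => s - b)); last first.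
    by apply/funext => s; rewrite /= mulrC.
  refine (is_derive_eq (is_deriveZ _ (is_deriveB (is_derive_id _ _) (is_derive_cst _ _ _))) _).
  by rewrite subr0 /GRing.scale/= mulr1.
have h := @is_derive1_comp _ f (fun s : R => (s - b) / a) x l a^-1 fl ab.
by refine (is_derive_eq h _); rewrite mulrC.
Qed.

(** On the middle third both 1/y and 1/(1-y) are at most 3. *)
Lemma bump_ge (y : R) : 3^-1 <= y <= 1 - 3^-1 -> expR (-6) <= smooth_bump 1 0 1 y.
Proof.
move=> /andP[y1 y2]; have y0 : 0 < y by lra.
have y3 : 0 < 1 - y by lra.
rewrite bumpE y0/= -subr_gt0 y3 -expRD ler_expR subr0 !mul1r.
have : y^-1 <= 3 by rewrite -[leRHS]invrK lef_pV2// posrE.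
have : (1 - y)^-1 <= 3 by rewrite -[leRHS]invrK lef_pV2// ?posrE//; lra.
lra.
Qed.

(** The bump of ]0, 1[ is stretched to ]K, K + lam[. Its squared norm is at least exp(-12) lam / 3,
    from the middle third alone, while its derivatives do not grow; normalising makes them small.
    Vanishing on [-K, K] will give orthogonality to functions supported there. *)
Lemma tiny_function (j : nat) (K : R) : exists (v : L2 mu) (D : nat -> R -> C),
  [/\ test_derivatives D, L2_rep v (D 0), nrm v = 1,
      forall i s, (i <= j)%N -> normc (D i s) <= 2^-1 ^+ j &
      forall s, `|s| <= K -> D 0 s = 0].
Proof.
wlog K0 : K / 0 <= K.
  move=> W; have K0 : 0 <= Num.max K 0 by rewrite le_max lexx orbT.
  have [v [D [h1 h2 h3 h4 h5]]] := W _ K0.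
  by exists v, D; split => // s sK; apply: h5; rewrite le_max sK.
have [E [E0 Ed Es]] := @bump_derivatives R 1 0 1 ltr01.
pose Ec n s : C := (E n s)%:C.
have tE : test_derivatives Ec.
  split; first by move=> n s; exact: is_derive_has_deriv.
  exists 1 => n s s1; rewrite /Ec Es//; apply/negP => /andP[h1 h2].
  by move: s1; rewrite gtr0_norm// ltNge ltW.
have /choice[M hM] := test_bounded tE.
have M0 i : 0 <= M i by apply: le_trans (hM i 0); exact: normc_ge0.
pose B := \sum_(i < j.+1) M i.
have B0 : 0 <= B by apply: sumr_ge0.
(* Chosen so that exp(-12) lam / 3 >= (B 2^j)^2, where B dominates the first j derivatives of the
   bump; the summand 1 ensures lam >= 1. *)
pose lam := 1 + 3 * (expR 6 * B * 2 ^+ j) ^+ 2.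
have lam1 : 1 <= lam by rewrite lerDl mulr_ge0// sqr_ge0.
have lam0 : 0 < lam by exact: lt_le_trans lam1.
pose F n s : C := (lam^-1 ^+ n * E n ((s - K) / lam))%:C.
have tF : test_derivatives F.
  split.
    move=> n s; apply: is_derive_has_deriv.
    rewrite exprSr -mulrA; apply: (@is_deriveZ _ R^o R^o (fun s => E n ((s - K) / lam))).
    exact: is_derive_affine.
  exists (K + lam) => n s s1; rewrite /F Es ?mulr0//; apply/negP => /andP[].
  rewrite pmulr_lgt0 ?invr_gt0// ltr_pdivrMr// mul1r => h1 h2.
  by move: s1; rewrite gtr0_norm; lra.
have [v vF] := L2_rep_exists (test_square_integrable tF 0).
pose d := expR (-6 : R).
have d0 : 0 < d by exact: expR_gt0.
have nv : d ^+ 2 * (lam / 3) <= nrm v ^+ 2.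
  rewrite -lee_fin -(L2_rep_nrm vF).
  pose I := `[K + lam / 3, K + lam - lam / 3].
  have -> : (d ^+ 2 * (lam / 3))%:E = (\int[mu]_s (d ^+ 2 * \1_[set` I] s)%:E)%E.
    under eq_integral do rewrite EFinM.
    rewrite ge0_integralZl//; last 2 first.
    - exact/measurable_EFinP/measurable_indic.
    - by rewrite lee_fin sqr_ge0.
    have mI : lebesgue_measure [set` I] = (lam / 3)%:E.
      rewrite lebesgue_measure_itv/= lte_fin ifT; last by lra.
      by rewrite -EFinB; congr (_%:E); field.
    by rewrite integral_indic// setIT EFinM; congr (_ * _)%E; rewrite -mI.
  apply: ge0_le_integral => //.
  - by move=> s _; rewrite lee_fin mulr_ge0 ?sqr_ge0.
  - by apply/measurable_EFinP; apply: measurable_funM => //; exact: measurable_indic.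
  - exact/measurable_EFinP/measurable_normc_sqr/(test_cmeasurable tF).
  - move=> s _; rewrite lee_fin indicE; have [|_] := boolP (s \in [set` I]); last first.
      by rewrite mulr0 sqr_ge0.
    rewrite inE/= in_itv/= => /andP[s1 s2]; rewrite mulr1.
    rewrite ler_sqr ?nnegrE ?normc_ge0 ?(ltW d0)// /F expr0 mul1r normcR.
    apply: le_trans (ler_norm _); rewrite E0; apply: bump_ge.
    by rewrite ler_pdivlMr// ler_pdivrMr//; lra.
have nv1 : B * 2 ^+ j <= nrm v.
  rewrite -ler_sqr ?nnegrE ?nrm_ge0 ?mulr_ge0 ?exprn_ge0//.
  apply: le_trans nv.
  have -> : d = (expR 6)^-1 by rewrite /d expRN.
  have e0 : expR 6 != 0 :> R by rewrite gt_eqF// expR_gt0.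
  rewrite -ler_pdivrMl ?exprn_gt0 ?invr_gt0 ?expR_gt0// /lam.
  rewrite [leLHS](_ : _ = (expR 6 * B * 2 ^+ j) ^+ 2); last first.
    by rewrite -!exprVn invrK -exprMn mulrA.
  by lra.
have nv0 : 0 < nrm v.
  have h : 0 < nrm v ^+ 2.
    by apply: lt_le_trans nv; rewrite mulr_gt0 ?exprn_gt0// divr_gt0.
  by rewrite lt0r nrm_ge0 andbT; apply: contraTneq h => ->; rewrite expr0n ltxx.
pose a : C := (nrm v)^-1%:C.
(* The summand 0 gives the family the shape of [test_derivatives_lin]. *)
exists (a *: v), (fun n s => a * F n s + 0); split.
- have [h1 h2] := tF; have t0 : test_derivatives (fun (_ : nat) (_ : R) => (0 : C)).
    split; last by exists 0.
    by move=> n s; apply: is_derive_has_deriv; exact: is_derive_cst.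
  exact: test_derivatives_lin.
- by under eq_fun do rewrite addr0; exact: L2_repZ.
- by rewrite nrmZC ger0_norm ?invr_ge0 ?nrm_ge0// mulVf// gt_eqF.
- move=> i s ij; rewrite addr0 normcM normcR ger0_norm ?invr_ge0 ?nrm_ge0//.
  rewrite mulrC ler_pdivrMr// exprVn mulrC ler_pdivlMr ?exprn_gt0//.
  apply: le_trans nv1; rewrite ler_wpM2r ?exprn_ge0//.
  apply: (@le_trans _ _ (M i)).
    rewrite /F normcR normrM ger0_norm ?exprn_ge0 ?invr_ge0 ?(ltW lam0)//.
    have := hM i ((s - K) / lam); rewrite /Ec normcR; apply: le_trans.
    rewrite ler_piMl// exprn_ile1 ?invr_ge0 ?(ltW lam0)//.
    by rewrite invf_le1.
  by rewrite /B (bigD1 (Ordinal (ij : (i < j.+1)%N)))//= lerDl sumr_ge0.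
- move=> s sK; rewrite addr0 /F Es ?mulr0 ?mulr0//.
  apply/negP => /andP[]; rewrite pmulr_lgt0 ?invr_gt0// => h1 _.
  by have := ler_norm s; lra.
Qed.

End tiny_functions.

(** * A countable total family of bumps *)

Section totality.
Variable R : realType.
Local Notation C := R[i].
Local Notation mu := (@lebesgue_measure R).

Lemma locally_integrable_of_itv (g : R -> R) : measurable_fun [set: R] g ->
  (forall a b, mu.-integrable `[a, b] (EFin \o g)) -> locally_integrable [set: R] g.
Proof.
move=> mg ig; split => //; first exact: openT.
move=> K _ cK.
have [M [_ hM]] := compact_bounded (cK : compact (K : set R^o)).
have KM : K `<=` `[- (M + 1), M + 1].
  move=> x Kx; rewrite /= in_itv/= -ler_norml; apply: (hM (M + 1)) => //.
  by rewrite ltrDl.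
have /integrableP[_ fin] := ig (- (M + 1)) (M + 1).
apply: le_lt_trans fin; apply: ge0_subset_integral => //.
- exact: compact_measurable.
- by apply/measurable_EFinP; apply: measurableT_comp => //; exact: measurable_funS mg.
Qed.

(** Lebesgue differentiation: almost everywhere on ]-k, +oo[, g is the derivative of its integral
    from -k, which vanishes identically. Letting k run through the naturals covers the line. *)
Lemma ae0_of_itv_integral0 (g : R -> R) : measurable_fun [set: R] g ->
  (forall a b, mu.-integrable `[a, b] (EFin \o g)) ->
  (forall p q, p < q -> \int[mu]_(t in `]p, q]) g t = 0) ->
  {ae mu, forall x, g x = 0}.
Proof.
move=> mg ig g0; have lg := locally_integrable_of_itv mg ig.
have H (k : nat) : {ae mu, forall x, - k%:R < x -> g x = 0}.
  have ik y : mu.-integrable [set` Interval (BRight (- k%:R)) (BRight y)] (EFin \o g).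
    apply: integrableS (ig (- k%:R) y) => //.
    by apply: subset_itvr; rewrite bnd_simp.
  have := FTC1 ik lg; apply: filterS; first exact: (ae_filter_ringOfSetsType mu).
  move=> x /= h xk; have [_ <-] := h xk.
  rewrite (_ : (fun y => _) = cst 0) ?derive1_cst//.
  apply/funext => y; have [ky|yk] := ltP (- k%:R) y; first exact: g0.
  by rewrite set_itv_ge ?bnd_simp -?leNgt// Rintegral_set0.
have := ae_foralln H; apply: filterS.
move=> x hx; apply: (hx (Num.truncn `|x|).+1).
rewrite ltrNl (le_lt_trans (ler_norm _))// normrN.
exact: truncnS_gt.
Qed.

(** Rational endpoints and c = 1/(n+1) keep the family countable, so that it can be orthonormalised.
    Numbers that code nothing yield one more function of the same kind, which is harmless. *)
Definition bump_seq (j : nat) : R -> R :=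
  let: (n, p, q) := odflt (0%N, 0 : rat, 0 : rat) (unpickle j) in
  smooth_bump n.+1%:R^-1 (ratr p) (ratr q).

Lemma bump_seqP n (p q : rat) :
  exists j, bump_seq j = smooth_bump n.+1%:R^-1 (ratr p) (ratr q).
Proof. by exists (pickle (n, p, q)); rewrite /bump_seq pickleK. Qed.

Lemma bump_seq_derivatives j : exists2 D : nat -> R -> C, test_derivatives D &
  D 0 = (fun s => (bump_seq j s)%:C).
Proof.
rewrite /bump_seq; case: (odflt _ _) => -[n p] q.
have [|D [D0 Dd Ds]] := @bump_derivatives R n.+1%:R^-1 (ratr p) (ratr q).
  by rewrite invr_gt0.
exists (fun n s => (D n s)%:C); last by rewrite D0.
split; first by move=> m s; exact: is_derive_has_deriv.
exists (Num.max `|ratr p| `|ratr q|) => m s; rewrite gt_max => /andP[h1 h2].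
rewrite Ds//; apply/negP => /andP[h3 h4].
have [s0|s0] := leP 0 s.
  by move: h2; rewrite (ger0_norm s0); have := ler_norm (ratr q : R); lra.
by move: h1; rewrite (ltr0_norm s0); have := ler_norm (- (ratr p : R)); rewrite normrN; lra.
Qed.

(** The endpoints approach a and b from inside, so that all the bumps vanish off ]a, b[ and the
    limit holds at every point, including a and b. *)
Lemma cvg_smooth_bump (c p q : nat -> R) (a b : R) s :
  c @ \oo --> 0 -> (forall n, a < p n) -> (forall n, q n < b) ->
  p @ \oo --> a -> q @ \oo --> b ->
  (fun n => smooth_bump (c n) (p n) (q n) s) @ \oo --> (\1_`]a, b[ s : R).
Proof.
move=> cc pa qb cp cq; rewrite indicE.
have [sab|sab] := boolP (s \in `]a, b[%classic); last first.
  rewrite (_ : (fun n => _) = cst 0); first exact: cvg_cst.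
  apply/funext => n; rewrite bumpE ifF//; apply/negbTE.
  apply: contraNN sab => /andP[h1 h2]; rewrite inE/= in_itv/=.
  by rewrite (lt_trans (pa n) h1) (lt_trans h2 (qb n)).
move: sab; rewrite inE/= in_itv/= => /andP[as_ sb].
have H (u : nat -> R) (l : R) : 0 < l -> u @ \oo --> l ->
    (fun n => expR (- (c n * (u n)^-1))) @ \oo --> (1 : R).
  move=> l0 ul; rewrite -(expR0 R).
  apply: continuous_cvg; first exact: continuous_expR.
  rewrite -oppr0; apply: cvgN; rewrite -(mul0r (l^-1)).
  by apply: cvgM => //; apply: cvgV => //; rewrite gt_eqF.
have h1 : (fun n => expR (- (c n * (s - p n)^-1))) @ \oo --> (1 : R).
  by apply: (H _ (s - a)); [rewrite subr_gt0|apply: cvgB => //; exact: cvg_cst].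
have h2 : (fun n => expR (- (c n * (q n - s)^-1))) @ \oo --> (1 : R).
  by apply: (H _ (b - s)); [rewrite subr_gt0|apply: cvgB => //; exact: cvg_cst].
rewrite -[X in _ --> X](mulr1 (1 : R)).
apply: (cvg_trans _ (cvgM h1 h2)); apply: near_eq_cvg.
near=> n; rewrite bumpE ifT//; apply/andP; split.
  by near: n; exact: (cvgr_lt _ cp).
by near: n; exact: (cvgr_gt _ cq).
Unshelve. all: by end_near. Qed.

Lemma smooth_bump_ge0_le1 (c p q s : R) : 0 < c -> 0 <= smooth_bump c p q s <= \1_`]p, q[ s.
Proof.
move=> c0; rewrite bumpE indicE; have [pq|pq] := boolP (p < s < q).
  rewrite mem_set//= mulr_ge0 ?expR_ge0//=.
  move: pq => /andP[h1 h2].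
  by rewrite mulr_ile1 ?expR_ge0// -expR0 ler_expR oppr_le0 mulr_ge0 ?(ltW c0)// invr_ge0 subr_ge0 ltW.
by rewrite memNset//= ?lexx//; apply/negP.
Qed.

Lemma rat_seq (a b : R) : a < b -> exists p : nat -> rat,
  (forall n, a < ratr (p n) < b) /\ (fun n => ratr (p n) : R) @ \oo --> a.
Proof.
move=> ab.
have /choice[p hp] : forall n : nat, exists p : rat, a < ratr p < Num.min b (a + n.+1%:R^-1).
  move=> n; have [|p] := @rat_in_itvoo R a (Num.min b (a + n.+1%:R^-1)).
    by rewrite lt_min ab ltrDl invr_gt0 ltr0Sn.
  by rewrite in_itv/=; exists p.
exists p; split.
  by move=> n; have /andP[-> /=] := hp n; rewrite lt_min => /andP[].
apply: (@squeeze_cvgr _ _ _ _ (cst a) (fun n => a + n.+1%:R^-1)).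
- near=> n; have /andP[h1 h2] := hp n; rewrite (ltW h1)/= ltW//.
  by move: h2; rewrite lt_min => /andP[].
- exact: cvg_cst.
- rewrite -[X in _ --> X]addr0; apply: cvgD; [exact: cvg_cst|exact: cvg_harmonic].
Unshelve. all: by end_near. Qed.

Lemma rat_seq_left (a b : R) : a < b -> exists p : nat -> rat,
  (forall n, a < ratr (p n) < b) /\ (fun n => ratr (p n) : R) @ \oo --> b.
Proof.
move=> ab; have [|p [hp cp]] := @rat_seq (- b) (- a); first by rewrite ltrN2.
exists (fun n => - p n); split.
  by move=> n; rewrite rmorphN/= ltrNr ltrNl andbC; exact: hp.
by under eq_fun do rewrite rmorphN/=; rewrite -[b]opprK; exact: cvgN.
Qed.

(** Dominated convergence along bumps tending to the indicator of ]a, b[ makes the integral of g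
    over every interval vanish. *)
Lemma ae0_of_bump_integral0 (g : R -> R) : measurable_fun [set: R] g ->
  mu.-integrable [set: R] (fun s => (g s ^+ 2)%:E) ->
  (forall j, \int[mu]_s (g s * bump_seq j s) = 0) ->
  {ae mu, forall x, g x = 0}.
Proof.
move=> mg ig g0.
(* The dominating function is integrable because |g| <= g^2 + 1 on [a, b], which follows from (|g| -
   1)^2 >= 0. *)
have dom (a b : R) : mu.-integrable [set: R] (EFin \o (fun s => `|g s| * \1_`[a, b] s)).
  apply: le_integrable (integrableD measurableT ig (integrable_indic_itv a b true false)) => //.
    apply/measurable_EFinP; apply: measurable_funM; last exact: measurable_indic.
    exact: measurableT_comp.
  move=> x _ /=; rewrite lee_fin indicE normrM normr_id.
  have g2 := real_normK (num_real (g x)).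
  have := sqr_ge0 (`|g x| - 1); rewrite sqrrB1 -g2 => h.
  rewrite [leRHS]ger0_norm ?addr_ge0 ?sqr_ge0//.
  case: (x \in _) => /=; rewrite ?normr0 ?mulr0 ?normr1 ?mulr1; last by rewrite addr0 sqr_ge0.
  by have := normr_ge0 (g x); lra.
have ii (a b : R) : mu.-integrable `[a, b] (EFin \o g).
  rewrite integrable_mkcond//.
  apply: le_integrable (dom a b) => //.
    by apply/(measurable_restrictT _ _).1 => //; apply/measurable_EFinP; exact: measurable_funS mg.
  move=> x _ /=; rewrite patchE indicE; case: ifP => _; last by rewrite lee_fin normr0.
  by rewrite lee_fin mulr1 normr_id.
apply: (ae0_of_itv_integral0 mg ii) => a b ab.
have [p [hp cp]] := rat_seq ab; have [q [hq cq]] := rat_seq_left ab.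
pose f n s := (g s * smooth_bump n.+1%:R^-1 (ratr (p n)) (ratr (q n)) s)%:E.
have mb n : measurable_fun [set: R] (smooth_bump n.+1%:R^-1 (ratr (p n)) (ratr (q n)) : R -> R).
  have [j hj] := bump_seqP n (p n) (q n); rewrite -hj.
  have [D tD D0] := bump_seq_derivatives j.
  have [m _] := test_cmeasurable tD 0; move: m; rewrite D0.
  by rewrite (_ : _ \o _ = bump_seq j)//; apply/funext.
have mf n : measurable_fun [set: R] (f n) by apply/measurable_EFinP; exact: measurable_funM.
have fb n s : (`|f n s| <= (`|g s| * \1_`[a, b] s)%:E)%E.
  rewrite /f lee_fin normrM ler_wpM2l//.
  have [|b0 b1] := andP (@smooth_bump_ge0_le1 n.+1%:R^-1 (ratr (p n)) (ratr (q n)) s _).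
    by rewrite invr_gt0 ltr0Sn.
  rewrite ger0_norm//; apply: (le_trans b1); rewrite !indicE.
  have [|_] := boolP (s \in `]_, _[%classic); last by rewrite ler0n.
  rewrite inE/= in_itv/= => /andP[s1 s2].
  have /andP[p1 _] := hp n; have /andP[_ q1] := hq n.
  by rewrite mem_set//= in_itv/= (ltW (lt_trans p1 s1)) (ltW (lt_trans s2 q1)).
have f0 n : (\int[mu]_s f n s = 0)%E.
  have [j hj] := bump_seqP n (p n) (q n).
  have := g0 j; rewrite hj /Rintegral => h.
  rewrite -[LHS]fineK ?h//; apply: integrable_fin_num => //.
  apply: le_integrable (dom a b) => //; first exact: mf.
  move=> s _.
  by apply: (le_trans (fb n s)); rewrite /= lee_fin ler_norm.
have cf s : (fun n => f n s) @ \oo --> (g s * \1_`]a, b[ s)%:E.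
  apply: cvg_EFin; first exact: nearW.
  rewrite (_ : fine \o _ = (fun n => g s * smooth_bump n.+1%:R^-1 (ratr (p n)) (ratr (q n)) s))//.
  apply: cvgM; first exact: cvg_cst.
  apply: cvg_smooth_bump => //; first exact: cvg_harmonic.
  - by move=> n; have /andP[] := hp n.
  - by move=> n; have /andP[] := hq n.
have ml : measurable_fun [set: R] (fun s => (g s * \1_`]a, b[ s)%:E).
  by apply/measurable_EFinP; apply: measurable_funM => //; exact: measurable_indic.
have ae1 : {ae mu, forall s, [set: R] s -> f ^~ s @ \oo --> (g s * \1_`]a, b[ s)%:E}.
  by apply: aeW => s _; exact: cf.
have ae2 : {ae mu, forall s n, [set: R] s -> (`|f n s| <= (`|g s| * \1_`[a, b] s)%:E)%E}.
  by apply: aeW => s n _; exact: fb.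
have h : (\int[mu]_s f n s)%E @[n --> \oo] --> (\int[mu]_s (g s * \1_`]a, b[ s)%:E)%E.
  have [//| | | | |_ _] := @dominated_convergence _ _ _ mu setT measurableT f
    (fun s => (g s * \1_`]a, b[ s)%:E) (fun s => (`|g s| * \1_`[a, b] s)%:E).
  - exact: ml.
  - exact: ae1.
  - exact: dom.
  - exact: ae2.
  - exact.
have h0 : (\int[mu]_s (g s * \1_`]a, b[ s)%:E = 0)%E.
  apply/esym; move: h; rewrite (_ : (fun n => _) = cst 0%E); last first.
    by apply/funext => n; exact: f0.
  by move=> /cvg_lim <- //; rewrite lim_cst.
rewrite -Rintegral_itv_bndo_bndc; last first.
  apply: integrableS (ii a b) => //; apply: subset_itvW; exact: lexx.
rewrite /Rintegral integral_mkcond.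
have E : (EFin \o g) \_ `]a, b[ = (fun s => (g s * \1_`]a, b[ s)%:E).
  apply/funext => s; rewrite patchE indicE; case: ifP => _; first by rewrite mulr1.
  by rewrite mulr0.
by rewrite E h0.
Qed.

(** The bumps are real, so orthogonality to them splits into separate conditions on the real and the
    imaginary part of x. *)
Lemma L2_total (x : L2 mu) :
  (forall j (v : L2 mu), L2_rep v (fun s => (bump_seq j s)%:C : C) -> inner x v = 0) -> x = 0.
Proof.
move=> h; have [mx ix] := (square_integrableE mu x).1 (L2_rep_repr x).1.
have key j : (\int[mu]_s (complex.Re (x s) * bump_seq j s) = 0) /\
             (\int[mu]_s (complex.Im (x s) * bump_seq j s) = 0).
  have [D tD D0] := bump_seq_derivatives j.
  have sb : square_integrable mu (fun s => (bump_seq j s)%:C : C).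
    by rewrite -D0; exact: test_square_integrable.
  have [v vb] := L2_rep_exists sb.
  have := h j v vb; rewrite (L2_rep_inner (L2_rep_repr x) vb) /cintegral.
  move=> [h1 h2]; split.
    by rewrite -[RHS]h1; apply: eq_Rintegral => s _; case: (x s) => a b /=; ring.
  by rewrite -[RHS]h2; apply: eq_Rintegral => s _; case: (x s) => a b /=; ring.
have ip (p : C -> R) : measurable_fun [set: R] (fun s => p (x s)) ->
    (forall z, `|p z| <= normc z) -> mu.-integrable [set: R] (fun s => (p (x s) ^+ 2)%:E).
  move=> mp pz; apply: le_integrable ix => //.
    by apply/measurable_EFinP; exact: measurable_funX.
  move=> s _; rewrite lee_fin !ger0_norm ?sqr_ge0// -real_normK ?num_real//.
  by rewrite ler_sqr ?nnegrE ?normc_ge0.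
have a1 := ae0_of_bump_integral0 mx.1 (ip _ mx.1 (@ge0_normc_Re R)) (fun j => (key j).1).
have a2 := ae0_of_bump_integral0 mx.2 (ip _ mx.2 (@ge0_normc_Im R)) (fun j => (key j).2).
apply: (L2_rep_inj (L2_rep_repr x)).
have := L2_rep_ae (L2_rep0 mu) mx; apply.
have F := ae_filter_ringOfSetsType mu.
apply: (filterS2 _ _ a1 a2) => s /=; case: (x s) => a b /= -> ->.
by [].
Qed.

End totality.

(** * Adapted orthonormal bases *)

Section smooth_basis.
Variable R : realType.
Local Notation C := R[i].
Local Notation mu := (@lebesgue_measure R).

Lemma L2_smooth_basis : exists (u : nat -> L2 mu) (D : nat -> nat -> R -> C),
  [/\ orthonormal_basis u, forall n, test_derivatives (D n),
      forall n, L2_rep (u n) (D n 0) &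
      forall n i s, ~~ odd n -> (i <= n)%N -> normc (D n i s) <= 2^-1 ^+ n].
Proof.
pose A (v : L2 mu) := exists2 D : nat -> R -> C, test_derivatives D & L2_rep v (D 0).
pose Good n (v : L2 mu) := exists D : nat -> R -> C, [/\ test_derivatives D, L2_rep v (D 0) &
  forall i s, (i <= n)%N -> normc (D i s) <= 2^-1 ^+ n].
have /choice[x hx] : forall j, exists v : L2 mu, L2_rep v (fun s => (bump_seq j s)%:C : C).
  move=> j; have [D tD D0] := bump_seq_derivatives R j.
  by rewrite -D0; apply: L2_rep_exists; exact: test_square_integrable.
have A_lin (a : C) v w : A v -> A w -> A (a *: v + w).
  move=> [D tD vD] [E tE wE]; exists (fun n s => a * D n s + E n s).
    exact: test_derivatives_lin.
  exact: L2_rep_lin.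
have Ax j : A (x j).
  have [D tD D0] := bump_seq_derivatives R j; exists D => //.
  by rewrite D0; exact: hx.
have step n (w : nat -> L2 mu) : (forall i, (i < n)%N -> A (w i)) ->
    orthonormal_upto w n -> exists v, [/\ A v, nrm v = 1,
    forall i, (i < n)%N -> inner v (w i) = 0 & Good n v].
  move=> Aw _.
  (* The finitely many earlier vectors live in a common interval; a tiny function supported outside
     it is orthogonal to all of them. *)
  have [K hK] : exists K : R, forall i, (i < n)%N -> exists2 f : R -> C,
      L2_rep (w i) f & forall s, K < `|s| -> f s = 0.
    elim: n Aw => [|n IH] Aw; first by exists 0.
    have [|K hK] := IH; first by move=> i ni; apply: Aw; rewrite ltnW.
    have [D [_ [L DL]] wD] := Aw n (ltnSn n).
    exists (Num.max K L) => i; rewrite ltnS leq_eqVlt => /predU1P[->|/hK[f wf fK]].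
      by exists (D 0) => // s; rewrite gt_max => /andP[_ /DL].
    by exists f => // s; rewrite gt_max => /andP[/fK].
  have [v [D [tD vD v1 Dn DK]]] := tiny_function n K.
  exists v; split => //; first by exists D.
  - move=> i /hK[f wf fK]; rewrite (L2_rep_inner vD wf).
    rewrite (_ : (fun s => _) = (fun=> 0)).
      by rewrite /cintegral /Rintegral/= !integral0.
    apply/funext => s; have [sK|sK] := leP `|s| K; first by rewrite DK// mul0r.
    by rewrite fK// rmorph0 mulr0.
  - by exists D.
have [u [ou Au Gu xu]] := interleaved_orthonormalization false A_lin Ax step.
have /choice[D hD] : forall n, exists D : nat -> R -> C, [/\ test_derivatives D, L2_rep (u n) (D 0) &
    ~~ odd n -> forall i s, (i <= n)%N -> normc (D i s) <= 2^-1 ^+ n].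
  move=> n; have [no|no] := boolP (odd n).
    by have [D tD uD] := Au n; exists D; split.
  by have [D [h1 h2 h3]] := Gu n (negbTE no); exists D; split.
exists u, D; split.
- split => // y yu; apply: L2_total => j v vj.
  rewrite (L2_rep_inj vj (hx j)).
  (* Step 2j+1 puts the j-th bump into the span of the first 2j+2 vectors. *)
  have := xu j.*2.+1; rewrite /= odd_double => /(_ isT); rewrite uphalf_double.
  move=> /eqP; rewrite subr_eq0 => /eqP ->; rewrite inner_sumr big1// => i _.
  by rewrite innerZr yu mulr0.
- by move=> n; have [] := hD n.
- by move=> n; have [] := hD n.
- by move=> n i s no; have [_ _ /(_ no)] := hD n; exact.
Qed.

End smooth_basis.

(** * Orthonormal bases of H following the given sequence *)

Section hilbert_basis.
Variable R : realType.
Local Notation C := R[i].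
Variable H : hilbertType R.
Hypothesis Hsep : separable H.

(** If y is nonzero and orthogonal to a dense set, take d in that set with |y - d| < |y|; then |y|^2
    = <y, y - d> < |y|^2. *)
Lemma dense_sequence : exists x : nat -> H, forall y, (forall j, inner y (x j) = 0) -> y = 0.
Proof.
have [D [/countable_injP[f finj] dD]] := Hsep.
(* The injection [f] of the countable set into nat is inverted; naturals outside its range get 0,
   which imposes no condition on y. *)
exists (fun n => xget 0 [set d | D d /\ f d = n]) => y yx.
have yD d : D d -> inner y d = 0.
  move=> Dd; have := yx (f d); case: xgetP => [d' _ [Dd' fd] <-|/(_ d)/not_andP[]//].
  by rewrite (finj d d') ?inE.
apply/eqP; rewrite -nrm_eq0; apply/negP => /negP y0.
have yp : 0 < nrm y by rewrite lt0r y0 nrm_ge0.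
have [d [yd Dd]] : (ball y ((nrm y)%:C)) `&` D !=set0.
  apply: dD; last exact: ball_open.
  by exists y; apply: ballxx; rewrite ltcR.
move: yd; rewrite -ball_normE/= nrmE ltcR => yd.
have : nrm y ^+ 2 <= nrm y * nrm (y - d).
  have := normc_inner y (y - d); rewrite innerBr (yD _ Dd) subr0 nrm_inner.
  by rewrite normcR ger0_norm ?sqr_ge0.
by rewrite expr2 ler_pM2l// leNgt yd.
Qed.

Lemma hilbert_basis (Good : nat -> set H) :
  (forall n (w : nat -> H), orthonormal_upto w n -> exists v, [/\ nrm v = 1,
    forall i, (i < n)%N -> inner v (w i) = 0 & Good n v]) ->
  exists2 b, orthonormal_basis b & forall n, odd n -> Good n (b n).
Proof.
move=> step; have [x hx] := dense_sequence.
have step' n (w : nat -> H) : (forall i, (i < n)%N -> [set: H] (w i)) ->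
    orthonormal_upto w n -> exists v, [/\ [set: H] v, nrm v = 1,
    forall i, (i < n)%N -> inner v (w i) = 0 & Good n v].
  by move=> _ /step[v [h1 h2 h3]]; exists v.
have [b [ob _ Gb xb]] := interleaved_orthonormalization true
  (fun _ _ _ _ _ => I) (fun j => I : [set: H] (x j)) step'.
exists b => //; split => // y yb; apply: hx => j.
have := xb j.*2; rewrite odd_double => /(_ isT); rewrite doubleK.
move=> /eqP; rewrite subr_eq0 => /eqP ->; rewrite inner_sumr big1// => i _.
by rewrite innerZr yb mulr0.
Qed.

Variable e : nat -> H.
Hypothesis oe : orthonormal_sequence e.

(** An orthonormal sequence tends weakly to 0, so e_k is eventually almost orthogonal to finitely
    many given vectors. *)
Lemma escape n (w : nat -> H) (eps : R) : 0 < eps ->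
  exists N, forall k, (N <= k)%N -> \sum_(i < n) normc (inner (e k) (w i)) < eps.
Proof.
elim: n eps => [|n IH] eps e0; first by exists 0%N => k _; rewrite big_ord0.
have e20 : 0 < eps / 2 by rewrite divr_gt0.
have [N hN] := IH _ e20; have [M hM] := orthonormal_weak0 (w n) oe e20.
exists (maxn N M) => k; rewrite geq_max => /andP[/hN h1 /hM h2].
rewrite big_ord_recr/= [ltRHS]splitr ltrD//.
by rewrite innerC Defs.normcJ.
Qed.

(* v is the normalised residual of e k with respect to the w i.  The bound on
   T v involves a bound M of T because the family S_g need not be uniformly
   bounded; this is harmless, as M may depend on g. *)
Lemma escape_unit n (w : nat -> H) (eps : R) (P : nat -> Prop) : 0 < eps ->
  orthonormal_upto w n -> (\forall k \near \oo, P k) ->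
  exists v, [/\ nrm v = 1, forall i, (i < n)%N -> inner v (w i) = 0 &
   exists2 k, P k & forall (T : H -> H) M, 0 <= M -> bounded_operator T ->
     (forall x, nrm (T x) <= M * nrm x) -> nrm (T v) <= 2 * (nrm (T (e k)) + M * eps)].
Proof.
(* The bound 1/2 on the projection keeps the residual of norm at least 1/2, whence the factor 2
   after normalising; the bound [eps] controls the image of the projection under T. *)
move=> e0 ow [N0 _ PN]; have m0 : 0 < Num.min eps 2^-1 by rewrite lt_min e0 invr_gt0 ltr0n.
have [N hN] := escape n w m0.
pose k := maxn N0 N; have := hN k (leq_maxr _ _); rewrite lt_min => /andP[k1 k2].
pose s := \sum_(i < n) inner (e k) (w i) *: w i.
have sT (T : H -> H) M : 0 <= M -> bounded_operator T -> (forall x, nrm (T x) <= M * nrm x) ->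
    nrm (T s) <= M * \sum_(i < n) normc (inner (e k) (w i)).
  move=> M0 bT TM; apply: (le_trans (TM _)); rewrite ler_wpM2l//.
  apply: (le_trans (nrm_sum _ _ _)); apply: ler_sum => i _; rewrite nrmZ.
  rewrite (_ : nrm (w i) = 1) ?mulr1//; apply/eqP.
  rewrite -(@eqrXn2 _ 2)// ?nrm_ge0// expr1n; apply/eqP.
  by apply: (@complexI R); rewrite -nrm_inner ow// eqxx.
have id1 (x : H) : nrm (id x) <= 1 * nrm x by rewrite mul1r.
have bid : bounded_operator (@id H).
  by apply: (@bounded_operatorP _ _ _ _ 1) => // x; rewrite mul1r.
have r2 : 2^-1 <= nrm (residual w n (e k)).
  have := sT id 1 ler01 bid id1.
  have := nrm_le_sub (e k) s; rewrite (nrm_orthonormal _ oe) -/(residual w n (e k)).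
  by rewrite mul1r; lra.
have r0 : 0 < nrm (residual w n (e k)) by apply: lt_le_trans r2; rewrite invr_gt0.
exists ((nrm (residual w n (e k)))^-1%:C *: residual w n (e k)); split.
- by rewrite nrmZC ger0_norm ?invr_ge0 ?nrm_ge0// mulVf// gt_eqF.
- by move=> i ni; rewrite innerZl inner_residual// mulr0.
- exists k; first by apply: PN; exact: leq_maxl.
  move=> T M M0 bT TM; rewrite (boundedZ bT) nrmZC ger0_norm ?invr_ge0 ?nrm_ge0//.
  rewrite mulrC ler_pdivrMr// (boundedB bT).
  apply: (@le_trans _ _ (nrm (T (e k)) + M * eps)).
    have := nrmD (T (e k)) (- T s); rewrite nrmN => /le_trans; apply.
    rewrite lerD2l; apply: le_trans (sT T M M0 bT TM) _.
    by rewrite ler_wpM2l// ltW.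
  rewrite -mulrA mulrCA ler_peMr//.
    by rewrite addr_ge0 ?nrm_ge0// mulr_ge0// ltW.
  by move: r2; lra.
Qed.

End hilbert_basis.

(** * Kernels given by rapidly decaying matrices *)

Section conjugation.
Variable R : realType.
Local Notation C := R[i].

Lemma cvg_conj (T : Type) (F : set_system T) {FF : Filter F} (f : T -> C) (l : C) :
  (f t : C^o) @[t --> F] --> (l : C^o) ->
  (Num.conj (f t) : C^o) @[t --> F] --> (Num.conj l : C^o).
Proof.
move=> /(cvg_nrmP FF) fl; apply/cvg_nrmP => e /fl; apply: filterS => t.
rewrite !nrm_complex; suff -> : Num.conj (f t) - Num.conj l = Num.conj (f t - l).
  by rewrite Defs.normcJ.
by rewrite rmorphB.
Qed.

Lemma conjMl (a b : C) : Num.conj (Num.conj a * b) = a * Num.conj b.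
Proof. by rewrite rmorphM/= conjCK. Qed.

Lemma has_deriv_conj (f : R -> C) s l : has_deriv (f : R -> C^o) s l ->
  has_deriv (fun s => Num.conj (f s) : C^o) s (Num.conj l).
Proof.
rewrite /has_deriv => /cvg_conj; apply: cvg_trans; apply: near_eq_cvg.
near=> h; rewrite /GRing.scale/= rmorphM rmorphB; congr (_ * _).
exact: conjc_real.
Unshelve. all: by end_near. Qed.

Lemma C0_conj (X : topologicalType) (f : X -> C) : C0 (f : X -> C^o) ->
  C0 (fun x => Num.conj (f x) : C^o).
Proof.
move=> /C0P[fc f0]; apply/C0P; split; first by move=> x; apply: cvg_conj; exact: fc.
by move=> e /f0[K cK hK]; exists K => // x /hK; rewrite !nrm_complex Defs.normcJ.
Qed.

Lemma C0_scale (X : topologicalType) (B : normedModType C) (f : X -> C) (v : B) :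
  C0 (f : X -> C^o) -> C0 (fun x => f x *: v).
Proof.
move=> /C0P[fc f0]; apply/C0P; split.
  by move=> x; apply: (@cvgZl _ _ _ _ _ (f : X -> C^o)); exact: fc.
move=> e e0; have v0 : 0 < nrm v + 1 by rewrite ltr_wpDl ?nrm_ge0.
have [|K cK hK] := f0 (e / (nrm v + 1)); first by rewrite divr_gt0.
exists K => // x /hK; rewrite nrmZ nrm_complex ltr_pdivlMr// => h.
by apply: le_lt_trans h; rewrite ler_wpM2l ?normc_ge0// lerDl.
Qed.

(** Off the product of two compact sets one factor is small and the other is bounded. *)
Lemma C0_tensor (X Y : topologicalType) (f : X -> C) (g : Y -> C) :
  C0 (f : X -> C^o) -> C0 (g : Y -> C^o) -> C0 (fun p : X * Y => f p.1 * g p.2 : C^o).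
Proof.
move=> f0 g0; have [M hM] := C0_bounded f0; have [N hN] := C0_bounded g0.
have [fc {}f0] := (C0P _).1 f0; have [gc {}g0] := (C0P _).1 g0.
apply/C0P; split.
  move=> [x y]; apply: (@cvgM C (X * Y)%type).
    by apply: (cvg_comp _ _ cvg_fst); exact: fc.
  by apply: (cvg_comp _ _ cvg_snd); exact: gc.
move=> e e0; have MN0 : 0 < `|M| + `|N| + 1 by rewrite ltr_wpDl.
have [|K cK hK] := f0 (e / (`|M| + `|N| + 1)); first by rewrite divr_gt0.
have [|L cL hL] := g0 (e / (`|M| + `|N| + 1)); first by rewrite divr_gt0.
exists (K `*` L); first exact: compact_setX.
move=> [x y] /= nKL; rewrite nrm_complex normcM.
have fM : normc (f x) <= `|M| by rewrite -nrm_complex (le_trans (hM x))// ler_norm.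
have gN : normc (g y) <= `|N| by rewrite -nrm_complex (le_trans (hN y))// ler_norm.
have [Kx|nKx] := pselect (K x).
  have /hL : ~ L y by move=> Ly; apply: nKL.
  rewrite nrm_complex ltr_pdivlMr// => h; apply: le_lt_trans h.
  rewrite mulrC ler_wpM2l ?normc_ge0//; apply: (le_trans fM).
  by rewrite -addrA lerDl addr_ge0.
have := hK x nKx; rewrite nrm_complex ltr_pdivlMr// => h; apply: le_lt_trans h.
rewrite ler_wpM2l ?normc_ge0//; apply: (le_trans gN).
by rewrite addrAC lerDr addr_ge0.
Qed.

End conjugation.

Section csum_exchange.
Variable R : realType.
Local Notation C := R[i].
Variable B : normedModType C.
Hypothesis cB : seq_complete B.

Lemma csumD (f g : nat -> B) c d : geo f c -> geo g d ->
  csum (fun k => f k + g k) = csum f + csum g.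
Proof.
move=> fc gd; apply: csum_unique.
have -> : series (fun k => f k + g k) = (fun n => series f n + series g n).
  by apply/funext => n; rewrite /series/= big_split.
by apply: cvgD; [exact: geo_cvg fc|exact: geo_cvg gd].
Qed.

(** Finitely many rows can be summed inside the sum over n; the passage to all rows is Tannery's
    theorem, the partial column sums being dominated uniformly in N. *)
Lemma csum_exchange (a : nat -> nat -> B) c :
  (forall m n, nrm (a m n) <= c * 2^-1 ^+ m * 2^-1 ^+ n) ->
  csum (fun m => csum (a m)) = csum (fun n => csum (a^~ n)).
Proof.
move=> ac.
have g1 m : geo (a m) (c * 2^-1 ^+ m) by [].
have g2 n : geo (a^~ n) (c * 2^-1 ^+ n) by move=> m; rewrite mulrAC.
have G1 : geo (fun m => csum (a m)) (2 * c).
  by move=> m; have := geo_bound cB (g1 m); rewrite mulrA.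
have G2 : geo (fun n => csum (a^~ n)) (2 * c).
  by move=> n; have := geo_bound cB (g2 n); rewrite mulrA.
have gN N : geo (fun n => series (a^~ n) N) (2 * c).
  move=> n; have := geo_partial 0 N (g2 n); rewrite add0n expr0 mulr1 -mulrA.
  by rewrite /series/= mulrA.
have E N : series (fun m => csum (a m)) N = csum (fun n => series (a^~ n) N).
  elim: N => [|N IH].
    rewrite /series/= big_geq//; apply/esym/csum_unique.
    rewrite (_ : series _ = cst 0); first exact: cvg_cst.
    by apply/funext => n; rewrite /series/= big1// => i _; rewrite big_geq.
  rewrite seriesSr IH -(csumD (gN N) (g1 N)); congr csum.
  by apply/funext => n; rewrite seriesSr.
have h1 := geo_cvg cB G1.
have h2 : series (fun m => csum (a m)) @ \oo --> csum (fun n => csum (a^~ n)).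
  rewrite (_ : series _ = fun N => csum (fun n => series (a^~ n) N)); last exact/funext.
  apply: (cvg_csum cB (c := 2 * c)) => //; first exact: nearW.
  by move=> n; exact: geo_cvg (g2 n).
exact: cvg_unique h1 h2.
Qed.

End csum_exchange.

Lemma csum_conj (R : realType) (f : nat -> R[i]^o) c : geo f c ->
  csum (fun k => Num.conj (f k) : R[i]^o) = Num.conj (csum f).
Proof.
move=> fc; apply: csum_unique; have := geo_cvg (@seq_complete_C R) fc => /cvg_conj.
rewrite (_ : (fun t => _) = series (fun k => Num.conj (f k) : R[i]^o))//.
by apply/funext => N; rewrite /series/= rmorph_sum.
Qed.

Section kernels_from_matrices.
Variable R : realType.
Local Notation C := R[i].
Local Notation mu := (@lebesgue_measure R).
Variables (u : nat -> L2 mu) (D : nat -> nat -> R -> C) (w : nat -> R).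
Hypothesis u_basis : orthonormal_basis u.
Hypothesis D_test : forall n, test_derivatives (D n).
Hypothesis uD : forall n, L2_rep (u n) (D n 0).
Hypothesis w_ge0 : forall n, 0 <= w n.
Hypothesis wD : forall i, exists c : R, forall n s, w n * normc (D n i s) <= c * 2^-1 ^+ n.

Let cL2 : seq_complete (L2 mu) := @L2_seq_complete _ _ _ mu.
Let cC : seq_complete C^o := @seq_complete_C R.

Definition weighted_matrix (p : nat -> nat -> C) (c : R) :=
  forall m n, normc (p m n) <= c * (w m * w n).

(** The entry of p is treated as a vector of [C^o], so that the lemmas on series of scaled vectors
    serve both these scalar series and the L^2-valued ones. *)
Definition kernel_row (p : nat -> nat -> C) m j (t : R) : C :=
  csum (fun n => Num.conj (D n j t) *: (p m n : C^o)).

(* The partial derivative of order (i, j) of the sum of the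
   p m n * u_m(s) * conj (u_n(t)). *)
Definition matrix_kernel (p : nat -> nat -> C) i j (st : R * R) : C :=
  csum (fun m => D m i st.1 *: (kernel_row p m j st.2 : C^o)).

Lemma weight_bound i : exists2 c : R, 0 <= c & forall n s, w n * normc (D n i s) <= c * 2^-1 ^+ n.
Proof.
have [c hc] := wD i; exists c => //.
by have := hc 0%N 0; rewrite expr0 mulr1; apply: le_trans; rewrite mulr_ge0 ?normc_ge0.
Qed.

Section one_matrix.
Variables (p : nat -> nat -> C) (c0 : R).
Hypothesis c0_ge0 : 0 <= c0.
Hypothesis pw : weighted_matrix p c0.

(** Of the weight w_m w_n of the entry, w_n is spent on the derivative of u_n; w_m is left over for
    the sum over m. *)
Lemma kernel_row_geo j : exists2 c : R, 0 <= c &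
  forall m t, geo (fun n => Num.conj (D n j t) *: (p m n : C^o)) (c * w m).
Proof.
have [c cge hc] := weight_bound j; exists (c0 * c); first exact: mulr_ge0.
move=> m t n; rewrite nrmZ Defs.normcJ nrm_complex.
apply: (@le_trans _ _ (normc (D n j t) * (c0 * (w m * w n)))).
  by rewrite ler_wpM2l ?normc_ge0.
have := hc n t => /(ler_wpM2l (mulr_ge0 c0_ge0 (w_ge0 m))).
by lra.
Qed.

Lemma kernel_row_C0 m j : C0 (kernel_row p m j : R -> C^o).
Proof.
have [c c1 hc] := kernel_row_geo j.
apply: (C0_csum (c := c * w m)) => //.
move=> n; apply: C0_scale; apply: C0_conj; exact: test_C0.
Qed.

Lemma kernel_row_deriv m j t : has_deriv (kernel_row p m j : R -> C^o) t (kernel_row p m j.+1 t).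
Proof.
have [c c1 hc] := kernel_row_geo j; have [d d1 hd] := kernel_row_geo j.+1.
apply: (@has_deriv_csum R C^o (fun n s => Num.conj (D n j s))
  (fun n s => Num.conj (D n j.+1 s)) (p m) ((c + d) * w m)) => //.
- by move=> k s; apply: has_deriv_conj; have [h _] := D_test k; exact: h.
- move=> s k; apply: (le_trans (hc m s k)).
  by rewrite ler_wpM2r ?exprn_ge0// ler_wpM2r// lerDl.
- move=> s k; apply: (le_trans (hd m s k)).
  by rewrite ler_wpM2r ?exprn_ge0// ler_wpM2r// lerDr.
Qed.

Lemma matrix_kernel_geo i j : exists2 c : R, 0 <= c &
  forall st, geo (fun m => D m i st.1 *: (kernel_row p m j st.2 : C^o)) c.
Proof.
have [c c1 hc] := kernel_row_geo j; have [d d1 hd] := weight_bound i.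
exists (2 * c * d); first by rewrite !mulr_ge0.
move=> st m; rewrite nrmZ.
have := geo_bound cC (hc m st.2) => h1.
apply: (le_trans (ler_wpM2l (normc_ge0 _) h1)).
have := ler_wpM2l (mulr_ge0 (ler0n R 2) c1) (hd m st.1).
by lra.
Qed.

Lemma matrix_kernel_C0 i j : C0 (matrix_kernel p i j : R * R -> C^o).
Proof.
have [c c1 hc] := matrix_kernel_geo i j.
apply: (C0_csum (c := c)) => // m.
exact: (C0_tensor (test_C0 (D_test m) i) (kernel_row_C0 m j)).
Qed.

Lemma matrix_kernel_deriv1 i j s t :
  has_deriv (fun s => matrix_kernel p i j (s, t) : C^o) s (matrix_kernel p i.+1 j (s, t)).
Proof.
have [c c1 hc] := matrix_kernel_geo i j; have [d d1 hd] := matrix_kernel_geo i.+1 j.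
apply: (@has_deriv_csum R C^o (fun m s => D m i s) (fun m s => D m i.+1 s)
  (fun m => kernel_row p m j t) (c + d)) => //.
- by move=> k s'; have [h _] := D_test k; exact: h.
- move=> s' k; apply: (le_trans (hc (s', t) k)).
  by rewrite ler_wpM2r ?exprn_ge0// lerDl.
- move=> s' k; apply: (le_trans (hd (s', t) k)).
  by rewrite ler_wpM2r ?exprn_ge0// lerDr.
Qed.

(** Here the rows are the varying coefficients and the numbers [D m i s] the fixed vectors. *)
Lemma matrix_kernel_deriv2 i j s t :
  has_deriv (fun t => matrix_kernel p i j (s, t) : C^o) t (matrix_kernel p i j.+1 (s, t)).
Proof.
have [c c1 hc] := matrix_kernel_geo i j; have [d d1 hd] := matrix_kernel_geo i j.+1.
have E k t' : matrix_kernel p i k (s, t') = csum (fun m => kernel_row p m k t' *: (D m i s : C^o)).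
  by apply: (congr1 (@csum R C^o)); apply/funext => m; exact: mulrC.
rewrite E (_ : (fun t => _) = (fun t' => csum (fun m => kernel_row p m j t' *: (D m i s : C^o)))); last exact/funext.
apply: (@has_deriv_csum R C^o (fun m t => kernel_row p m j t) (fun m t => kernel_row p m j.+1 t)
  (fun m => D m i s) (c + d)) => //.
- by move=> k t'; exact: kernel_row_deriv.
- move=> t' k; rewrite [X in nrm X]mulrC; apply: (le_trans (hc (s, t') k)).
  by rewrite ler_wpM2r ?exprn_ge0// lerDl.
- move=> t' k; rewrite [X in nrm X]mulrC; apply: (le_trans (hd (s, t') k)).
  by rewrite ler_wpM2r ?exprn_ge0// lerDr.
Qed.

Lemma matrix_kernel_partial : C0_partial_derivatives (matrix_kernel p 0 0 : R * R -> C^o).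
Proof.
(* The iterated derivative depends only on how often each variable occurs in the word. *)
exists (fun l => matrix_kernel p (count negb l) (count id l)); split => //.
- by move=> l [s t]; exact: matrix_kernel_deriv1.
- by move=> l [s t]; exact: matrix_kernel_deriv2.
- by move=> l; exact: matrix_kernel_C0.
Qed.

Lemma matrix_kernel_measurable : cmeasurable (matrix_kernel p 0 0 : R * R -> C^o).
Proof.
have [c c1 hc] := matrix_kernel_geo 0 0.
apply: (@cmeasurable_cvg _ _ _ (fun N st => series (fun m => D m 0 st.1 *: (kernel_row p m 0 st.2 : C^o)) N)).
  elim=> [|N IH].
    rewrite (_ : (fun _ => _) = (fun=> 0)); first exact: cmeasurable0.
    by apply/funext => st; rewrite /series/= big_geq.
  rewrite (_ : (fun _ => _) = (fun st => series (fun m => D m 0 st.1 *: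
     (kernel_row p m 0 st.2 : C^o)) N + D N 0 st.1 * kernel_row p N 0 st.2)); last first.
    by apply/funext => st; rewrite seriesSr.
  apply: cmeasurableD => //; apply: cmeasurableM.
    have [m1 m2] := test_cmeasurable (D_test N) 0.
    split; [exact: (measurableT_comp m1 measurable_fst)|exact: (measurableT_comp m2 measurable_fst)].
  have [cr _] := kernel_row_C0 N 0.
  have [m1 m2] := continuous_cmeasurable cr.
  split; [exact: (measurableT_comp m1 measurable_snd)|exact: (measurableT_comp m2 measurable_snd)].
by move=> st; exact: geo_cvg cC _ _ (hc st).
Qed.

Section row_vectors.
Variable z : nat -> L2 mu.
Hypothesis zu : forall m n, inner (z m) (u n) = Num.conj (p m n).
Hypothesis zw : forall m, nrm (z m) <= c0 * w m.

(** [z] stays abstract because it is used twice: z_m = P^* u_m for the kernel itself, and z_m = P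
    u_m for the adjoint kernel, with the conjugate transpose of p. *)
Lemma row_vector_rep m : L2_rep (z m) (fun x => Num.conj (kernel_row p m 0 x)).
Proof.
have [c c1 hc] := kernel_row_geo 0.
have h := basis_expand cL2 u_basis.1 u_basis (x := z m).
refine (@L2_rep_lim _ _ _ mu _ (z m)
  (fun N x => series (fun n => inner (z m) (u n) * D n 0 x) N) _ h _ _).
  move=> N; refine (@L2_rep_series _ _ _ mu (fun n => inner (z m) (u n) *: u n)
    (fun n x => inner (z m) (u n) * D n 0 x) N _) => k; exact: L2_repZ.
move=> x; rewrite (_ : (fun N => _) =
   (fun N => Num.conj (series (fun n => Num.conj (D n 0 x) *: (p m n : C^o)) N))).
  by apply: cvg_conj; exact: geo_cvg cC _ _ (hc m x).
apply/funext => N; rewrite /series/= rmorph_sum; apply: eq_bigr => n _.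
by rewrite zu mulrC; exact/esym/conjMl.
Qed.

(* The i-th derivative of t(s) = sum_m conj (u_m(s)) z_m, where z_m = P^* u_m. *)
Definition carleman_deriv i (s : R) : L2 mu := csum (fun m => Num.conj (D m i s) *: z m).

Lemma carleman_geo i : exists2 c : R, 0 <= c &
  forall s, geo (fun m => Num.conj (D m i s) *: z m) c.
Proof.
have [d d1 hd] := weight_bound i; exists (c0 * d); first exact: mulr_ge0.
move=> s m; rewrite nrmZ Defs.normcJ.
apply: (le_trans (ler_wpM2l (normc_ge0 _) (zw m))).
by have := ler_wpM2l c0_ge0 (hd m s); lra.
Qed.

Lemma carleman_C0_derivatives : C0_derivatives (carleman_deriv 0).
Proof.
exists carleman_deriv; split => //.
- move=> i s; have [c c1 hc] := carleman_geo i; have [d d1 hd] := carleman_geo i.+1.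
  apply: (@has_deriv_csum R (L2 mu) (fun m s => Num.conj (D m i s))
    (fun m s => Num.conj (D m i.+1 s)) z (c + d)) => //.
  + by move=> k t; apply: has_deriv_conj; have [h _] := D_test k; exact: h.
  + move=> t k; apply: (le_trans (hc t k)).
    by rewrite ler_wpM2r ?exprn_ge0// lerDl.
  + move=> t k; apply: (le_trans (hd t k)).
    by rewrite ler_wpM2r ?exprn_ge0// lerDr.
- move=> i; have [c c1 hc] := carleman_geo i.
  apply: (C0_csum (c := c)) => // m.
  by apply: C0_scale; apply: C0_conj; exact: test_C0.
Qed.

Lemma carleman_rep s :
  L2_rep (carleman_deriv 0 s) (fun x => Num.conj (matrix_kernel p 0 0 (s, x))).
Proof.
have [c c1 hc] := carleman_geo 0; have [d d1 hd] := matrix_kernel_geo 0 0.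
refine (@L2_rep_lim _ _ _ mu _ _ (fun N x =>
   series (fun m => Num.conj (D m 0 s) * Num.conj (kernel_row p m 0 x)) N) _
   (geo_cvg cL2 (hc s)) _ _).
  move=> N; refine (@L2_rep_series _ _ _ mu (fun m => Num.conj (D m 0 s) *: z m)
    (fun m x => Num.conj (D m 0 s) * Num.conj (kernel_row p m 0 x)) N _) => k.
  by apply: L2_repZ; exact: row_vector_rep.
move=> x; rewrite (_ : (fun N => _) =
   (fun N => Num.conj (series (fun m => D m 0 s *: (kernel_row p m 0 x : C^o)) N))).
  by apply: cvg_conj; exact: geo_cvg cC _ _ (hd (s, x)).
apply/funext => N; rewrite /series/= rmorph_sum; apply: eq_bigr => n _.
exact/esym/(rmorphM (@Num.conj C)).
Qed.

Lemma square_integrable_conj (f : R -> C) :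
  square_integrable mu (fun x => Num.conj (f x)) -> square_integrable mu f.
Proof.
move=> [mf fi]; split.
  have := cmeasurableJ mf; rewrite (_ : (fun x => _) = f)//.
  by apply/funext => x; rewrite conjCK.
by move: fi; under eq_integral do rewrite Defs.normcJ.
Qed.

Lemma matrix_kernel_Carleman : Carleman_kernel (matrix_kernel p 0 0 : R * R -> C^o).
Proof.
split; first exact: matrix_kernel_measurable.
by apply: aeW => s; apply: square_integrable_conj; exact: (carleman_rep s).1.
Qed.

(** Almost everywhere (P f)(s) = sum_m u_m(s) <f, z_m>. For each s this sum is <f, t(s)> by
    continuity of the inner product, and t(s) is represented by the conjugate of the kernel at (s,
    .). *)
Lemma matrix_kernel_integral (P : L2 mu -> L2 mu) : linear P ->
  (forall f m, inner f (z m) = inner (P f) (u m)) ->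
  integral_operator (matrix_kernel p 0 0 : R * R -> C^o) P.
Proof.
move=> lP Pz; split => //; first exact: matrix_kernel_measurable.
move=> f.
have [c c1 hc] := weight_bound 0.
have gF s : geo (fun m => D m 0 s *: (inner f (z m) : C^o)) (nrm f * c0 * c).
  move=> m; rewrite nrmZ nrm_complex.
  have h := le_trans (normc_inner f (z m)) (ler_wpM2l (nrm_ge0 f) (zw m)).
  apply: (le_trans (ler_wpM2l (normc_ge0 _) h)).
  by have := ler_wpM2l (mulr_ge0 (nrm_ge0 f) c0_ge0) (hc m s); lra.
have PfE : L2_rep (P f) (fun s => csum (fun m => D m 0 s *: (inner f (z m) : C^o))).
  refine (@L2_rep_lim _ _ _ mu _ (P f)
    (fun N s => series (fun m => D m 0 s *: (inner f (z m) : C^o)) N) _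
    (basis_expand cL2 u_basis.1 u_basis (x := P f)) _ _).
    move=> N; rewrite (_ : (fun m => _) = (fun m => inner f (z m) *: u m)); last first.
      by apply/funext => m; rewrite Pz.
    rewrite (_ : (fun s => _) = (fun s => series (fun m => inner f (z m) * D m 0 s) N)).
      refine (@L2_rep_series _ _ _ mu (fun m => inner f (z m) *: u m)
        (fun m s => inner f (z m) * D m 0 s) N _) => k; exact: L2_repZ.
    apply/funext => s; rewrite /series/=; apply: eq_bigr => m _; exact: mulrC.
  by move=> s; exact: geo_cvg cC _ _ (gF s).
have F := ae_filter_ringOfSetsType mu.
apply: filterS PfE.2 => s Ps.
have E : (fun t => matrix_kernel p 0 0 (s, t) * f t) =
    (fun t => f t * Num.conj (Num.conj (matrix_kernel p 0 0 (s, t)))).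
  by apply/funext => t; rewrite conjCK mulrC.
rewrite E; split; first exact: cintegrableMJ (L2_rep_repr f).1 (carleman_rep s).1.
rewrite -(L2_rep_inner (L2_rep_repr f) (carleman_rep s)) Ps.
have [d d1 hd] := carleman_geo 0.
have h1 := geo_cvg cC (gF s).
have := geo_cvg cL2 (hd s) => /(cvg_innerr (y := f)) h2.
rewrite (_ : (fun N => _) = series (fun m => D m 0 s *: (inner f (z m) : C^o))) in h2.
  exact: (cvg_unique (@norm_hausdorff C C^o) h1 h2).
apply/funext => N; rewrite /series/= inner_sumr; apply: eq_bigr => m _.
by rewrite innerZr conjCK.
Qed.

End row_vectors.
End one_matrix.

(** Conjugation and transposition leave the two summations in the wrong order, so the double series
    has to be rearranged. *)
Lemma matrix_kernel_adjoint p c0 : 0 <= c0 -> weighted_matrix p c0 ->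
  adjoint_kernel (matrix_kernel p 0 0 : R * R -> C^o) =
  matrix_kernel (fun m n => Num.conj (p n m)) 0 0.
Proof.
move=> c00 pw; apply/funext => -[s t]; rewrite /adjoint_kernel/=.
have [c c1 hc] := weight_bound 0.
pose a m n := D m 0 t * (Num.conj (D n 0 s) * p m n) : C^o.
have ha m n : nrm (a m n) <= c0 * c * c * 2^-1 ^+ m * 2^-1 ^+ n.
  rewrite nrm_complex !normcM Defs.normcJ.
  apply: (@le_trans _ _ (normc (D m 0 t) * (normc (D n 0 s) * (c0 * (w m * w n))))).
    by rewrite !ler_wpM2l ?normc_ge0.
  have h1 := hc m t; have h2 := hc n s.
  have := ler_pM (mulr_ge0 (w_ge0 m) (normc_ge0 _)) (mulr_ge0 (w_ge0 n) (normc_ge0 _)) h1 h2.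
  by move=> /(ler_wpM2l c00); lra.
have pw' : weighted_matrix (fun m n => Num.conj (p n m)) c0.
  by move=> m n; rewrite Defs.normcJ [w m * _]mulrC; exact: pw.
have [d d1 hd] := kernel_row_geo c00 pw 0; have [d' d1' hd'] := kernel_row_geo c00 pw' 0.
have E1 : matrix_kernel p 0 0 (t, s) = csum (fun m => csum (a m)).
  apply: (congr1 (@csum R C^o)); apply/funext => m.
  exact: (esym (csumZ cC _ (hd m s))).
have g1 m : geo (a m) (c0 * c * c * 2^-1 ^+ m) by [].
have g2 n : geo (a^~ n) (c0 * c * c * 2^-1 ^+ n) by move=> m; rewrite mulrAC.
have G2 : geo (fun n => csum (a^~ n)) (2 * (c0 * c * c)).
  by move=> n; rewrite -[leRHS]mulrA; exact: geo_bound.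
rewrite E1 (csum_exchange cC ha) -(csum_conj G2).
apply: (congr1 (@csum R C^o)); apply/funext => n.
rewrite -(csum_conj (g2 n)); have := csumZ cC (D n 0 s) (hd' n t) => <-.
apply: (congr1 (@csum R C^o)); apply/funext => m; rewrite /a.
rewrite -[RHS]/(D n 0 s * (Num.conj (D m 0 t) * Num.conj (p m n))).
by rewrite !rmorphM/= conjCK mulrCA.
Qed.

End kernels_from_matrices.

(** * From operators small on the basis to kernels of Mercer type *)

Section mercer.
Variable R : realType.
Local Notation C := R[i].
Local Notation mu := (@lebesgue_measure R).

(** A diagonal choice: the n-th weight tames only the derivatives of order at most n. For a fixed
    order i the remaining indices n < i are finitely many and go into the constant. *)
Lemma smoothing_weights (D : nat -> nat -> R -> C) : (forall n, test_derivatives (D n)) ->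
  (forall n i s, ~~ odd n -> (i <= n)%N -> normc (D n i s) <= 2^-1 ^+ n) ->
  exists w : nat -> R, [/\ forall n, 0 < w n <= 1, forall n, ~~ odd n -> w n = 1 &
    forall i, exists c : R, forall n s, w n * normc (D n i s) <= c * 2^-1 ^+ n].
Proof.
move=> tD De.
have /choice[M hM] : forall n, exists M : nat -> R, forall i x, normc (D n i x) <= M i.
  by move=> n; have /choice[M h] := test_bounded (tD n); exists M.
have M0 n i : 0 <= M n i by apply: le_trans (hM n i 0); exact: normc_ge0.
pose B n := 1 + \sum_(i < n.+1) M n i.
have B1 n : 1 <= B n by rewrite lerDl sumr_ge0.
have B0 n : 0 < B n by exact: lt_le_trans (B1 n).
pose w n := if odd n then 2^-1 ^+ n / B n else 1.
have w1 n : 0 < w n <= 1.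
  rewrite /w; case: ifP => _; last by rewrite ltr01 lexx.
  rewrite divr_gt0 ?exprn_gt0 ?invr_gt0//= ler_pdivrMr// mul1r.
  apply: le_trans (B1 n); rewrite exprn_ile1 ?invr_ge0// invf_le1// ler1n//.
exists w; split => //; first by move=> n /negbTE; rewrite /w => ->.
move=> i; pose c := 1 + \sum_(n < i) M n i * 2 ^+ n.
have c1 : 1 <= c by rewrite lerDl sumr_ge0// => n _; rewrite mulr_ge0// exprn_ge0.
exists c => n s; have [ni|ni] := leqP i n.
  apply: (@le_trans _ _ (1 * 2^-1 ^+ n)); last by rewrite ler_wpM2r// exprn_ge0// invr_ge0.
  rewrite mul1r /w; case: ifPn => no; last by rewrite mul1r; exact: De.
  rewrite mulrAC ler_pdivrMr// ler_wpM2l ?exprn_ge0 ?invr_ge0//.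
  apply: (le_trans (hM n i s)); rewrite /B (bigD1 (Ordinal (ni : (i < n.+1)%N)))//=.
  by rewrite addrCA lerDl addr_ge0// sumr_ge0.
rewrite exprVn ler_pdivlMr ?exprn_gt0//.
apply: (@le_trans _ _ (M n i * 2 ^+ n)).
  rewrite ler_wpM2r ?exprn_ge0//; apply: le_trans (hM n i s).
  by have /andP[_ h] := w1 n; rewrite ler_piMl ?normc_ge0.
by rewrite /c (bigD1 (Ordinal ni))//= addrCA lerDl addr_ge0// sumr_ge0// => k _;
  rewrite mulr_ge0// exprn_ge0.
Qed.

Section fixed_basis.
Variables (u : nat -> L2 mu) (D : nat -> nat -> R -> C) (w : nat -> R).
Hypothesis u_basis : orthonormal_basis u.
Hypothesis D_test : forall n, test_derivatives (D n).
Hypothesis uD : forall n, L2_rep (u n) (D n 0).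
Hypothesis w01 : forall n, 0 < w n <= 1.
Hypothesis wD : forall i, exists c : R, forall n s, w n * normc (D n i s) <= c * 2^-1 ^+ n.

Let cL2 : seq_complete (L2 mu) := @L2_seq_complete _ _ _ mu.
Let w_ge0 n : 0 <= w n.
Proof. by have /andP[/ltW] := w01 n. Qed.
Let w_sqr n : w n ^+ 2 <= w n.
Proof. by have /andP[_ h] := w01 n; rewrite expr2 ler_piMl. Qed.

(** The last hypothesis is the bound on P^* u_m in weak form; thus it can be checked on a
    factorisation P = X A without the adjoint of A. *)
Lemma Kinf_of_decay (P : L2 mu -> L2 mu) (c : R) : 0 <= c -> bounded_operator P ->
  (forall n, nrm (P (u n)) <= c * w n ^+ 2) ->
  (forall x m, normc (inner (P x) (u m)) <= nrm x * (c * w m ^+ 2)) ->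
  exists2 K, Kinf_kernel K & integral_operator K P.
Proof.
move=> c0 bP Pu Px.
have Padj := adjoint_exists bP cL2 u_basis.
pose p m n := inner (P (u n)) (u m).
have pw : weighted_matrix w p c.
  move=> m n; have h1 := Px (u n) m; rewrite (nrm_orthonormal _ u_basis.1) mul1r in h1.
  have h2 : normc (p m n) <= c * w n ^+ 2.
    apply: le_trans (Pu n); apply: (le_trans (normc_inner _ _)).
    by rewrite (nrm_orthonormal _ u_basis.1) mulr1.
  have [mn|/ltW nm] := leP (w m) (w n).
    by apply: (le_trans h1); rewrite ler_wpM2l// expr2 ler_wpM2l.
  by apply: (le_trans h2); rewrite ler_wpM2l// expr2 ler_wpM2r.
have pw' : weighted_matrix w (fun m n => Num.conj (p n m)) c.
  by move=> m n; rewrite Defs.normcJ [w m * _]mulrC; exact: pw.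
pose z m := adjoint P (u m).
have zu m n : inner (z m) (u n) = Num.conj (p m n) by rewrite innerC -Padj.
have zw m : nrm (z m) <= c * w m.
  apply: (@le_trans _ _ (c * w m ^+ 2)); last by rewrite ler_wpM2l.
  have [->|z0] := eqVneq (nrm (z m)) 0; first by rewrite mulr_ge0// sqr_ge0.
  have zp : 0 < nrm (z m) by rewrite lt0r z0 nrm_ge0.
  (* The weak bound is tested on z_m itself, where <P z_m, u_m> = |z_m|^2. *)
  rewrite -(ler_pM2l zp) -expr2; have := Px (z m) m.
  by rewrite Padj nrm_inner normcR ger0_norm ?sqr_ge0.
have zu' m n : inner (P (u m)) (u n) = Num.conj (Num.conj (p n m)) by rewrite conjCK.
have zw' m : nrm (P (u m)) <= c * w m.
  by apply: (le_trans (Pu m)); rewrite ler_wpM2l.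
have adjE := matrix_kernel_adjoint w_ge0 wD c0 pw.
exists (matrix_kernel D p 0 0).
  split.
  - split; first exact: (matrix_kernel_Carleman u_basis D_test uD w_ge0 wD c0 pw zu zw).
    by rewrite adjE; exact: (matrix_kernel_Carleman u_basis D_test uD w_ge0 wD c0 pw' zu' zw').
  - exact: (matrix_kernel_partial D_test w_ge0 wD c0 pw).
  - exists (carleman_deriv D z 0).
      by move=> s; exact: (carleman_rep u_basis uD w_ge0 wD c0 pw zu zw).
    exact: (carleman_C0_derivatives D_test w_ge0 wD c0 zw).
  - exists (carleman_deriv D (fun m => P (u m)) 0).
      rewrite adjE => s.
      exact: (carleman_rep u_basis uD w_ge0 wD c0 pw' zu' zw').
    exact: (carleman_C0_derivatives D_test w_ge0 wD c0 zw').
apply: (matrix_kernel_integral u_basis D_test uD w_ge0 wD c0 pw zu zw).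
  by have [] := bP.
by move=> f m; rewrite Padj.
Qed.

(** The condition is symmetric in T and its adjoint A and stable under linear combinations, so
    combinations of the transported family need no separate argument. A is carried as a witness so
    that the adjoint of a combination can be written down. *)
Definition small_operator (T : L2 mu -> L2 mu) := bounded_operator T /\
  exists (A : L2 mu -> L2 mu) (c : R), [/\ forall x y, inner (T x) y = inner x (A y), 0 <= c,
    forall n, nrm (T (u n)) <= c * w n ^+ 2 & forall n, nrm (A (u n)) <= c * w n ^+ 2].

Lemma small_operator0 : small_operator (fun=> 0).
Proof.
split.
  by apply: (@bounded_operatorP _ _ _ _ 0) => [a x y|x]; rewrite ?scaler0 ?addr0// nrm0 mul0r.
exists (fun=> 0), 0; split => //; first by move=> x y; rewrite inner0l inner0r.
  by move=> n; rewrite nrm0 mul0r.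
by move=> n; rewrite nrm0 mul0r.
Qed.

Lemma small_operator_lin a T V : small_operator T -> small_operator V ->
  small_operator (fun x => a *: T x + V x).
Proof.
move=> [bT [A [c [TA c0 Tc Ac]]]] [bV [B [d [VB d0 Vd Bd]]]]; split.
  have [M M0 TM] := bounded_nrm bT; have [N N0 VN] := bounded_nrm bV.
  apply: (@bounded_operatorP _ _ _ _ (normc a * M + N)).
    move=> b x y; rewrite (boundedD bT) (boundedZ bT) (boundedD bV) (boundedZ bV).
    by rewrite !scalerDr !scalerA [b * a]mulrC addrACA.
  move=> x; apply: (le_trans (nrmD _ _)); rewrite nrmZ mulrDl lerD// -mulrA.
  by rewrite ler_wpM2l ?normc_ge0.
exists (fun x => Num.conj a *: A x + B x), (normc a * c + d).
have key (f g : L2 mu) b n : normc b = normc a -> nrm f <= c * w n ^+ 2 -> nrm g <= d * w n ^+ 2 ->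
    nrm (b *: f + g) <= (normc a * c + d) * w n ^+ 2.
  move=> ba fc gd; apply: (le_trans (nrmD _ _)); rewrite nrmZ mulrDl lerD// ba -mulrA.
  by rewrite ler_wpM2l ?normc_ge0.
split.
- by move=> x y; rewrite innerDl innerZl TA VB innerDr innerZr conjCK.
- by rewrite addr_ge0// mulr_ge0 ?normc_ge0.
- by move=> n; exact: key.
- by move=> n; apply: key => //; rewrite Defs.normcJ.
Qed.

Lemma small_operator_sum (m : nat) (c : 'I_m -> C) (T : 'I_m -> L2 mu -> L2 mu) :
  (forall i, small_operator (T i)) -> small_operator (fun f => \sum_(i < m) c i *: T i f).
Proof.
move=> sT; elim: (index_enum _) => [|i r IH].
  rewrite (_ : (fun f => _) = (fun=> 0)); first exact: small_operator0.
  by apply/funext => f; rewrite big_nil.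
rewrite (_ : (fun f => _) = (fun f => c i *: T i f + \sum_(i <- r) c i *: T i f)).
  exact: small_operator_lin.
by apply/funext => f; rewrite big_cons.
Qed.

Lemma Mset_Kinf T P : small_operator T -> Mset T P ->
  exists2 K, Kinf_kernel K & integral_operator K P.
Proof.
move=> [bT [A [c [TA c0 Tc Ac]]]] MP.
have AT x y : inner (A x) y = inner x (T y).
  by rewrite innerC -TA -innerC.
have bA := bounded_of_adjoint bT TA.
have adjT : adjoint T = A by exact: adjoint_spec.
(* X' is the adjoint of X: the pair (X, X') is (T, A) or (A, T), and both members are small on the
   basis. *)
have [X [X' [A1 [PX bX bA1 XX' X'c]]]] : exists (X X' A1 : L2 mu -> L2 mu),
   [/\ P = X \o A1, bounded_operator X, bounded_operator A1,
     forall x y, inner (X x) y = inner x (X' y) & forall n, nrm (X' (u n)) <= c * w n ^+ 2].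
  have [[[A1 bA1 PE]|[A1 bA1 PE]] _] := MP.
    by exists T, A, A1; split.
  by exists A, T, A1; rewrite -adjT; split => //; rewrite adjT.
have [Y [A2 [PY bA2 Yc]]] : exists (Y A2 : L2 mu -> L2 mu),
   [/\ P = A2 \o Y, bounded_operator A2 & forall n, nrm (Y (u n)) <= c * w n ^+ 2].
  have [_ [[A2 bA2 PE]|[A2 bA2 PE]]] := MP.
    by exists T, A2; split.
  by exists A, A2; rewrite -adjT; split => //; rewrite adjT.
have [M M0 A1M] := bounded_nrm bA1; have [N N0 A2N] := bounded_nrm bA2.
apply: (@Kinf_of_decay P ((M + N) * c)).
- by rewrite mulr_ge0// addr_ge0.
- by rewrite PX; exact: bounded_comp.
- move=> n; rewrite PY /=; apply: (le_trans (A2N _)).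
  have := ler_wpM2l N0 (Yc n); have := mulr_ge0 M0 (mulr_ge0 c0 (sqr_ge0 (w n))).
  lra.
- move=> x m; rewrite PX /= XX'; apply: (le_trans (normc_inner _ _)).
  have := ler_pM (nrm_ge0 _) (nrm_ge0 _) (A1M x) (X'c m).
  have := mulr_ge0 (nrm_ge0 x) (mulr_ge0 N0 (mulr_ge0 c0 (sqr_ge0 (w m)))).
  lra.
Qed.

(** T lies in M(T), with the identity as the other factor, so the statement on M(T) yields the
    kernel of T as well. *)
Lemma small_operator_Mercer T : small_operator T ->
  exists2 K, biCarleman_operator K T & Mercer_type K T.
Proof.
move=> sT; have bid : bounded_operator (@id (L2 mu)).
  by apply: (@bounded_operatorP _ _ _ _ 1) => // x; rewrite mul1r.
have [|K KK KT] := @Mset_Kinf T T sT.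
  by split; left; exists id.
exists K; first by split => //; have [] := KK.
by split => // P; exact: Mset_Kinf.
Qed.

End fixed_basis.
End mercer.

Lemma sup_norm_near (R : realType) (H : preHilbertType R) (G : Type) (F : nat -> G -> H) :
  sup_norm (F n) @[n --> \oo] --> 0%E -> forall eps : R, 0 < eps ->
  \forall n \near \oo, forall g, nrm (F n g) <= eps.
Proof.
move=> F0 eps e0; have : \forall n \near \oo, (sup_norm (F n) < eps%:E)%E.
  by apply: (F0 [set x | (x < eps%:E)%E]); apply: open_nbhs_nbhs; split;
    [exact: open_ereal_lt_ereal|rewrite /= lte_fin].
apply: filterS => n h g; rewrite -lee_fin; apply: le_trans (ltW h).
by apply: ereal_sup_ubound; right; exists g.
Qed.

(** * Transport by a unitary operator and conclusion *)

Section transport.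
Variable R : realType.
Variables (H K : preHilbertType R) (U : H -> K) (Ui : K -> H).
Hypothesis U_unitary : unitary_operator U.
Hypotheses (UK : cancel U Ui) (UiK : cancel Ui U).

Lemma unitary_bounded : bounded_operator U.
Proof. by have [] := U_unitary. Qed.

Lemma nrm_unitary x : nrm (U x) = nrm x.
Proof.
have [_ _ UI] := U_unitary; apply/eqP.
by rewrite -(@eqrXn2 _ 2)// ?nrm_ge0// -(inj_eq (@complexI R)) -!nrm_inner UI.
Qed.

Lemma inner_unitary_inv x y : inner (U x) y = inner x (Ui y).
Proof. by have [_ _ UI] := U_unitary; rewrite -[y in LHS]UiK UI. Qed.

Lemma unitary_inv_bounded : bounded_operator Ui.
Proof. exact: bounded_of_adjoint unitary_bounded inner_unitary_inv. Qed.

End transport.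

Theorem theorem9 (R : realType) (H : hilbertType R)
  (Hsep : separable H) (Hinf : infinite_dimensional H)
  (G : Type) (S : G -> H -> H) (Sbnd : forall g, bounded_operator (S g))
  (Sseq : exists e : nat -> H, [/\ orthonormal_sequence e,
     sup_norm (fun g => S g (e n)) @[n --> \oo] --> 0%E &
     sup_norm (fun g => adjoint (S g) (e n)) @[n --> \oo] --> 0%E]) :
  exists (U : H -> L2R R) (Uinv : L2R R -> H),
    [/\ unitary_operator U, cancel U Uinv, cancel Uinv U,
     forall g, let T := U \o S g \o Uinv in
       exists2 K, biCarleman_operator K T & Mercer_type K T &
     forall (m : nat) (c : 'I_m -> R[i]) (g : 'I_m -> G),
       let T := fun f => \sum_(i < m) c i *: (U \o S (g i) \o Uinv) f in
       exists2 K, biCarleman_operator K T & Mercer_type K T].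
Proof.
have [e [oe Se Sse]] := Sseq.
have cH : seq_complete H := @complete_seq_complete R H.
have [u [D [bu tD uD De]]] := L2_smooth_basis R.
have [w [w01 weven wD]] := smoothing_weights tD De.
have w0 n : 0 < w n by have /andP[] := w01 n.
(* An auxiliary basis: the adjoints of the [S g] must be known to exist before the adapted basis,
   which depends on them, can be built. *)
have [b0 bb0 _] : exists2 b : nat -> H, orthonormal_basis b & forall n, odd n -> True.
  apply: (@hilbert_basis R H Hsep (fun _ _ => True)) => n v ov.
  have [|z [z1 zv _]] := escape_unit (P := fun _ => True) oe ltr01 ov; first exact: nearW.
  by exists z.
have adj g := adjoint_exists (Sbnd g) cH bb0.
have badj g := bounded_of_adjoint (Sbnd g) (adj g).
(* M is quantified inside, so that v is chosen independently of g although the norms of the [S g]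
   need not be bounded in g. *)
pose Good n (v : H) := forall g M, 0 <= M -> (forall x, nrm (S g x) <= M * nrm x) ->
  (forall x, nrm (adjoint (S g) x) <= M * nrm x) ->
  nrm (S g v) <= 2 * (1 + M) * w n ^+ 2 /\ nrm (adjoint (S g) v) <= 2 * (1 + M) * w n ^+ 2.
have [b bb Gb] : exists2 b : nat -> H, orthonormal_basis b & forall n, odd n -> Good n (b n).
  apply: hilbert_basis => // n v ov.
  have w20 : 0 < w n ^+ 2 by rewrite exprn_gt0.
  pose small_at k := (forall g, nrm (S g (e k)) <= w n ^+ 2) /\
    (forall g, nrm (adjoint (S g) (e k)) <= w n ^+ 2).
  have ne : \forall k \near \oo, small_at k.
    exact: filterI (sup_norm_near Se w20) (sup_norm_near Sse w20).
  (* With eps = w_n^2 the estimate reads 2 (w_n^2 + M w_n^2), the constant in [Good]. *)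
  have [z [z1 zv [k [h1 h2] hk]]] := escape_unit (P := small_at) oe w20 ov ne.
  exists z; split => // g M M0 SM SsM; split.
    apply: (le_trans (hk _ _ M0 (Sbnd g) SM)); have := h1 g; lra.
  by apply: (le_trans (hk _ _ M0 (badj g) SsM)); have := h2 g; lra.
have [U [Ui [uU UK UiK Ub Uiu]]] := unitary_of_bases cH (@L2_seq_complete _ _ _ _) bb bu.
have small g : small_operator u w (U \o S g \o Ui).
  have [M M0 SM] := bounded_nrm (Sbnd g); have [N N0 SN] := bounded_nrm (badj g).
  have bU := unitary_bounded uU; have bUi := unitary_inv_bounded uU UiK.
  split; first by apply: bounded_comp => //; exact: bounded_comp.
  have SM' x : nrm (S g x) <= (M + N) * nrm x.
    by apply: (le_trans (SM x)); rewrite ler_wpM2r ?nrm_ge0// lerDl.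
  have SN' x : nrm (adjoint (S g) x) <= (M + N) * nrm x.
    by apply: (le_trans (SN x)); rewrite ler_wpM2r ?nrm_ge0// lerDr.
  have MN0 : 0 <= M + N by exact: addr_ge0.
  have key n : nrm (S g (b n)) <= 2 * (1 + (M + N)) * w n ^+ 2 /\
               nrm (adjoint (S g) (b n)) <= 2 * (1 + (M + N)) * w n ^+ 2.
    have [no|no] := boolP (odd n); first exact: Gb.
    (* For even n the weight is 1 and plain boundedness suffices. *)
    rewrite (weven n no) expr1n mulr1.
    have := SM' (b n); have := SN' (b n); rewrite (nrm_orthonormal _ bb.1) mulr1 => h1 h2.
    by split; lra.
  exists (U \o adjoint (S g) \o Ui), (2 * (1 + (M + N))); split.
  - move=> x y /=; rewrite (inner_unitary_inv uU UiK) adj.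
    by have [_ _ UI] := uU; rewrite -[x in RHS]UiK UI.
  - by rewrite mulr_ge0// addr_ge0.
  - by move=> n /=; rewrite (nrm_unitary uU) Uiu; have [] := key n.
  - by move=> n /=; rewrite (nrm_unitary uU) Uiu; have [] := key n.
exists U, Ui; split => //.
- move=> g; exact: (small_operator_Mercer bu tD uD w01 wD (small g)).
- move=> m c g; apply: (small_operator_Mercer bu tD uD w01 wD).
  by apply: (small_operator_sum c (T := fun i => U \o S (g i) \o Ui)) => i; exact: small.
Qed.
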